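(* Let $T$ be a square cell of side length $h>0$ of a uniform cartesian mesh of the plane, let $S=S_T$ be a rectangular stencil of $m=\#(S)$ cells of this mesh centered around $T$, and let $V_n$ be an $n$-parameter family of characteristic functions (a possibly nonlinear subset of $L^1(S)$). Assume that the stability property $$h^2\|a_S(v)\|_{\ell^1}\le \|v\|_{L^1(S)},\qquad v\in L^1(S),$$ holds, and that the inverse stability property $$\|v-\tilde v\|_{L^1(S)}\le C h^2\|a_S(v)-a_S(\tilde v)\|_{\ell^1},\qquad v,\tilde v\in V_n,$$ holds for some constant $C$ independent of $h$. Then the recovery by $\ell^2$ minimization, that is $\tilde u_T=R_T(a_S(u))$ with $$\tilde u_T\in \operatorname*{arg\,min}_{v\in V_n}\|a_S(v)-a_S(u)\|_{\ell^2},$$ is near optimal in $L^1$ norm with multiplicative constant $1+2C\sqrt m$: $$\|u-\tilde u_T\|_{L^1(T)}\le (1+2C\sqrt m)\, e_n(u)_S .$$ In the case of linear interfaces using $3\times 3$ stencils (the LVIRA method), i.e. when $S$ is the $3\times3$ stencil centered at $T$ and $V_n=V_2$ is the family of functions $\chi_H$, with $H$ a half-plane whose boundary line passes through $T$, this constant is $1+2\cdot\frac32\sqrt 9=10$.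
   Context: The mesh consists of the cells $h(k+[0,1]^2)$, $k\in\mathbb Z^2$. A rectangular stencil centered around $T$ is the set of $m=(2k+1)\times(2l+1)$ cells ($k,l\ge 1$) forming a rectangle symmetric around $T$; $S$ also denotes the union of these cells when writing $L^1(S)$. For an integrable $v$ and a cell $\tilde T$, $a_{\tilde T}(v)=\frac1{|\tilde T|}\int_{\tilde T}v(x)\,dx$ is the cell average, and $a_S(v)=(a_{\tilde T}(v))_{\tilde T\in S}\in\mathbb R^m$. The error of best approximation is $e_n(u)_S=\min_{v\in V_n}\|u-v\|_{L^1(S)}$. The function $u\in L^1(S)$ is the unknown function, known only through $a_S(u)$; in the paper $u=\chi_\Omega$ is the characteristic function of a set $\Omega$. The bound is asserted for any minimizer $\tilde u_T$. *)

(* Defs.v *)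
From HB Require Import structures.
From mathcomp Require Import all_boot all_order all_algebra.
From mathcomp Require Import all_classical all_reals all_analysis.
Set Implicit Arguments.
Unset Strict Implicit.
Unset Printing Implicit Defensive.
Import Order.TTheory GRing.Theory Num.Theory.
Import numFieldNormedType.Exports.
Local Open Scope classical_set_scope.
Local Open Scope ring_scope.

Section Recovery.
Context {R : realType}.

Definition plane := (measurableTypeR R * measurableTypeR R)%type.

Definition area : set plane -> \bar R :=
  (@lebesgue_measure R \x @lebesgue_measure R)%E.

(* The elements of L^1(A) are represented by functions on the whole plane;
   only their restriction to A matters. *)
Definition L1 (A : set plane) : set (plane -> R) :=
  [set v | area.-integrable A (fun x => (v x)%:E)].

Definition L1norm (A : set plane) (v : plane -> R) : R :=
  \int[area]_(x in A) `|v x|.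

Definition cell (h : R) (t : int * int) : set plane :=
  `[h * t.1%:~R, h * (t.1%:~R + 1)] `*` `[h * t.2%:~R, h * (t.2%:~R + 1)].

(* Mesh index of the cell in position (i, j) of the (2k+1) x (2l+1) stencil
   centered around the cell of index t; (i, j) = (k, l) gives t itself. *)
Definition stencil_index (t : int * int) (k l : nat)
    (i : 'I_(k.*2.+1)) (j : 'I_(l.*2.+1)) : int * int :=
  (t.1 + i%:Z - k%:Z, t.2 + j%:Z - l%:Z).

Definition stencil (h : R) (t : int * int) (k l : nat) : set plane :=
  [set x | exists i j, cell h (@stencil_index t k l i j) x].

Definition stencil_card (k l : nat) : nat := (k.*2.+1 * l.*2.+1)%N.

Definition cell_average (Q : set plane) (v : plane -> R) : R :=
  (fine (area Q))^-1 * \int[area]_(x in Q) v x.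

(* a_S(v); the vector of R^m is arranged as a (2k+1) x (2l+1) array. *)
Definition stencil_averages (h : R) (t : int * int) (k l : nat)
    (v : plane -> R) : 'M[R]_(k.*2.+1, l.*2.+1) :=
  \matrix_(i, j) cell_average (cell h (stencil_index t i j)) v.

Definition ell1 (p q : nat) (a : 'M[R]_(p, q)) : R :=
  \sum_i \sum_j `|a i j|.

Definition ell2 (p q : nat) (a : 'M[R]_(p, q)) : R :=
  Num.sqrt (\sum_i \sum_j `|a i j| ^+ 2).

Definition parametric_family (n : nat) (V : set (plane -> R)) : Prop :=
  exists (P : set 'rV[R]_n) (Omega : 'rV[R]_n -> set plane),
    V = [set \1_(Omega p) | p in P].

Definition stable (h : R) (t : int * int) (k l : nat) : Prop :=
  forall v, L1 (stencil h t k l) v ->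
    h ^+ 2 * ell1 (stencil_averages h t k l v) <= L1norm (stencil h t k l) v.

Definition inverse_stable (h : R) (t : int * int) (k l : nat)
    (V : set (plane -> R)) (C : R) : Prop :=
  forall v w, V v -> V w ->
    L1norm (stencil h t k l) (v \- w) <=
    C * h ^+ 2 *
      ell1 (stencil_averages h t k l v - stencil_averages h t k l w).

(* e_n(u)_S; the infimum is the minimum whenever the latter exists. *)
Definition best_error (h : R) (t : int * int) (k l : nat)
    (V : set (plane -> R)) (u : plane -> R) : R :=
  inf [set L1norm (stencil h t k l) (u \- v) | v in V].

Definition ell2_recovery (h : R) (t : int * int) (k l : nat)
    (V : set (plane -> R)) (u : plane -> R) : set (plane -> R) :=
  [set w | V w /\ forall v, V v ->
     ell2 (stencil_averages h t k l w - stencil_averages h t k l u) <=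
     ell2 (stencil_averages h t k l v - stencil_averages h t k l u)].

Definition near_optimal (h : R) (t : int * int) (k l : nat)
    (V : set (plane -> R)) (K : R) : Prop :=
  forall u w, L1 (stencil h t k l) u -> ell2_recovery h t k l V u w ->
    L1norm (cell h t) (u \- w) <= K * best_error h t k l V u.

Definition half_plane (a b c : R) : set plane :=
  [set x | a * x.1 + b * x.2 <= c].

Definition boundary_line (a b c : R) : set plane :=
  [set x | a * x.1 + b * x.2 = c].

Definition lvira_family (h : R) (t : int * int) : set (plane -> R) :=
  [set v | exists a b c : R,
     [/\ (a, b) != (0, 0),
         boundary_line a b c `&` cell h t !=set0
       & v = \1_(half_plane a b c)]].

End Recovery.

Arguments plane R : clear implicits.

(* Main.v *)
Require Import Defs.
From HB Require Import structures.
From mathcomp Require Import all_boot all_order all_algebra.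
From mathcomp Require Import all_classical all_reals all_analysis.
From mathcomp Require Import measurable_realfun.
From mathcomp Require Import ring lra.
Set Implicit Arguments.
Unset Strict Implicit.
Unset Printing Implicit Defensive.
Import Order.TTheory GRing.Theory Num.Theory.
Import numFieldNormedType.Exports.
Local Open Scope classical_set_scope.
Local Open Scope ring_scope.

(** Near optimality under stability is a triangle inequality.  For v in the
    family, the distance from v to the recovered w is controlled, through the
    inverse stability and the Cauchy-Schwarz inequality, by the l2 distance of
    their averages; w being a closest point to the data, the parallelogram
    identity bounds that distance by twice the l2 distance from the averages
    of v to the data, and stability bounds the latter by the L1 distance from
    u to v ([near_optimal_stable]).  Stability itself always holds, because
    cells overlap in null sets only ([stable_stencil]).

    The constant 3/2 of the LVIRA family is the substance.  For two half-planes
    whose boundary lines meet T, let p and q be the areas, in each of the nine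
    cells, of the two parts of the symmetric difference.  The L1 distance is
    the sum of the p + q, while h^2 times the difference of averages is p - q.
    Since |p - q| = p + q - 2 min (p, q), inverse stability with constant 3/2
    says exactly that 6 sum min (p, q) <= sum (p + q)
    ([half_planes_balanced_all]).  Equality occurs for opposite half-planes
    bounded by a line through the center of T parallel to a side or to a
    diagonal, so that no estimate below has much room.

    The lines are seen as graphs y = k - m x, in coordinates where T is the
    unit square, and the proof depends on their relative position.

    If both half-planes lie on the same side of their graphs, the symmetric
    difference is the region between the graphs, a double wedge.  When the
    slopes have opposite signs, only one column contains parts of both signs,
    and the gap between the graphs widens away from the crossing
    ([graphs_balanced_adjacent]).  When the slopes have the same sign, only the
    cell containing the crossing has parts of both signs; homogeneous scaling
    by 2 or 3 from the crossing, and translations of each wedge into itself,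
    produce enough area in the other cells ([graphs_balanced_same]).

    If the half-planes lie on opposite sides of their graphs, the two parts are
    the region below both graphs and the region above both graphs.  When the
    slopes have the same sign and a product at most 1, the inequality holds
    column by column ([column_outer], [column_center]); the other cases are
    reduced to these by exchanging the coordinates, which inverts the slopes.
    There remain a horizontal and a vertical line, for which all areas are
    products ([balanced_perpendicular]). *)

(** The other hypotheses often mention integrals, which are costly atoms for
    linear arithmetic. *)
Tactic Notation "lra_from" ne_hyp_list(hs) := clear - hs; lra.

(** * Integrals over compact intervals *)

Section Integral1D.
Context {R : realType}.
Implicit Types (a b c k d m : R) (F G : R -> R).

Definition integ a b F : R := \int[@lebesgue_measure R]_(x in `[a, b]) F x.

Lemma continuous_itv_integrable a b F : continuous F ->
  (@lebesgue_measure R).-integrable `[a, b] (EFin \o F).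
Proof.
move=> cF; apply: continuous_compact_integrable; first exact: segment_compact.
exact: continuous_subspaceT.
Qed.

Lemma integ_le a b F G : continuous F -> continuous G ->
  (forall x, a <= x <= b -> F x <= G x) -> integ a b F <= integ a b G.
Proof.
move=> cF cG FG; apply: le_Rintegral => //; try exact: continuous_itv_integrable.
Qed.

Lemma eq_integ a b F G : (forall x, a <= x <= b -> F x = G x) ->
  integ a b F = integ a b G.
Proof.
by move=> FG; apply: eq_Rintegral => x; rewrite inE/= in_itv/=; exact: FG.
Qed.

Lemma integ_ge0 a b F : (forall x, a <= x <= b -> 0 <= F x) -> 0 <= integ a b F.
Proof. by move=> F0; apply: Rintegral_ge0 => x /=; rewrite in_itv/=; exact: F0. Qed.

Lemma integ_cat a c b F : continuous F -> a <= c <= b ->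
  integ a b F = integ a c F + integ c b F.
Proof.
move=> cF /andP[ac cb].
have iF : (@lebesgue_measure R).-integrable `[a, b] (EFin \o F).
  exact: continuous_itv_integrable.
have := @Rintegral_itvB R F (BLeft a) (BRight b) c iF.
rewrite !bnd_simp => /(_ ac cb) H.
apply/eqP; rewrite addrC -subr_eq; apply/eqP; rewrite /integ H.
rewrite Rintegral_itv_obnd_cbnd//.
apply: integrableS iF => //; apply: subset_itvr; by rewrite bnd_simp.
Qed.

Lemma integ_cst a b k : a <= b -> integ a b (fun=> k) = k * (b - a).
Proof.
move=> ab; rewrite /integ Rintegral_cst//; congr (_ * _).
rewrite [X in fine X](lebesgue_measure_itv `[a, b])/= lte_fin.
by case: ltgtP ab => //= -> _; rewrite subrr.
Qed.

Lemma integD a b F G : continuous F -> continuous G ->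
  integ a b (fun x => F x + G x) = integ a b F + integ a b G.
Proof. by move=> cF cG; apply: RintegralD => //; exact: continuous_itv_integrable. Qed.

Lemma integB a b F G : continuous F -> continuous G ->
  integ a b (fun x => F x - G x) = integ a b F - integ a b G.
Proof. by move=> cF cG; apply: RintegralB => //; exact: continuous_itv_integrable. Qed.

Lemma integZ a b k F : continuous F ->
  integ a b (fun x => k * F x) = k * integ a b F.
Proof. by move=> cF; apply: RintegralZl => //; exact: continuous_itv_integrable. Qed.

Lemma continuous_affine m k : continuous (fun x : R => m * x + k).
Proof.
by move=> x; apply: cvgD; [apply: cvgM; [exact: cvg_cst|exact: cvg_id]|exact: cvg_cst].
Qed.

Lemma derive1_affine m k : derive1 (fun x : R => m * x + k) = cst m.
Proof.
apply/funext => x; rewrite derive1E deriveD// deriveM// !derive_cst derive_id.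
by rewrite /= scaler0 addr0 addr0 [LHS]mulr1.
Qed.

Lemma integ_subst k d a b F : 0 < k -> a <= b -> continuous F ->
  integ (k * a + d) (k * b + d) F = k * integ a b (fun x => F (k * x + d)).
Proof.
move=> k0 ab cF.
rewrite -integZ; last first.
  by move=> x; apply: continuous_comp; [exact: continuous_affine|exact: cF].
rewrite /integ /Rintegral; congr fine.
rewrite (@integration_by_substitution_increasing R (fun x => k * x + d) F a b)//.
- by apply: eq_integral => x _; rewrite derive1_affine /= mulrC.
- by move=> x y _ _ xy; rewrite ltrD2r ltr_pM2l.
- by rewrite derive1_affine => x _; exact: cvg_cst.
- by rewrite derive1_affine; exact: is_cvg_cst.
- by rewrite derive1_affine; exact: is_cvg_cst.
- split => //.
  + by apply: cvg_at_right_filter; exact: continuous_affine.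
  + by apply: cvg_at_left_filter; exact: continuous_affine.
- exact: continuous_subspaceT.
Qed.

Lemma integ_reflect d a b F : a <= b -> continuous F ->
  integ (d - b) (d - a) F = integ a b (fun x => F (d - x)).
Proof.
move=> ab cF.
rewrite /integ /Rintegral; congr fine.
have E x : d - x = -1 * x + d by ring.
rewrite !E.
rewrite (@integration_by_substitution_decreasing R (fun x => -1 * x + d) F a b)//.
- by apply: eq_integral => x _; rewrite fctE derive1_affine /= opprK mulr1 E.
- by move=> x y _ _ xy; rewrite ltrD2r !mulN1r ltrN2.
- by rewrite derive1_affine => x _; exact: cvg_cst.
- by rewrite derive1_affine; exact: is_cvg_cst.
- by rewrite derive1_affine; exact: is_cvg_cst.
- split => //.
  + by apply: cvg_at_right_filter; exact: continuous_affine.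
  + by apply: cvg_at_left_filter; exact: continuous_affine.
- exact: continuous_subspaceT.
Qed.

Lemma integ_id a b : a <= b -> integ a b id = (b - a) * ((a + b) / 2).
Proof.
move=> ab.
have cid : continuous (@id R) by move=> x; exact: cvg_id.
have : integ a b id = (a + b) * (b - a) - integ a b id.
  rewrite -[in RHS]integ_cst// -integB//; last by move=> x; exact: cvg_cst.
  rewrite -(@integ_reflect (a + b) a b id)//.
  by rewrite addrK (addrC a) addrK.
lra.
Qed.

Lemma integ_affine a b m k : a <= b ->
  integ a b (fun x => m * x + k) = (b - a) * (m * ((a + b) / 2) + k).
Proof.
move=> ab; rewrite integD; last 2 first.
- move=> x; apply: cvgM; [exact: cvg_cst|exact: cvg_id].
- move=> x; exact: cvg_cst.
rewrite integ_cst// integZ; last by move=> x; exact: cvg_id.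
by rewrite integ_id//; ring.
Qed.

Lemma integ_le_affine a b m k F : a <= b -> continuous F ->
  (forall x, a <= x <= b -> F x <= m * x + k) ->
  integ a b F <= (b - a) * (m * ((a + b) / 2) + k).
Proof.
by move=> ab cF FG; rewrite -integ_affine//; apply: integ_le => //; exact: continuous_affine.
Qed.

Lemma integ_ge_affine a b m k F : a <= b -> continuous F ->
  (forall x, a <= x <= b -> m * x + k <= F x) ->
  (b - a) * (m * ((a + b) / 2) + k) <= integ a b F.
Proof.
by move=> ab cF FG; rewrite -integ_affine//; apply: integ_le => //; exact: continuous_affine.
Qed.

End Integral1D.

(** * Areas below lines in the unit cell *)

Section Clip.
Context {R : realType}.
Implicit Types (y b k m t s : R).

(** For a line y = k - m x, [clip (k - m * s)] is the length of the part below
    the line of the vertical slice of the unit square at abscissa s. *)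
Definition clip y : R := Num.max 0 (Num.min 1 y).

Lemma clip_ge0 y : 0 <= clip y.
Proof. by rewrite /clip le_max lexx. Qed.

Lemma clip_le1 y : clip y <= 1.
Proof. by rewrite /clip ge_max ler01 ge_min lexx. Qed.

Lemma clip_le b y : 0 <= b -> y <= b -> clip y <= b.
Proof. by move=> b0 yb; rewrite /clip ge_max b0 ge_min yb orbT. Qed.

Lemma le_clip b y : b <= 1 -> b <= y -> b <= clip y.
Proof. by move=> b1 yb; rewrite /clip le_max le_min b1 yb orbT. Qed.

Lemma clip_eq0 y : y <= 0 -> clip y = 0.
Proof. by move=> y0; apply/eqP; rewrite eq_le clip_ge0 clip_le. Qed.

Lemma clip_eq1 y : 1 <= y -> clip y = 1.
Proof. by move=> y1; apply/eqP; rewrite eq_le clip_le1 le_clip. Qed.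

Lemma clip_id y : 0 <= y <= 1 -> clip y = y.
Proof. by move=> /andP[y0 y1]; apply/eqP; rewrite eq_le clip_le// le_clip. Qed.

Lemma clip_homo : {homo clip : x y / x <= y}.
Proof.
move=> x y xy; rewrite /clip ge_max le_max lexx/= le_max le_min !ge_min.
by rewrite lexx xy !orbT.
Qed.

Lemma clip_onem y : 1 - clip y = clip (1 - y).
Proof.
have [y0|y0] := leP y 0; first by rewrite clip_eq0// clip_eq1; lra.
have [y1|y1] := leP 1 y; first by rewrite clip_eq1// clip_eq0; lra.
by rewrite !clip_id; lra.
Qed.

Lemma continuous_clip (F : R -> R) : continuous F ->
  continuous (fun x => clip (F x)).
Proof.
move=> cF x; apply: (@continuous_max _ _ (cst 0) (fun x => Num.min 1 (F x))).
  exact: cvg_cst.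
by apply: (@continuous_min _ _ (cst 1) F); [exact: cvg_cst|exact: cF].
Qed.

Lemma continuous_minf (F G : R -> R) : continuous F -> continuous G ->
  continuous (fun x => Num.min (F x) (G x)).
Proof. by move=> cF cG x; apply: (@continuous_min _ _ F G); [exact: cF|exact: cG]. Qed.

Lemma continuous_decline k m : continuous (fun s : R => k - m * s).
Proof.
move=> x; apply: cvgB; first exact: cvg_cst.
by apply: cvgM; [exact: cvg_cst|exact: cvg_id].
Qed.

Lemma continuous_clip_decline k m : continuous (fun s : R => clip (k - m * s)).
Proof. by apply: continuous_clip; exact: continuous_decline. Qed.

(** Area of the part of the unit square below the line y = k - m x. *)
Definition below k m : R := integ 0 1 (fun s => clip (k - m * s)).

(** Areas of the parts of the unit square below two lines, and above two
    lines. *)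
Definition below2 k m k' m' : R :=
  integ 0 1 (fun s => Num.min (clip (k - m * s)) (clip (k' - m' * s))).

Definition above2 k m k' m' : R :=
  integ 0 1 (fun s => Num.min (1 - clip (k - m * s)) (1 - clip (k' - m' * s))).

Lemma continuous_below2 k m k' m' :
  continuous (fun s => Num.min (clip (k - m * s)) (clip (k' - m' * s))).
Proof. by apply: continuous_minf; exact: continuous_clip_decline. Qed.

Lemma continuous_above2 k m k' m' :
  continuous (fun s => Num.min (1 - clip (k - m * s)) (1 - clip (k' - m' * s))).
Proof.
apply: continuous_minf => x; apply: cvgB;
  [exact: cvg_cst|exact: continuous_clip_decline|
   exact: cvg_cst|exact: continuous_clip_decline].
Qed.

Lemma below2_ge0 k m k' m' : 0 <= below2 k m k' m'.
Proof. by apply: integ_ge0 => s _; rewrite le_min !clip_ge0. Qed.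

Lemma below2C k m k' m' : below2 k m k' m' = below2 k' m' k m.
Proof. by apply: eq_integ => s _; rewrite minC. Qed.

Lemma above2C k m k' m' : above2 k m k' m' = above2 k' m' k m.
Proof. by apply: eq_integ => s _; rewrite minC. Qed.

Lemma onem_below k m : 1 - below k m = below (1 - k + m) m.
Proof.
have -> : 1 - below k m = integ 0 1 (fun s => 1 - clip (k - m * s)).
  rewrite integB; [|by move=> ?; exact: cvg_cst|exact: continuous_clip_decline].
  by rewrite integ_cst// subr0 mulr1.
have := @integ_reflect R 1 0 1 (fun s => 1 - clip (k - m * s)).
rewrite subrr subr0 => ->//.
  by apply: eq_integ => s _; rewrite clip_onem; congr clip; ring.
by move=> x; apply: cvgB; [exact: cvg_cst|exact: continuous_clip_decline].
Qed.

(** The central symmetry of the unit square exchanges above and below, so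
    that every bound on [below2] yields one on [above2]. *)
Lemma above2E k m k' m' :
  above2 k m k' m' = below2 (1 - k + m) m (1 - k' + m') m'.
Proof.
have := @integ_reflect R 1 0 1 (fun s =>
  Num.min (1 - clip (k - m * s)) (1 - clip (k' - m' * s))) ler01.
rewrite subrr subr0 /above2 => ->; last exact: continuous_above2.
by apply: eq_integ => s _; rewrite !clip_onem; congr (Num.min (clip _) (clip _)); ring.
Qed.

Lemma above2_ge0 k m k' m' : 0 <= above2 k m k' m'.
Proof. by rewrite above2E below2_ge0. Qed.

Lemma below2_le k m k' m' : below2 k m k' m' <= below k m.
Proof.
apply: integ_le => [||s _]; [exact: continuous_below2|exact: continuous_clip_decline|].
by rewrite ge_min lexx.
Qed.

Lemma above2_le k m k' m' : above2 k m k' m' <= 1 - below k m.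
Proof. by rewrite above2E onem_below below2_le. Qed.

Lemma below2_above2_le1 k m k' m' : below2 k m k' m' + above2 k m k' m' <= 1.
Proof. have := below2_le k m k' m'; have := above2_le k m k' m'; lra. Qed.

Lemma below_homo k k' m : k <= k' -> below k m <= below k' m.
Proof.
move=> kk; apply: integ_le; [exact: continuous_clip_decline..|move=> s _].
by apply: clip_homo; lra.
Qed.

Lemma below_eq0 k m : 0 <= m -> k <= 0 -> below k m = 0.
Proof.
move=> m0 k0; have -> : below k m = integ 0 1 (fun=> 0).
  by apply: eq_integ => s s01; rewrite clip_eq0//; nra.
by rewrite integ_cst// mul0r.
Qed.

Lemma below_eq1 k m : 0 <= m -> m + 1 <= k -> below k m = 1.
Proof.
move=> m0 k0; have -> : below k m = integ 0 1 (fun=> 1).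
  by apply: eq_integ => s s01; rewrite clip_eq1//; nra.
by rewrite integ_cst// subr0 mulr1.
Qed.

Lemma below2_eq k m k' m' : 0 <= m' -> m' + 1 <= k' -> below2 k m k' m' = below k m.
Proof.
move=> m0 k0; apply: eq_integ => s s01; rewrite (clip_eq1 (y := k' - _)); last by nra.
by apply/min_idPl; exact: clip_le1.
Qed.

Lemma above2_eq k m k' m' : 0 <= m' -> k' <= 0 -> above2 k m k' m' = 1 - below k m.
Proof. by move=> m0 k0; rewrite above2E onem_below below2_eq//; lra. Qed.

(** The region below a line cutting the base at t is contained in the
    triangle with legs t and m t. *)
Lemma below_le_tri t m : 0 <= m -> 0 <= t <= 1 -> below (m * t) m <= m * t ^+ 2 / 2.
Proof.
move=> m0 t01; rewrite /below (@integ_cat _ 0 t 1)//; last exact: continuous_clip_decline.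
have H1 : integ 0 t (fun s => clip (m * t - m * s)) <= (t - 0) * (- m * ((0 + t) / 2) + m * t).
  by apply: integ_le_affine; [lra|exact: continuous_clip_decline|move=> s s01; apply: clip_le; nra].
have H2 : integ t 1 (fun s => clip (m * t - m * s)) <= (1 - t) * (0 * ((t + 1) / 2) + 0).
  by apply: integ_le_affine; [lra|exact: continuous_clip_decline|move=> s s01; apply: clip_le; nra].
nra.
Qed.

(** The region is contained in the rectangle over the segment [0, t]. *)
Lemma below_le_base t m : 0 <= m -> 0 <= t <= 1 -> below (m * t) m <= t.
Proof.
move=> m0 t01; rewrite /below (@integ_cat _ 0 t 1)//; last exact: continuous_clip_decline.
have H1 : integ 0 t (fun s => clip (m * t - m * s)) <= (t - 0) * (0 * ((0 + t) / 2) + 1).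
  apply: integ_le_affine; [lra|exact: continuous_clip_decline|move=> s s01].
  have := clip_le1 (m * t - m * s); lra.
have H2 : integ t 1 (fun s => clip (m * t - m * s)) <= (1 - t) * (0 * ((t + 1) / 2) + 0).
  by apply: integ_le_affine; [lra|exact: continuous_clip_decline|move=> s s01; apply: clip_le; nra].
lra.
Qed.

(** The line enters through the top at t - w and leaves through the bottom at
    t, so the region is a trapezoid. *)
Lemma belowE_trap t m w : 0 <= w -> m * w = 1 -> w <= t <= 1 -> below (m * t) m = t - w / 2.
Proof.
move=> w0 mw wt.
have c := @continuous_clip_decline (m * t) m.
have m0 : 0 < m by nra.
rewrite /below (@integ_cat _ 0 t 1)// ?(@integ_cat _ 0 (t - w) t)//; try lra.
have -> : integ 0 (t - w) (fun s => clip (m * t - m * s)) = integ 0 (t - w) (fun=> 1).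
  apply: eq_integ => s s01; rewrite clip_eq1//; nra.
have -> : integ (t - w) t (fun s => clip (m * t - m * s)) = integ (t - w) t (fun s => - m * s + m * t).
  apply: eq_integ => s s01; rewrite clip_id//; first by ring.
  by apply/andP; split; nra.
have -> : integ t 1 (fun s => clip (m * t - m * s)) = integ t 1 (fun=> 0).
  apply: eq_integ => s s01; rewrite clip_eq0//; nra.
rewrite !integ_cst ?integ_affine; try lra.
nra.
Qed.

(** Both lines pass above the point (t, 1), so that the rectangle over the
    segment [0, t] is below them. *)
Lemma below2_ge_base t k m k' m' : 0 <= t <= 1 -> 0 <= m -> 0 <= m' ->
  1 + m * t <= k -> 1 + m' * t <= k' -> t <= below2 k m k' m'.
Proof.
move=> t01 m0 m0' k1 k1'.
have c := @continuous_below2 k m k' m'.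
rewrite /below2 (@integ_cat _ 0 t 1)//.
have H1 : (t - 0) * (0 * ((0 + t) / 2) + 1) <= integ 0 t (fun s => Num.min (clip (k - m * s)) (clip (k' - m' * s))).
  apply: integ_ge_affine => //; first by lra.
  by move=> s s01; rewrite le_min; apply/andP; split; apply: le_clip; nra.
have H2 : 0 <= integ t 1 (fun s => Num.min (clip (k - m * s)) (clip (k' - m' * s))).
  by apply: integ_ge0 => s _; rewrite le_min !clip_ge0.
lra.
Qed.

Lemma below_ge_base t k m : 0 <= t <= 1 -> 0 <= m -> 1 + m * t <= k -> t <= below k m.
Proof.
by move=> t01 m0 k1; apply: le_trans (below2_le k m k m); exact: below2_ge_base.
Qed.

End Clip.

(** * One column of cells, half-planes on opposite sides of their graphs *)

Section OuterColumns.
Context {R : realType}.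
Implicit Types (k m t s x y w : R).

Local Notation pp := below2.
Local Notation qq := above2.

(** The area inequality restricted to one column of the stencil, for a
    half-plane below y = k - m x and one above y = k' - m' x.  In the lower
    cell of the column the lines have levels k + 1 and k' + 1, in the upper
    cell k - 1 and k' - 1. *)
Definition column_balanced k m k' m' : Prop :=
  6 * (Num.min (pp (k + 1) m (k' + 1) m') (qq (k + 1) m (k' + 1) m') +
       Num.min (pp k m k' m') (qq k m k' m') +
       Num.min (pp (k - 1) m (k' - 1) m') (qq (k - 1) m (k' - 1) m')) <=
  pp (k + 1) m (k' + 1) m' + qq (k + 1) m (k' + 1) m' +
  (pp k m k' m' + qq k m k' m') +
  (pp (k - 1) m (k' - 1) m' + qq (k - 1) m (k' - 1) m').

Lemma column_balancedC k m k' m' : column_balanced k m k' m' -> column_balanced k' m' k m.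
Proof. by rewrite /column_balanced !(below2C k') !(below2C (k' + 1)) !(below2C (k' - 1)) !(above2C k') !(above2C (k' + 1)) !(above2C (k' - 1)). Qed.

Lemma column_balanced_onem k m k' m' :
  column_balanced (1 - k + m) m (1 - k' + m') m' -> column_balanced k m k' m'.
Proof.
rewrite /column_balanced !above2E.
have E1 z n : 1 - (1 - z + n + 1) + n = z - 1 :> R by ring.
have E2 z n : 1 - (1 - z + n - 1) + n = z + 1 :> R by ring.
have E3 z n : 1 - (1 - z + n) + n = z :> R by ring.
have E4 z n : 1 - (z + 1) + n = 1 - z + n - 1 :> R by ring.
have E5 z n : 1 - (z - 1) + n = 1 - z + n + 1 :> R by ring.
rewrite !E1 !E2 !E3 !E4 !E5.
move: (pp (1 - k + m + 1) m _ _) (pp (1 - k + m) m _ _) (pp (1 - k + m - 1) m _ _).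
move: (pp (k + 1) m _ _) (pp k m _ _) (pp (k - 1) m _ _) => p1 p2 p3 q3 q2 q1.
by rewrite (minC q3) (minC q2) (minC q1); lra.
Qed.

(** Meant for the intersection of two triangles whose legs are t, m t and
    t', m' t': when m m' <= 1, its area is at most t t' / 2. *)
Lemma le_geo_mean (z x y c : R) : 0 <= x -> 0 <= y -> 0 <= c -> 0 <= z ->
  z <= x -> z <= y -> x * y <= c ^+ 2 -> z <= c.
Proof.
move=> x0 y0 c0 z0 zx zy xy; rewrite -(@ler_pXn2r _ 2)// ?nnegrE//.
by apply: le_trans xy; rewrite expr2 ler_pM.
Qed.

Lemma ge_minl (p q : R) : Num.min p q <= p. Proof. by rewrite ge_min lexx. Qed.
Lemma ge_minr (p q : R) : Num.min p q <= q. Proof. by rewrite ge_min lexx orbT. Qed.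

(** Lines that stay above the bottom of the central cell leave the lower
    cell entirely below them. *)
Lemma outer_bottom k m k' m' : 0 <= m -> 0 <= m' -> m <= k -> m' <= k' ->
  pp (k + 1) m (k' + 1) m' = 1 /\ qq (k + 1) m (k' + 1) m' = 0.
Proof.
move=> m0 m0' mk mk'.
have pm : pp (k + 1) m (k' + 1) m' = 1 by rewrite below2_eq ?below_eq1 ?lerD2r.
split => //; have := below2_above2_le1 (k + 1) m (k' + 1) m'.
have := above2_ge0 (k + 1) m (k' + 1) m'; rewrite pm => q0 q1.
by apply/eqP; rewrite eq_le q0 andbT; lra_from q1.
Qed.

Lemma outer_reduce k m k' m' : 0 <= m -> 0 <= m' -> m <= k -> m' <= k' ->
  6 * (Num.min (pp k m k' m') (qq k m k' m') +
       Num.min (pp (k - 1) m (k' - 1) m') (qq (k - 1) m (k' - 1) m')) <=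
  1 + (pp k m k' m' + qq k m k' m') +
  (pp (k - 1) m (k' - 1) m' + qq (k - 1) m (k' - 1) m') -> column_balanced k m k' m'.
Proof.
move=> m0 m0' mk mk'; rewrite /column_balanced.
have [-> ->] := outer_bottom m0 m0' mk mk'.
by rewrite (min_idPr (ler01 : 0 <= 1 :> R)) add0r addr0.
Qed.

(** The first line stays in the central cell, so nothing in the upper cell
    is below both lines and only the central cell has two parts.  If the second
    line crosses the top of that cell, a small triangle above it in the central cell
    is compensated by the part above it in the upper cell. *)
Lemma outer_flat k m k' m' : 0 <= m -> 0 <= m' ->
  m <= k -> m' <= k' -> k <= 1 -> column_balanced k m k' m'.
Proof.
move=> m0 m0' mk mk' k1; apply: outer_reduce => //.
have k10 : k - 1 <= 0 by rewrite subr_le0.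
have p1 : pp (k - 1) m (k' - 1) m' = 0.
  apply/eqP; rewrite eq_le below2_ge0 andbT.
  by apply: le_trans (below2_le _ _ _ _) _; rewrite below_eq0.
have q1 : qq (k - 1) m (k' - 1) m' = 1 - below (k' - 1) m' by rewrite above2C above2_eq.
have q10 : 0 <= 1 - below (k' - 1) m' by rewrite -q1 above2_ge0.
rewrite p1 q1 (min_idPl q10).
have p00 := below2_ge0 k m k' m'; have q00 := above2_ge0 k m k' m'.
have pq0 := below2_above2_le1 k m k' m'.
have := ge_minl (pp k m k' m') (qq k m k' m').
have := ge_minr (pp k m k' m') (qq k m k' m').
set z := Num.min _ _ => zq zp.
have [k1'|k1'] := leP k' 1.
  by rewrite (below_eq0 (k := k' - 1)) ?subr_le0//; lra_from zp zq p00 q00 pq0.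
have q0 : qq k m k' m' <= 1 - below k' m' by rewrite above2C above2_le.
suff b : 4 * (1 - below k' m') <= 2 - below (k' - 1) m'.
  lra_from b q0 zp zq.
have [ks|ks] := leP (m' + 1) k'.
  rewrite (below_eq1 (k := k'))// subrr mulr0.
  lra_from q10.
have m'0 : 0 < m' by lra_from k1' ks.
have [t tE] : exists t, 1 - k' + m' = m' * t.
  by exists ((1 - k' + m') / m'); rewrite mulrC divfK// gt_eqF.
have t0 : 0 <= t by rewrite -(pmulr_rge0 _ m'0) -tE; lra_from ks.
have t1 : t <= 1 by rewrite -(ler_pM2l m'0) -tE; lra_from k1'.
have t01 : 0 <= t <= 1 by rewrite t0.
have t01' : 0 <= 1 - t <= 1 by lra_from t0 t1.
have h1 := below_le_tri m0' t01.
have h2 := below_le_base m0' t01'.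
have e2 : m' * (1 - t) = k' - 1 by lra_from tE.
rewrite onem_below tE; rewrite e2 in h2.
have mt : m' * t ^+ 2 <= t.
  by rewrite expr2 mulrA ler_piMl// -tE; lra_from mk'.
lra_from h1 h2 mt t1.
Qed.

(** The lines leave the cell through its top, at 1 - t and 1 - t', and through
    its right side.  They are above the chord from (1 - t', 1) to (1, 0). *)
Lemma below2_ge_chord t t' m m' : 0 <= m -> 0 <= m' -> 0 < t -> t <= t' <= 1 ->
  m * t <= 1 -> m' * t' <= 1 ->
  1 - t' / 2 <= pp (1 + m * (1 - t)) m (1 + m' * (1 - t')) m'.
Proof.
move=> m0 m0' t0 tt' mt mt'.
have c := @continuous_below2 R (1 + m * (1 - t)) m (1 + m' * (1 - t')) m'.
have t'0 : 0 < t' by lra.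
have i0 : 0 < t'^-1 by rewrite invr_gt0.
have ti : t' * t'^-1 = 1 by rewrite divff//; lra.
rewrite /pp (@integ_cat _ 0 (1 - t') 1)//; last by lra.
have H1 : (1 - t' - 0) * (0 * ((0 + (1 - t')) / 2) + 1) <= integ 0 (1 - t')
    (fun s => Num.min (clip (1 + m * (1 - t) - m * s)) (clip (1 + m' * (1 - t') - m' * s))).
  apply: integ_ge_affine => //; first by lra.
  move=> s s01.
  have h1 : 0 <= m * (1 - t - s) by apply: mulr_ge0 => //; lra_from s01 tt'.
  have h2 : 0 <= m' * (1 - t' - s) by apply: mulr_ge0 => //; lra_from s01.
  by rewrite mul0r add0r le_min; apply/andP; split; apply: le_clip => //; [lra_from h1|lra_from h2].
have H2 : (1 - (1 - t')) * (- t'^-1 * ((1 - t' + 1) / 2) + t'^-1) <= integ (1 - t') 1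
    (fun s => Num.min (clip (1 + m * (1 - t) - m * s)) (clip (1 + m' * (1 - t') - m' * s))).
  apply: integ_ge_affine => //; first by lra.
  move=> s s01.
  have E : - t'^-1 * s + t'^-1 = t'^-1 * (1 - s) by ring.
  rewrite E; set r := 1 - s.
  have r0 : 0 <= r <= t' by rewrite /r; lra.
  have u0 : 0 <= t'^-1 * r by apply: mulr_ge0; lra.
  have u1 : t'^-1 * r <= 1 by rewrite mulrC ler_pdivrMr//; lra.
  have sE : s = 1 - r by rewrite /r; ring.
  have rE : r = t' * (t'^-1 * r) by rewrite mulrA ti mul1r.
  rewrite sE; move: u0 u1 rE; move: (t'^-1 * r) => u u0 u1 rE.
  have h1 : 0 <= m * (t' - t) * u by rewrite !mulr_ge0// subr_ge0; case/andP: tt'.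
  have h2 : 0 <= (1 - u) * (1 - m * t) by rewrite mulr_ge0// subr_ge0.
  have h3 : 0 <= (1 - u) * (1 - m' * t') by rewrite mulr_ge0// subr_ge0.
  by rewrite rE le_min; apply/andP; split; apply: le_clip => //; [lra_from h1 h2|lra_from h3].
have E2 : (1 - (1 - t')) * (- t'^-1 * ((1 - t' + 1) / 2) + t'^-1) = t' * (t' * t'^-1) / 2 by field; lra.
rewrite E2 ti in H2; lra.
Qed.

Lemma above2_ge_base t t' m m' : 0 <= m -> 0 <= m' -> 0 <= t -> t <= t' <= 1 ->
  t <= qq (m * (1 - t)) m (m' * (1 - t')) m'.
Proof.
move=> m0 m0' t0 tt'; rewrite above2E; apply: below2_ge_base => //; first lra.
- nra.
- nra.
Qed.

(** Here q0 and p0 are the areas in the central cell, q1 and p1 those in the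
    upper cell, for two lines crossing the common side at 1 - t and 1 - t'. *)
Lemma outer_both_poly t t' q0 p0 p1 q1 : 0 <= t <= t' -> t' <= 1 ->
  0 <= q0 -> q0 <= t * t' / 2 -> 1 - t' / 2 <= p0 -> 0 <= p1 ->
  p1 <= (1 - t) * (1 - t') / 2 -> t <= q1 ->
  6 * (Num.min p0 q0 + Num.min p1 q1) <= 1 + (p0 + q0) + (p1 + q1).
Proof.
move=> tt' t1 q00 hq0 hp0 p10 hp1 hq1.
have a := ge_minr p0 q0.
have b := ge_minl p1 q1.
have c := ge_minr p1 q1.
have [t4|t4] := leP t' (1/4).
  suff : (9/2) * (t * t') <= (3/2) * t' + 2 * t by lra.
  nra.
suff : 5 * (t * t') + 1/2 <= 2 * t' + (7/2) * t by nra.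
have : 0 <= t * ((7/2) - 5 * t') + 2 * t' - 1/2.
  have [h|h] := leP t' (7/10); first nra.
  nra.
lra.
Qed.

End OuterColumns.

Section OuterColumnsMixed.
Context {R : realType}.
Implicit Types (k m n t s x y w l e : R).

Local Notation pp := below2.
Local Notation qq := above2.

(** The integrand is at most 1 minus the distance of the clipped heights.
    That distance vanishes at the crossing and is at least l / 2 at both ends of
    the interval; it is at least linear in between, and its integral is at least
    l / 4. *)
Lemma crossing_gap m n l e : 0 <= n -> n < m -> 0 < l < 1 -> 1 <= m * (1 - l) ->
  0 <= e -> l / 2 <= e -> l / 2 <= 1 - (e + n) ->
  pp (m * (1 - l)) m (e + n) n + qq (m * (1 - l)) m (e + n) n <= 1 - l / 4.
Proof.
move=> n0 nm l01 ml e0 le ln.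
have mn0 : 0 < m - n by rewrite subr_gt0.
have m0 : 0 < m by exact: le_lt_trans nm.
have ml0 : 0 < m * l by rewrite mulr_gt0//; case/andP: l01.
have [x xE] : exists x, (m - n) * x = m * (1 - l) - n - e.
  by exists ((m * (1 - l) - n - e) / (m - n)); rewrite mulrC divfK// gt_eqF.
have x0 : 0 < x by rewrite -(pmulr_rgt0 _ mn0) xE; lra_from ml ln l01.
have x1 : x < 1 by rewrite -(ltr_pM2l mn0) xE; lra_from ml0 e0.
have y0 : 0 < 1 - x by rewrite subr_gt0.
have c1 := @continuous_below2 R (m * (1 - l)) m (e + n) n.
have c2 := @continuous_above2 R (m * (1 - l)) m (e + n) n.
rewrite /pp /qq -integD//.
set F := (fun s : R => _).
have cF : continuous F by move=> s; apply: cvgD; [exact: c1|exact: c2].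
have Fle (a b : R) : Num.min a b + Num.min (1 - a) (1 - b) <= 1 - `|a - b|.
  have [ab|ab] := leP a b.
    by rewrite (min_idPr _); [rewrite ler0_norm; lra_from ab|lra_from ab].
  by rewrite (min_idPl _); [rewrite ger0_norm; lra_from ab|lra_from ab].
have Fl s d : d <= `|clip (m * (1 - l) - m * s) - clip (e + n - n * s)| -> F s <= 1 - d.
  by move=> hd; apply: le_trans (Fle _ _) _; rewrite lerD2l lerN2.
(* the flatter line stays inside the cell *)
have flat s : 0 <= s <= 1 -> clip (e + n - n * s) = e + n - n * s.
  move=> /andP[s0 s1]; have ns := mulr_ge0 n0 s0.
  have ns1 : 0 <= n * (1 - s) by rewrite mulr_ge0// subr_ge0.
  by rewrite clip_id//; lra_from ns ns1 e0 ln l01.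
have [xi xxi] : exists2 xi, x * xi = 1 & 0 < xi.
  by exists x^-1; rewrite ?invr_gt0// divff// gt_eqF.
have [yi yyi] : exists2 yi, (1 - x) * yi = 1 & 0 < yi.
  by exists (1 - x)^-1; rewrite ?invr_gt0// divff// gt_eqF.
move=> yi0 xi0.
rewrite (@integ_cat _ 0 x 1)//; last by rewrite !ltW.
have H1 : integ 0 x F <= (x - 0) * ((l / 2 * xi) * ((0 + x) / 2) + (1 - l / 2)).
  apply: integ_le_affine => //; first exact: ltW.
  move=> s s01.
  have -> : (l / 2 * xi) * s + (1 - l / 2) = 1 - l / 2 * (1 - s * xi) by ring.
  apply: Fl; apply: le_trans (ler_norm _).
  have [u sE] : exists u, s = x * u by exists (s * xi); rewrite mulrCA xxi mulr1.
  have -> : s * xi = u by rewrite sE mulrAC xxi mul1r.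
  have u0 : 0 <= u by rewrite -(pmulr_rge0 _ x0) -sE; case/andP: s01.
  have u1 : 0 <= 1 - u by rewrite subr_ge0 -(ler_pM2l x0) -sE mulr1; case/andP: s01.
  rewrite flat; last by lra_from s01 x1.
  have ns : 0 <= n * s by rewrite mulr_ge0//; case/andP: s01.
  have lu : 0 <= l * u by rewrite mulr_ge0// ltW//; case/andP: l01.
  rewrite lerBrDr; apply: le_clip; first by lra_from ns lu ln.
  have slope : l / 2 * (1 - u) <= ((m - n) * x) * (1 - u).
    by apply: ler_wpM2r => //; rewrite xE; lra_from ml ln.
  have mns : (m - n) * s = (m - n) * x * u by rewrite sE mulrA.
  lra_from slope mns xE.
have H2 : integ x 1 F <= (1 - x) * ((- (l / 2) * yi) * ((x + 1) / 2) + (1 + l / 2 * (x * yi))).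
  apply: integ_le_affine => //; first exact: ltW.
  move=> s s01.
  have -> : - (l / 2) * yi * s + (1 + l / 2 * (x * yi)) = 1 - l / 2 * ((s - x) * yi) by ring.
  apply: Fl; rewrite distrC; apply: le_trans (ler_norm _).
  have [u sE] : exists u, s - x = (1 - x) * u by exists ((s - x) * yi); rewrite mulrCA yyi mulr1.
  have -> : (s - x) * yi = u by rewrite sE mulrAC yyi mul1r.
  have u0 : 0 <= u by rewrite -(pmulr_rge0 _ y0) -sE subr_ge0; case/andP: s01.
  have u1 : u <= 1 by rewrite -(ler_pM2l y0) -sE mulr1; lra_from s01.
  rewrite flat; last by lra_from s01 x0.
  have ns : 0 <= n * (1 - s) by rewrite mulr_ge0// subr_ge0; case/andP: s01.
  have lu : l / 2 * u <= l / 2 by rewrite ler_piMr//; lra_from l01.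
  rewrite lerBrDr -lerBrDl; apply: clip_le; first by lra_from lu le ns.
  have slope : l / 2 * u <= (m - n) * (1 - x) * u.
    by apply: ler_wpM2r => //; lra_from xE ml0 le l01.
  have mns : (m - n) * (s - x) = (m - n) * (1 - x) * u by rewrite sE mulrA.
  lra_from slope mns xE.
have E1 : (x - 0) * ((l / 2 * xi) * ((0 + x) / 2) + (1 - l / 2)) = x * (x * xi) * l / 4 + x * (1 - l / 2) by field.
have E2 : (1 - x) * ((- (l / 2) * yi) * ((x + 1) / 2) + (1 + l / 2 * (x * yi))) =
  (1 - x) - (1 - x) * ((1 - x) * yi) * l / 4 by field.
rewrite E1 xxi in H1; rewrite E2 yyi in H2; lra_from H1 H2.
Qed.

(** The first line leaves the cell through the bottom at 1 - l.  Bounding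
    the minimum by the area below one line, or above the other one, is enough
    except when the lines cross well inside the cell, where the sum of the two
    areas is small by [crossing_gap]. *)
Lemma outer_mixed_min m n l e : 0 <= m -> 0 <= n -> m * n <= 1 -> 0 < l < 1 -> m * l <= 1 -> 0 <= e ->
  4 * Num.min (pp (m * (1 - l)) m (e + n) n) (qq (m * (1 - l)) m (e + n) n) <= 2 - l / 2.
Proof.
move=> m0 n0 mn l01 ml e0.
have pf := below2_le (m * (1 - l)) m (e + n) n.
have pg : pp (m * (1 - l)) m (e + n) n <= below (e + n) n by rewrite below2C below2_le.
have qg : qq (m * (1 - l)) m (e + n) n <= 1 - below (e + n) n by rewrite above2C above2_le.
have G : n < m -> 1 <= m * (1 - l) -> l / 2 <= e -> l / 2 <= 1 - (e + n) ->
    pp (m * (1 - l)) m (e + n) n + qq (m * (1 - l)) m (e + n) n <= 1 - l / 4.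
  by move=> nm m1; apply: crossing_gap.
move: pf pg qg G; move: (pp _ _ _ _) (qq _ _ _ _) => p q pf pg qg G.
have hp := ge_minl p q; have hq := ge_minr p q.
have l01' : 0 <= 1 - l <= 1 by lra_from l01.
have [mu|mu] := leP (m * (1 - l)) 1.
  have := below_le_tri m0 l01'; rewrite expr2 mulrA => tri.
  have mll : m * (1 - l) * (1 - l) <= 1 - l by rewrite ler_piMl//; case/andP: l01'.
  lra_from hp pf tri mll l01.
have mp : 0 < m by rewrite lt_neqAle m0 andbT; apply: contraTneq mu => <-; rewrite mul0r ltr10.
have [w mw w0] : exists2 w, m * w = 1 & 0 < w.
  by exists m^-1; rewrite ?invr_gt0// divff// gt_eqF.
have nw : n <= w by rewrite -(ler_pM2l mp) mw.
have lw : l <= w by rewrite -(ler_pM2l mp) mw.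
have wl : w < 1 - l by rewrite -(ltr_pM2l mp) mw.
have pfE : below (m * (1 - l)) m = 1 - l - w / 2.
  by apply: belowE_trap => //; [exact: ltW|lra_from wl l01].
rewrite pfE in pf.
have [en|en] := leP 1 (e + n).
  rewrite onem_below in qg.
  have mono : below (1 - (e + n) + n) n <= below (n * 1) n by apply: below_homo; lra_from en.
  have tri := @below_le_tri R 1 n n0 (ltac:(by rewrite ler01 lexx)).
  lra_from hq qg mono tri nw wl l01.
have pgE : below (e + n) n = e + n / 2.
  have -> : below (e + n) n = integ 0 1 (fun s => - n * s + (e + n)).
    apply: eq_integ => s /andP[s0 s1]; have ns := mulr_ge0 n0 s0.
    have ns1 : 0 <= n * (1 - s) by rewrite mulr_ge0// subr_ge0.
    by rewrite clip_id ?mulNr 1?addrC//; lra_from ns ns1 e0 en.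
  by rewrite integ_affine//; field.
rewrite pgE in pg qg.
(* p is at most the average of the areas below each line *)
have [e34|e34] := leP e (3 / 4 * l); first by lra_from e34 hp pf pg nw.
have [hb|hb] := leP (1/2) (7/8 * l + w / 2); first by lra_from hb hp pf.
have [enl|enl] := leP (1 - l / 2) (e + n); first by lra_from enl hb hq qg nw l01.
have m1 : 1 < m by rewrite -(ltr_pM2r w0) mul1r mw; lra_from wl l01.
have pq : p + q <= 1 - l / 4.
  by apply: G; [lra_from nw m1 wl l01|exact: ltW|lra_from e34 l01|lra_from enl].
lra_from pq hp hq.
Qed.

(** The first line leaves the central cell through its top at 1 - l, and the
    second one stays above that cell: the upper cell alone has two parts. *)
Lemma outer_mixed m n l e : 0 <= m -> 0 <= n -> m * n <= 1 -> 0 < l < 1 -> m * l <= 1 -> 0 <= e ->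
  column_balanced (1 + m * (1 - l)) m (1 + e + n) n.
Proof.
move=> m0 n0 mn l01 ml e0.
have l01' : 0 <= l <= 1 by lra_from l01.
have ml0 : 0 <= m * (1 - l) by rewrite mulr_ge0// subr_ge0; case/andP: l01'.
apply: outer_reduce => //; [lra_from ml|lra_from e0|].
have -> : 1 + m * (1 - l) - 1 = m * (1 - l) by ring.
have -> : 1 + e + n - 1 = e + n by ring.
have z := outer_mixed_min m0 n0 mn l01 ml e0.
have h2 := above2_ge0 (m * (1 - l)) m (e + n) n.
have q0 : qq (1 + m * (1 - l)) m (1 + e + n) n = 0.
  apply/eqP; rewrite eq_le above2_ge0 andbT above2C.
  apply: le_trans (above2_le _ _ _ _) _; rewrite below_eq1 ?subrr//.
  lra_from e0.
have p0 : 1 - l / 2 <= pp (1 + m * (1 - l)) m (1 + e + n) n.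
  rewrite below2_eq//; last by lra_from e0.
  have tri := below_le_tri m0 l01'.
  have E : 1 - (1 + m * (1 - l)) + m = m * l by ring.
  have := onem_below (1 + m * (1 - l)) m; rewrite E => oE.
  have mll : m * l * l <= l by rewrite ler_piMl//; case/andP: l01'.
  lra_from tri oE mll.
have p00 : 0 <= pp (1 + m * (1 - l)) m (1 + e + n) n by exact: below2_ge0.
rewrite q0 (min_idPr p00).
have z1 := ge_minl (pp (m * (1 - l)) m (e + n) n) (qq (m * (1 - l)) m (e + n) n).
have z2 := ge_minr (pp (m * (1 - l)) m (e + n) n) (qq (m * (1 - l)) m (e + n) n).
lra_from z p0 z1 z2.
Qed.

End OuterColumnsMixed.

Section OuterColumnsEnd.
Context {R : realType}.
Implicit Types (k m n t s x y w l e : R).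

Local Notation pp := below2.
Local Notation qq := above2.

(** Both lines leave the central cell through its top, at 1 - t and 1 - t'.
    The bound m m' <= 1 enters through the geometric mean of the areas of two
    triangles. *)
Lemma outer_both t t' m m' : 0 <= m -> 0 <= m' -> m * m' <= 1 -> 0 < t -> t <= t' < 1 ->
  m * t <= 1 -> m' * t' <= 1 ->
  column_balanced (1 + m * (1 - t)) m (1 + m' * (1 - t')) m'.
Proof.
move=> m0 m0' mm t0 tt' mt mt'; apply: outer_reduce => //; try nra.
have E n z : 1 + n * (1 - z) - 1 = n * (1 - z) :> R by ring.
have E' n z : 1 - (1 + n * (1 - z)) + n = n * z :> R by ring.
have E'' n z : 1 - n * (1 - z) + n = 1 + n * z :> R by ring.
rewrite !E; apply: (@outer_both_poly R t t'); try lra.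
- exact: above2_ge0.
- have h1 : qq (1 + m * (1 - t)) m (1 + m' * (1 - t')) m' <= m * t ^+ 2 / 2.
    by rewrite above2E !E'; apply: le_trans (below2_le _ _ _ _) _; apply: below_le_tri => //; lra.
  have h2 : qq (1 + m * (1 - t)) m (1 + m' * (1 - t')) m' <= m' * t' ^+ 2 / 2.
    rewrite above2E !E' below2C; apply: le_trans (below2_le _ _ _ _) _; apply: below_le_tri => //; lra.
  apply: le_geo_mean h1 h2 _; rewrite ?above2_ge0//.
  + by apply: mulr_ge0 => //; apply: mulr_ge0 => //; exact: sqr_ge0.
  + by apply: mulr_ge0 => //; apply: mulr_ge0 => //; exact: sqr_ge0.
  + by apply: mulr_ge0 => //; apply: mulr_ge0; lra.
  + have -> : m * t ^+ 2 / 2 * (m' * t' ^+ 2 / 2) = (m * m') * (t * t' / 2) ^+ 2 by field.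
    by apply: ler_piMl => //; exact: sqr_ge0.
- by apply: below2_ge_chord => //; lra.
- exact: below2_ge0.
- have z01 : 0 <= 1 - t <= 1 by lra.
  have z01' : 0 <= 1 - t' <= 1 by lra.
  have h1 := le_trans (below2_le _ _ (m' * (1 - t')) m') (below_le_tri m0 z01).
  have h2 := le_trans (below2_le _ _ (m * (1 - t)) m) (below_le_tri m0' z01').
  rewrite below2C in h2.
  apply: le_geo_mean h1 h2 _; rewrite ?below2_ge0//.
  + by apply: mulr_ge0 => //; apply: mulr_ge0 => //; exact: sqr_ge0.
  + by apply: mulr_ge0 => //; apply: mulr_ge0 => //; exact: sqr_ge0.
  + by apply: mulr_ge0 => //; apply: mulr_ge0; lra.
  + have -> : m * (1 - t) ^+ 2 / 2 * (m' * (1 - t') ^+ 2 / 2) = (m * m') * ((1 - t) * (1 - t') / 2) ^+ 2 by field.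
    by apply: ler_piMl => //; exact: sqr_ge0.
- by apply: above2_ge_base => //; lra.
Qed.

(** The lines stay above the bottom of the central cell; this covers the
    left column, and by central symmetry the right one, when the lines decrease
    and meet the central cell. *)
Lemma column_outer k m k' m' : 0 <= m -> 0 <= m' -> m * m' <= 1 ->
  m <= k -> m' <= k' -> column_balanced k m k' m'.
Proof.
move=> m0 m0' mm mk mk'.
have [k1|k1] := leP k 1; first exact: outer_flat.
have [k1'|k1'] := leP k' 1; first by apply: column_balancedC; exact: outer_flat.
have tP z n : 0 <= n -> n <= z -> 1 < z -> z < 1 + n ->
    exists2 t, 0 < t < 1 /\ n * t <= 1 & z = 1 + n * (1 - t).
  move=> n0 nz z1 zn; have n1 : 0 < n by lra.
  exists ((1 + n - z) / n); last by rewrite mulrBr mulr1 (mulrC n) divfK; lra.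
  split; last by rewrite mulrC divfK; lra.
  by rewrite divr_gt0 ?ltr_pdivrMr//=; lra.
have [h|h] := leP (1 + m) k; have [h'|h'] := leP (1 + m') k'.
- apply: outer_reduce => //.
  have a1 := below2_above2_le1 k m k' m'.
  have b1 := below2_above2_le1 (k - 1) m (k' - 1) m'.
  have p1 : pp k m k' m' = 1 by rewrite below2_eq ?below_eq1//; lra.
  have a2 := above2_ge0 k m k' m'.
  have b2 := above2_ge0 (k - 1) m (k' - 1) m'.
  have b3 := below2_ge0 (k - 1) m (k' - 1) m'.
  have z1 := ge_minr (pp k m k' m') (qq k m k' m').
  have z2 := ge_minl (pp (k - 1) m (k' - 1) m') (qq (k - 1) m (k' - 1) m').
  have z3 := ge_minr (pp (k - 1) m (k' - 1) m') (qq (k - 1) m (k' - 1) m').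
  lra_from a1 b1 p1 a2 b2 b3 z1 z2 z3.
- have [t [t01 t1] ->] := tP _ _ m0' mk' k1' h'.
  have -> : k = 1 + (k - m - 1) + m by ring.
  apply: column_balancedC; apply: outer_mixed => //; lra.
- have [t [t01 t1] ->] := tP _ _ m0 mk k1 h.
  have -> : k' = 1 + (k' - m' - 1) + m' by ring.
  apply: outer_mixed => //; lra.
- have [t [t01 t1] ->] := tP _ _ m0 mk k1 h.
  have [t' [t01' t1'] ->] := tP _ _ m0' mk' k1' h'.
  have [tt|/ltW tt] := leP t t'.
    by apply: outer_both => //; lra.
  by apply: column_balancedC; apply: outer_both => //; lra.
Qed.

(** The first line cuts off the lower left corner of the central cell and the
    second one its upper right corner.  Each corner triangle extends in the next
    cell of the column to a region at least twice as large. *)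
Lemma column_split k m k' m' : 0 <= m -> 0 <= m' ->
  0 <= k -> k <= 1 -> k < m -> m' <= k' -> 1 < k' -> k' <= m' + 1 ->
  column_balanced k m k' m'.
Proof.
move=> m0 m0' k0 k1 km mk' k1' km'; rewrite /column_balanced.
have tri z n : 0 <= z -> z <= 1 -> z < n -> 2 * below z n <= below (z + 1) n.
  move=> z0 z1 zn; have n0 : 0 < n by lra.
  have zE : z = n * (z / n) by rewrite mulrC divfK//; lra.
  have t01 : 0 <= z / n <= 1 by rewrite divr_ge0 ?ler_pdivrMr//; lra.
  have h1 : 2 * below z n <= z / n.
    have := below_le_tri (ltW n0) t01; rewrite -zE => h.
    have : n * (z / n) ^+ 2 <= z / n.
      have -> : n * (z / n) ^+ 2 = z * (z / n) by field; lra.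
      by apply: ler_piMl => //; lra.
    lra.
  apply: le_trans h1 _; apply: below_ge_base => //; first lra.
  by rewrite -zE; lra.
have p1 : pp (k - 1) m (k' - 1) m' = 0.
  apply/eqP; rewrite eq_le below2_ge0 andbT.
  by apply: le_trans (below2_le _ _ _ _) _; rewrite below_eq0//; lra.
have q1 : 2 * qq k m k' m' <= qq (k - 1) m (k' - 1) m'.
  rewrite (above2C (k - 1)) (@above2_eq _ (k' - 1) m' (k - 1) m)//; last lra.
  rewrite onem_below.
  have -> : 1 - (k' - 1) + m' = (1 - k' + m') + 1 by ring.
  apply: le_trans (tri (1 - k' + m') m' _ _ _); try lra.
  by rewrite ler_pM2l// -onem_below above2C above2_le.
have pm : 2 * pp k m k' m' <= pp (k + 1) m (k' + 1) m'.
  rewrite (@below2_eq _ (k + 1) m (k' + 1) m')//; last lra.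
  apply: le_trans (tri k m _ _ _) => //; try lra.
  by rewrite ler_pM2l// below2_le.
have qm : qq (k + 1) m (k' + 1) m' = 0.
  apply/eqP; rewrite eq_le above2_ge0 andbT.
  by rewrite above2C; apply: le_trans (above2_le _ _ _ _) _; rewrite below_eq1//; lra.
have a := below2_ge0 (k + 1) m (k' + 1) m'.
have b := above2_ge0 (k - 1) m (k' - 1) m'.
rewrite p1 qm (min_idPr a) (min_idPl b).
have z1 := ge_minl (pp k m k' m') (qq k m k' m').
have z2 := ge_minr (pp k m k' m') (qq k m k' m').
lra_from pm q1 z1 z2.
Qed.

(** The lines cross at (x, y) in the cell.  The region below both lies under
    the flatter line on the left of x and under the steeper one on the right:
    a rectangle and two triangles. *)
Lemma below2_le_cross x y k m n w : 0 < m -> m * w = 1 -> 0 <= n -> n <= m ->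
  0 <= x <= 1 -> 0 <= y <= 1 -> m * x = k - y -> k <= m ->
  pp k m (y + n * x) n <= x * y + n * x ^+ 2 / 2 + w * y ^+ 2 / 2.
Proof.
move=> m0 mw n0 nm x01 y01 xE km.
have c := @continuous_below2 R k m (y + n * x) n.
have w0 : 0 < w by rewrite -(pmulr_rgt0 _ m0) mw.
have zE : m * (x + y * w) = k by rewrite mulrDr mulrCA mw mulr1 xE; ring.
have yw : 0 <= y * w by apply: mulr_ge0; lra_from y01 w0.
have z1 : x + y * w <= 1 by rewrite -(ler_pM2l m0) zE mulr1.
rewrite /pp (@integ_cat _ 0 x 1)// (@integ_cat _ x (x + y * w) 1)//; last by lra_from x01 yw z1.
have H1 : integ 0 x (fun s => Num.min (clip (k - m * s)) (clip (y + n * x - n * s))) <=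
  (x - 0) * (- n * ((0 + x) / 2) + (y + n * x)).
  apply: integ_le_affine => //; first by lra_from x01.
  move=> s s01; rewrite ge_min; apply/orP; right.
  have nxs : 0 <= n * (x - s) by apply: mulr_ge0 => //; lra_from s01.
  by apply: clip_le; lra_from nxs y01.
have H2 : integ x (x + y * w) (fun s => Num.min (clip (k - m * s)) (clip (y + n * x - n * s))) <=
  (x + y * w - x) * (- m * ((x + (x + y * w)) / 2) + k).
  apply: integ_le_affine => //; first by lra_from yw.
  move=> s s01; rewrite ge_min; apply/orP; left.
  have mzs : 0 <= m * (x + y * w - s) by apply: mulr_ge0; lra_from m0 s01.
  by apply: clip_le; lra_from mzs zE.
have H3 : integ (x + y * w) 1 (fun s => Num.min (clip (k - m * s)) (clip (y + n * x - n * s))) <=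
  (1 - (x + y * w)) * (0 * ((x + y * w + 1) / 2) + 0).
  apply: integ_le_affine => //.
  move=> s s01; rewrite ge_min; apply/orP; left.
  have mzs : 0 <= m * (s - (x + y * w)) by apply: mulr_ge0; lra_from m0 s01.
  by apply: clip_le; lra_from mzs zE.
have E2 : (x + y * w - x) * (- m * ((x + (x + y * w)) / 2) + k) = w * y ^+ 2 / 2.
  have -> : - m * ((x + (x + y * w)) / 2) + k = k - m * x - m * w * y / 2 by field.
  by rewrite mw xE; field.
rewrite E2 in H2; lra_from H1 H2 H3.
Qed.

End OuterColumnsEnd.

Section CenterColumns.
Context {R : realType}.
Implicit Types (k m n t s x y w l e : R).

Local Notation pp := below2.
Local Notation qq := above2.

(** Four times the bound of [below2_le_cross] is at most 1 + w when the
    crossing (x, y) lies below the antidiagonal x + y = 1. *)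
Lemma cross_area_bound x y n w : 0 <= x -> 0 <= y -> 0 <= n <= w -> 0 <= w <= 1 ->
  4 * (x * y + n * x ^+ 2 / 2 + w * y ^+ 2 / 2) <= (1 + w) * (x + y) ^+ 2.
Proof.
move=> x0 y0 nw w1.
have h1 : n * x ^+ 2 <= w * x ^+ 2 by apply: ler_wpM2r; [exact: sqr_ge0|lra].
have h2 : 0 <= (1 - w) * (x - y) ^+ 2 by apply: mulr_ge0; [lra|exact: sqr_ge0].
nra.
Qed.

Lemma above2_le_cross x y k m n w : 0 < m -> m * w = 1 -> 0 <= n -> n <= m ->
  0 <= x <= 1 -> 0 <= y <= 1 -> m * x = k - y -> 1 <= k ->
  qq k m (y + n * x) n <=
  (1 - x) * (1 - y) + n * (1 - x) ^+ 2 / 2 + w * (1 - y) ^+ 2 / 2.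
Proof.
move=> m0 mw n0 nm x01 y01 xE k1; rewrite above2E.
have -> : 1 - (y + n * x) + n = (1 - y) + n * (1 - x) by ring.
apply: below2_le_cross => //; [lra_from x01|lra_from y01|lra_from xE|lra_from k1].
Qed.

Lemma inverse_exists m : 0 < m -> exists2 w, m * w = 1 & 0 < w.
Proof. by move=> m0; exists m^-1; rewrite ?invr_gt0// divff// gt_eqF. Qed.

(** The steep line goes from top to bottom of the central cell, the flat one
    from its left side to its right side.  In the lower cell everything on the
    left of the steep line is below both lines, in the upper cell everything on
    its right is above both, which gives at least 1 + w in total.  The parts of
    the central cell are governed by the position of the crossing with respect
    to its antidiagonal. *)
Lemma column_cross_flat k m k' n : 0 <= n -> m * n <= 1 -> 1 < k -> k < m ->
  n <= k' -> k' <= 1 -> column_balanced k m k' n.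
Proof.
move=> n0 mn k1 km nk' k1'; rewrite /column_balanced.
have m0 : 0 < m by lra_from k1 km.
have [w mw w0] := inverse_exists m0.
have w1 : w < 1 by rewrite -(ltr_pM2l m0) mw mulr1; lra_from k1 km.
have nw : n <= w by rewrite -(ler_pM2l m0) mw.
have kw : k * w < 1 by rewrite -mw ltr_pM2r.
have kw0 : w <= k * w by rewrite ler_peMl ?ltW.
have mnp : 0 < m - n by lra_from nw w1 k1 km.
have [x xE] : exists x, (m - n) * x = k - k'.
  by exists ((k - k') / (m - n)); rewrite mulrC divfK// gt_eqF.
have x0 : 0 <= x by rewrite -(pmulr_rge0 _ mnp) xE; lra_from k1 k1'.
have x1 : x <= 1 by rewrite -(ler_pM2l mnp) xE; lra_from km nk'.
have [y kE] : exists y, k' = y + n * x by exists (k' - n * x); rewrite subrK.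
have nx : 0 <= n * x by exact: mulr_ge0.
have nx1 : 0 <= n * (1 - x) by rewrite mulr_ge0// subr_ge0.
have y0 : 0 <= y by lra_from nx1 kE nk'.
have y1 : y <= 1 by lra_from nx kE k1'.
have mx : m * x = k - y by lra_from xE kE.
have x01 : 0 <= x <= 1 by rewrite x0.
have y01 : 0 <= y <= 1 by rewrite y0.
have nm : n <= m by lra_from mnp.
have p0 := below2_le_cross m0 mw n0 nm x01 y01 mx (ltW km).
have q0 := above2_le_cross m0 mw n0 nm x01 y01 mx (ltW k1).
rewrite -kE in p0 q0.
have p1 : pp (k - 1) m (k' - 1) n = 0.
  apply/eqP; rewrite eq_le below2_ge0 andbT below2C.
  by apply: le_trans (below2_le _ _ _ _) _; rewrite below_eq0//; lra_from k1'.
have qm : qq (k + 1) m (k' + 1) n = 0.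
  apply/eqP; rewrite eq_le above2_ge0 andbT above2C.
  by apply: le_trans (above2_le _ _ _ _) _; rewrite below_eq1 ?subrr//; lra_from nk'.
have pm : k * w <= pp (k + 1) m (k' + 1) n.
  have nkw : n * (k * w) <= n by rewrite ler_piMr// ltW.
  apply: below2_ge_base => //.
  - lra_from kw kw0 w0.
  - exact: ltW.
  - by rewrite mulrCA mw mulr1 addrC.
  - lra_from nkw nk'.
have q1 : 1 - k * w + w <= qq (k - 1) m (k' - 1) n.
  have nkw : n * (1 - k * w + w) <= n by rewrite ler_piMr//; lra_from kw0.
  rewrite above2E; apply: below2_ge_base => //.
  - lra_from kw kw0 w0.
  - exact: ltW.
  - have -> : m * (1 - k * w + w) = m - k * (m * w) + m * w by ring.
    by rewrite mw; lra_from m0.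
  - lra_from nkw k1'.
have a := below2_ge0 (k + 1) m (k' + 1) n.
have b := above2_ge0 (k - 1) m (k' - 1) n.
rewrite p1 qm (min_idPr a) (min_idPl b).
have := ge_minl (pp k m k' n) (qq k m k' n).
have := ge_minr (pp k m k' n) (qq k m k' n).
set z := Num.min _ _ => zq zp.
suff zw : 4 * z <= 1 + w by lra_from zw zq zp pm q1.
have nw0 : 0 <= n <= w by rewrite n0.
have ww : 0 <= w <= 1 by rewrite !ltW.
have sq r : 0 <= r -> r <= 1 -> (1 + w) * r ^+ 2 <= 1 + w.
  by move=> r0 r1; rewrite ler_piMr ?exprn_ile1//; lra_from w0.
have [xy|xy] := leP (x + y) 1.
  have H := cross_area_bound x0 y0 nw0 ww.
  have S := sq _ (addr_ge0 x0 y0) xy.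
  lra_from H S p0 zp.
have x1' : 0 <= 1 - x by rewrite subr_ge0.
have y1' : 0 <= 1 - y by rewrite subr_ge0.
have H := cross_area_bound x1' y1' nw0 ww.
have S : (1 + w) * (1 - x + (1 - y)) ^+ 2 <= 1 + w.
  by apply: sq (addr_ge0 x1' y1') _; lra_from xy.
lra_from H S q0 zq.
Qed.

Lemma cross_late_poly (d y w : R) : 0 <= y -> y <= d -> d <= 1 -> y <= 1 - w -> 0 <= w -> 
  (1 + w) * (1 - d) ^+ 2 + 5 / 2 * (w * y ^+ 2) <= 1 + w.
Proof.
move=> y0 yd d1 yw w0.
have h1 : d <= 2 * d - d ^+ 2 by nra.
have h2 : w * y ^+ 2 <= w * (1 - w) * y.
  have : 0 <= (w * y) * (1 - w - y) by apply: mulr_ge0; [exact: mulr_ge0|lra].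
  lra.
have h3 : w * (1 - w) * y <= 1/4 * y.
  apply: ler_wpM2r => //; have := sqr_ge0 (w - 1/2); lra.
have h4 : (1 + w) * d <= (1 + w) * (2 * d - d ^+ 2) by apply: ler_wpM2l; lra.
nra.
Qed.

(** The lines cut the top of the central cell at x and y; as y <= x, they
    cross inside the cell, and a triangle below both remains in the upper
    cell. *)
Lemma column_cross_late k m k' n x y : 0 < m -> 0 < n -> m * n <= 1 -> 0 < x -> k = 1 + m * x -> k < m ->
  k' = 1 + n * y -> 0 < y <= 1 -> y <= x -> column_balanced k m k' n.
Proof.
move=> m0 n0 mn x0 kE km kE' y01 yx; rewrite /column_balanced.
have [w mw w0] := inverse_exists m0.
have k1 : 1 < k by rewrite kE ltrDl mulr_gt0.
have w1 : w < 1 by rewrite -(ltr_pM2l m0) mw mulr1; lra_from k1 km.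
have nw : n <= w by rewrite -(ler_pM2l m0) mw.
have xw : x + w < 1 by rewrite -(ltr_pM2l m0) mulrDr mw; lra_from kE km.
have mnp : 0 < m - n by lra_from nw w1 k1 km.
have nm : n <= m by lra_from mnp.
have [x1 xE] : exists x1, (m - n) * x1 = k - k'.
  by exists ((k - k') / (m - n)); rewrite mulrC divfK// gt_eqF.
have [y1 kE2] : exists y1, k' = y1 + n * x1 by exists (k' - n * x1); rewrite subrK.
have nxy' : 0 <= n * (x - y) by rewrite mulr_ge0 ?subr_ge0// ltW.
have x1x : x <= x1 by rewrite -(ler_pM2l mnp) xE; lra_from kE kE' nxy'.
have ny : 0 <= n * y by rewrite mulr_ge0 ?ltW//; lra_from y01.
have x11 : x1 <= 1 by rewrite -(ler_pM2l mnp) xE; lra_from kE' ny km nw w1.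
have nxy : 0 <= n * (x1 - y) by apply: mulr_ge0; [exact: ltW|lra_from x1x yx].
have nxy1 : n * (x1 - y) <= x1 - y by rewrite ler_piMl//; [lra_from x1x yx|lra_from nw w1].
have y1E : y1 = 1 - n * (x1 - y) by lra_from kE' kE2.
have x101 : 0 <= x1 <= 1 by rewrite x11 andbT; lra_from x0 x1x.
have y11 : 0 <= 1 - y1 by lra_from y1E nxy.
have y101 : 0 <= y1 <= 1 by lra_from y1E nxy nxy1 x11 y01.
have mx : m * x1 = k - y1 by lra_from xE kE2.
have q0 := above2_le_cross m0 mw (ltW n0) nm x101 y101 mx (ltW k1).
rewrite -kE2 in q0.
have qm : qq (k + 1) m (k' + 1) n = 0.
  apply/eqP; rewrite eq_le above2_ge0 andbT above2C.
  apply: le_trans (above2_le _ _ _ _) _; rewrite below_eq1 ?subrr//.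
    exact: ltW.
  lra_from kE' ny nw w1.
have x01 : 0 <= x <= 1 by lra_from x0 xw w0.
have pm : x + w <= pp (k + 1) m (k' + 1) n.
  have nxw : n * (x + w) <= n by rewrite ler_piMr// ltW.
  apply: below2_ge_base.
  - lra_from x0 w0 xw.
  - exact: ltW.
  - exact: ltW.
  - by rewrite mulrDr mw kE addrA addrAC.
  - lra_from nxw kE' ny nw w1.
have y01' : 0 <= y <= 1 by lra_from y01.
have q1 : 1 - x <= qq (k - 1) m (k' - 1) n.
  rewrite above2E; apply: below2_ge_base.
  - lra_from x01.
  - exact: ltW.
  - exact: ltW.
  - lra_from kE.
  - lra_from kE' nxy'.
have p1 : pp (k - 1) m (k' - 1) n <= n * y ^+ 2 / 2.
  rewrite below2C; apply: le_trans (below2_le _ _ _ _) _.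
  by rewrite kE' addrAC subrr add0r; exact: below_le_tri (ltW n0) y01'.
have a := below2_ge0 (k + 1) m (k' + 1) n.
rewrite qm (min_idPr a).
have p00 := below2_ge0 k m k' n.
have := ge_minl (pp k m k' n) (qq k m k' n).
have := ge_minr (pp k m k' n) (qq k m k' n).
have := ge_minl (pp (k - 1) m (k' - 1) n) (qq (k - 1) m (k' - 1) n).
set z1 := Num.min (pp (k - 1) _ _ _) _; set z0 := Num.min _ _ => z1p z0q z0p.
suff pq : 4 * qq k m k' n + 5 * pp (k - 1) m (k' - 1) n <= 1 + w.
  lra_from pq z1p z0q z0p pm q1.
have nw0 : 0 <= n <= w by rewrite nw ltW.
have ww : 0 <= w <= 1 by rewrite !ltW.
have x11' : 0 <= 1 - x1 by rewrite subr_ge0.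
have C := cross_area_bound x11' y11 nw0 ww.
have d1 : 1 - x1 + (1 - y1) = 1 - (x1 + y1 - 1) by ring.
rewrite d1 in C.
have yd : y <= x1 + y1 - 1 by lra_from y1E nxy1.
have d2 : x1 + y1 - 1 <= 1 by lra_from x11 y11.
have y0 : 0 <= y by case/andP: y01'.
have yw : y <= 1 - w by lra_from yx xw.
have H := cross_late_poly y0 yd d2 yw (ltW w0).
have nyw : n * y ^+ 2 <= w * y ^+ 2 by rewrite ler_wpM2r ?sqr_ge0.
lra_from C H nyw q0 p1.
Qed.

Lemma cross_early_poly (x y w p1 : R) : 0 <= x <= y -> y <= 1 -> 0 <= w <= 1 ->
  0 <= p1 -> p1 <= x * y / 2 -> p1 <= w * y ^+ 2 / 2 ->
  5 / 2 * (w * (1 - y) ^+ 2) - x - w / 2 + 5 * p1 - (1 - y) <= x + w.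
Proof.
move=> xy y1 w01 p0 hx hw.
set z := 1 - y; have yE : y = 1 - z by rewrite /z; ring.
have z01 : 0 <= z <= 1 by rewrite /z; lra.
have h1 : 4 * p1 <= 2 * (x * y) by lra.
have h2 : w * y ^+ 2 <= w * y.
  have : 0 <= (w * y) * (1 - y) by apply: mulr_ge0; [apply: mulr_ge0|]; lra.
  lra.
suff : w * (y / 2 - 3 / 2 + 5 / 2 * z ^+ 2) <= z * (1 + 2 * x).
  by rewrite yE in h1 h2 hw *; lra.
have h3 : 5 / 2 * z ^+ 2 - z / 2 - 1 <= z.
  have : z * z <= z by apply: ler_piMl; lra.
  rewrite expr2; lra.
have : w * (5 / 2 * z ^+ 2 - z / 2 - 1) <= w * z by apply: ler_wpM2l; lra.
have : w * z <= z by apply: ler_piMl; lra.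
have : 0 <= z * (2 * x) by apply: mulr_ge0; lra.
by rewrite yE; lra.
Qed.

(** As x <= y, the lines cross above the central cell, in which the
    region below both is the one below the steep line. *)
Lemma column_cross_early k m k' n x y : 0 < m -> 0 < n -> m * n <= 1 -> 0 < x -> k = 1 + m * x -> k < m ->
  k' = 1 + n * y -> y <= 1 -> x <= y -> column_balanced k m k' n.
Proof.
move=> m0 n0 mn x0 kE km kE' y1 xy; rewrite /column_balanced.
have [w mw w0] := inverse_exists m0.
have k1 : 1 < k by rewrite kE ltrDl mulr_gt0.
have w1 : w < 1 by rewrite -(ltr_pM2l m0) mw mulr1; lra_from k1 km.
have nw : n <= w by rewrite -(ler_pM2l m0) mw.
have xw : x + w < 1 by rewrite -(ltr_pM2l m0) mulrDr mw; lra_from kE km.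
have y01 : 0 <= y <= 1 by lra_from x0 xy y1.
have x01 : 0 <= x <= 1 by lra_from x0 xy y1.
have ny : 0 <= n * y by apply: mulr_ge0; [exact: ltW|case/andP: y01].
have kx : k - 1 = m * x by rewrite kE addrAC subrr add0r.
have ky : k' - 1 = n * y by rewrite kE' addrAC subrr add0r.
have qm : qq (k + 1) m (k' + 1) n = 0.
  apply/eqP; rewrite eq_le above2_ge0 andbT above2C.
  apply: le_trans (above2_le _ _ _ _) _; rewrite below_eq1 ?subrr//.
    exact: ltW.
  lra_from kE' ny nw w1.
have pm : x + w <= pp (k + 1) m (k' + 1) n.
  have nxw : n * (x + w) <= n by rewrite ler_piMr// ltW.
  apply: below2_ge_base.
  - lra_from x0 w0 xw.
  - exact: ltW.
  - exact: ltW.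
  - by rewrite mulrDr mw kE addrA addrAC.
  - lra_from nxw kE' ny nw w1.
have q1 : 1 - y <= qq (k - 1) m (k' - 1) n.
  have mxy : 0 <= m * (y - x) by rewrite mulr_ge0 ?subr_ge0// ltW.
  rewrite above2E; apply: below2_ge_base.
  - lra_from y01.
  - exact: ltW.
  - exact: ltW.
  - lra_from kE mxy.
  - lra_from kE'.
have p1y : pp (k - 1) m (k' - 1) n <= n * y ^+ 2 / 2.
  rewrite below2C; apply: le_trans (below2_le _ _ _ _) _.
  by rewrite ky; exact: below_le_tri (ltW n0) y01.
have p1x : pp (k - 1) m (k' - 1) n <= m * x ^+ 2 / 2.
  apply: le_trans (below2_le _ _ _ _) _.
  by rewrite kx; exact: below_le_tri (ltW m0) x01.
have tri0 u v : 0 < u -> 0 <= u * v ^+ 2 / 2 :> R.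
  by move=> u0; rewrite divr_ge0// mulr_ge0 ?sqr_ge0// ltW.
have p1 : pp (k - 1) m (k' - 1) n <= x * y / 2.
  apply: le_geo_mean p1x p1y _; rewrite ?below2_ge0 ?tri0//.
    by case/andP: x01 => x00 _; case/andP: y01 => y00 _; rewrite divr_ge0 ?mulr_ge0.
  have -> : m * x ^+ 2 / 2 * (n * y ^+ 2 / 2) = (m * n) * (x * y / 2) ^+ 2 by field.
  by rewrite ler_piMl ?sqr_ge0.
have q0 : qq k m k' n <= n * (1 - y) ^+ 2 / 2.
  rewrite above2C; apply: le_trans (above2_le _ _ _ _) _; rewrite onem_below.
  have -> : 1 - k' + n = n * (1 - y) by rewrite kE'; ring.
  by apply: below_le_tri (ltW n0) _; lra_from y01.
have p0 : x + w / 2 <= pp k m k' n.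
  have -> : pp k m k' n = below k m.
    apply: eq_integ => s s01; apply/min_idPl.
    have [h|h] := leP (k - m * s) (k' - n * s); first exact: clip_homo.
    (* left of y the second graph is above the cell, right of y the first
       one is below the second *)
    have sy : s <= y.
      rewrite leNgt; apply/negP => ys.
      have mns : 0 <= (m - n) * (s - y).
        by apply: mulr_ge0; [lra_from nw w1 k1 km|lra_from ys].
      have mxy : 0 <= m * (y - x) by rewrite mulr_ge0 ?subr_ge0// ltW.
      lra_from h mns mxy kE kE'.
    have nys : 0 <= n * (y - s) by rewrite mulr_ge0 ?subr_ge0// ltW.
    by rewrite (clip_eq1 (y := k' - _)) ?clip_le1//; lra_from nys kE'.
  have -> : k = m * (x + w) by rewrite mulrDr mw kE addrC.
  rewrite (@belowE_trap _ (x + w) m w) //; [lra_from w0|lra_from w0|lra_from x0 xw].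
have a := below2_ge0 (k + 1) m (k' + 1) n.
rewrite qm (min_idPr a).
have p10 := below2_ge0 (k - 1) m (k' - 1) n.
have := ge_minl (pp (k - 1) m (k' - 1) n) (qq (k - 1) m (k' - 1) n).
have := ge_minr (pp k m k' n) (qq k m k' n).
set z1 := Num.min (pp (k - 1) _ _ _) _; set z0 := Num.min _ _ => z0q z1p.
have nyw : n * y ^+ 2 <= w * y ^+ 2 by rewrite ler_wpM2r ?sqr_ge0.
have nzw : n * (1 - y) ^+ 2 <= w * (1 - y) ^+ 2 by rewrite ler_wpM2r ?sqr_ge0.
have xy' : 0 <= x <= y by rewrite xy andbT ltW.
have ww : 0 <= w <= 1 by rewrite !ltW.
have p1w : pp (k - 1) m (k' - 1) n <= w * y ^+ 2 / 2 by lra_from p1y nyw.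
have H := cross_early_poly xy' y1 ww p10 p1 p1w.
lra_from H z0q z1p p0 q0 pm q1 nzw.
Qed.

Lemma column_cross k m k' n : 0 <= n -> m * n <= 1 -> 1 < k -> k < m ->
  0 <= k' -> k' <= n + 1 -> column_balanced k m k' n.
Proof.
have late k0 m0 k0' n0 : 0 <= n0 -> m0 * n0 <= 1 -> 1 < k0 -> k0 < m0 ->
    1 < k0' -> k0' <= n0 + 1 -> column_balanced k0 m0 k0' n0.
  move=> a b c d e f.
  have n1 : 0 < n0 by lra.
  have m1 : 0 < m0 by lra.
  have kE : k0 = 1 + m0 * ((k0 - 1) / m0) by rewrite mulrC divfK; lra.
  have kE' : k0' = 1 + n0 * ((k0' - 1) / n0) by rewrite mulrC divfK; lra.
  have x0 : 0 < (k0 - 1) / m0 by rewrite divr_gt0//; lra.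
  have y0 : 0 < (k0' - 1) / n0 by rewrite divr_gt0//; lra.
  have y1 : (k0' - 1) / n0 <= 1 by rewrite ler_pdivrMr//; lra.
  have [h|h] := leP ((k0 - 1) / m0) ((k0' - 1) / n0).
    by apply: column_cross_early kE d kE' _ _ => //; lra.
  by apply: column_cross_late kE d kE' _ _ => //; lra.
move=> n0 mn k1 km k0' kn'.
have [h|h] := leP k' 1; last exact: late.
have [h'|h'] := leP n k'; first exact: column_cross_flat.
by apply: column_balanced_onem; apply: late => //; lra.
Qed.

(** Lines meeting the central cell enter through its left side or its top,
    and leave through its right side or its bottom; the central symmetry
    accounts for the remaining combinations. *)
Lemma column_center k m k' m' : 0 <= m -> 0 <= m' -> m * m' <= 1 ->
  0 <= k <= m + 1 -> 0 <= k' <= m' + 1 -> column_balanced k m k' m'.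
Proof.
move=> m0 m0' mm k01 k01'.
have mm' : m' * m <= 1 by rewrite mulrC.
have [a|a] := leP m k; have [a'|a'] := leP m' k'.
- exact: column_outer.
- have [b'|b'] := leP k' 1; last first.
    by apply: column_balancedC; apply: column_cross => //; lra.
  have [b|b] := leP k 1.
    by apply: column_balanced_onem; apply: column_outer => //; lra.
  by apply: column_balancedC; apply: column_split => //; lra.
- have [b|b] := leP k 1; last first.
    by apply: column_cross => //; lra.
  have [b'|b'] := leP k' 1.
    by apply: column_balanced_onem; apply: column_outer => //; lra.
  by apply: column_split => //; lra.
- have [b|b] := leP k 1; last by apply: column_cross => //; lra.
  have [b'|b'] := leP k' 1.
    by apply: column_balanced_onem; apply: column_outer => //; lra.
  by apply: column_balancedC; apply: column_cross => //; lra.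
Qed.

End CenterColumns.

(** * Regions between graphs with slopes of opposite signs *)

Section OppositeSlopes.
Context {R : realType}.
Implicit Types (k m s x y i j : R).

Definition sum3 (F : R -> R) : R := F (- 1) + F 0 + F 1.

(** The cells of the stencil are indexed by i and j in {-1, 0, 1}.  With p
    and q the areas where two indicator functions differ by 1 and by -1, this is
    inverse stability with constant 3/2, as |p - q| = p + q - 2 min (p, q). *)
Definition stencil_balanced (p q : R -> R -> R) : Prop :=
  6 * sum3 (fun i => sum3 (fun j => Num.min (p i j) (q i j))) <=
  sum3 (fun i => sum3 (fun j => p i j + q i j)).

Lemma stencil_balancedC p q : stencil_balanced p q -> stencil_balanced q p.
Proof.
rewrite /stencil_balanced /sum3.
rewrite (minC (q (-1) (-1))) (minC (q (-1) 0)) (minC (q (-1) 1)).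
rewrite (minC (q 0 (-1))) (minC (q 0 0)) (minC (q 0 1)).
rewrite (minC (q 1 (-1))) (minC (q 1 0)) (minC (q 1 1)).
lra.
Qed.

Lemma stencil_balanced_mirror p q :
  stencil_balanced (fun i j => p (- i) j) (fun i j => q (- i) j) -> stencil_balanced p q.
Proof. by rewrite /stencil_balanced /sum3 opprK oppr0; lra. Qed.

Lemma stencil_balanced_rows p q :
  (forall j, 6 * sum3 (fun i => Num.min (p i j) (q i j)) <= sum3 (fun i => p i j + q i j)) ->
  stencil_balanced p q.
Proof. by move=> row; rewrite /stencil_balanced; move: (row (-1)) (row 0) (row 1); rewrite /sum3; lra. Qed.

Lemma stencil_balanced_cols p q :
  (forall i, i = -1 \/ i = 0 \/ i = 1 ->
    6 * sum3 (fun j => Num.min (p i j) (q i j)) <= sum3 (fun j => p i j + q i j)) ->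
  stencil_balanced p q.
Proof.
move=> col; rewrite /stencil_balanced; move: (col (-1)) (col 0) (col 1).
move=> /(_ (or_introl erefl)) h1 /(_ (or_intror (or_introl erefl))) h2 /(_ (or_intror (or_intror erefl))) h3.
by move: h1 h2 h3; rewrite /sum3; lra.
Qed.

(** Area of the part of the unit square below the first line and above the
    second one. *)
Definition gap k m k' m' : R :=
  integ 0 1 (fun s => Num.max 0 (clip (k - m * s) - clip (k' - m' * s))).

Lemma continuous_maxf (F G : R -> R) : continuous F -> continuous G ->
  continuous (fun x => Num.max (F x) (G x)).
Proof. by move=> cF cG x; apply: (@continuous_max _ _ F G); [exact: cF|exact: cG]. Qed.

Lemma continuous_gap k m k' m' :
  continuous (fun s => Num.max 0 (clip (k - m * s) - clip (k' - m' * s))).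
Proof.
apply: continuous_maxf => x; first exact: cvg_cst.
by apply: cvgB; exact: continuous_clip_decline.
Qed.

Lemma gap_ge0 k m k' m' : 0 <= gap k m k' m'.
Proof. by apply: integ_ge0 => s _; rewrite le_max lexx. Qed.

Lemma gap_reflect k m k' m' : gap k m k' m' = gap (k - m) (- m) (k' - m') (- m').
Proof.
have := @integ_reflect R 1 0 1 (fun s => Num.max 0 (clip (k - m * s) - clip (k' - m' * s))) ler01.
rewrite subrr subr0 /gap => ->; last exact: continuous_gap.
by apply: eq_integ => s _; congr (Num.max _ (clip _ - clip _)); ring.
Qed.

Lemma gap_ge z k m k' m' :
  (forall s, 0 <= s <= 1 -> z <= clip (k - m * s) - clip (k' - m' * s)) -> z <= gap k m k' m'.
Proof.
move=> H; have -> : z = (1 - 0) * (0 * ((0 + 1) / 2) + z) by ring.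
apply: integ_ge_affine => //; first exact: continuous_gap.
by move=> s s01; rewrite le_max mul0r add0r H ?orbT.
Qed.

Lemma gap_eq0 k m k' m' :
  (forall s, 0 <= s <= 1 -> clip (k - m * s) <= clip (k' - m' * s)) -> gap k m k' m' = 0.
Proof.
move=> H; have -> : gap k m k' m' = integ 0 1 (fun=> 0).
  by apply: eq_integ => s s01; apply/max_idPl; rewrite subr_le0 H.
by rewrite integ_cst// mul0r.
Qed.

Lemma gap_le_left z t k m k' m' : 0 <= t <= 1 -> 0 <= z ->
  (forall s, 0 <= s <= t -> clip (k - m * s) - clip (k' - m' * s) <= z) ->
  (forall s, t <= s <= 1 -> clip (k - m * s) <= clip (k' - m' * s)) -> gap k m k' m' <= t * z.
Proof.
move=> t01 z0 H1 H2; rewrite /gap (@integ_cat _ 0 t 1)//; last exact: continuous_gap.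
have I1 : integ 0 t (fun s => Num.max 0 (clip (k - m * s) - clip (k' - m' * s))) <=
    (t - 0) * (0 * ((0 + t) / 2) + z).
  apply: integ_le_affine; [lra|exact: continuous_gap|move=> s s01].
  by rewrite mul0r add0r ge_max z0 H1.
have -> : integ t 1 (fun s => Num.max 0 (clip (k - m * s) - clip (k' - m' * s))) =
    integ t 1 (fun=> 0).
  by apply: eq_integ => s s01; apply/max_idPl; rewrite subr_le0 H2.
rewrite integ_cst; lra.
Qed.

Lemma gap_le_right z t k m k' m' : 0 <= t <= 1 -> 0 <= z ->
  (forall s, t <= s <= 1 -> clip (k - m * s) - clip (k' - m' * s) <= z) ->
  (forall s, 0 <= s <= t -> clip (k - m * s) <= clip (k' - m' * s)) ->
  gap k m k' m' <= (1 - t) * z.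
Proof.
move=> t01 z0 H1 H2; rewrite gap_reflect; apply: gap_le_left => // [|s s01|s s01]; first lra.
  have : clip (k - m * (1 - s)) - clip (k' - m' * (1 - s)) <= z by apply: H1; lra.
  by apply: le_trans; rewrite le_eqVlt; apply/orP; left; apply/eqP; congr (clip _ - clip _); ring.
have : clip (k - m * (1 - s)) <= clip (k' - m' * (1 - s)) by apply: H2; lra.
have E y n : y - n - - n * s = y - n * (1 - s) :> R by ring.
by rewrite !E.
Qed.

(** The area of [gap] in the cell (i, j), for lines given in the coordinates
    of the central cell. *)
Definition above_graph k m k' m' i j : R := gap (k - m * i - j) m (k' - m' * i - j) m'.

Definition graphs_balanced k m k' m' : Prop :=
  stencil_balanced (above_graph k m k' m') (above_graph k' m' k m).

Lemma graphs_balancedC k m k' m' : graphs_balanced k m k' m' -> graphs_balanced k' m' k m.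
Proof.
exact: stencil_balancedC.
Qed.

Lemma graphs_balanced_mirror k m k' m' :
  graphs_balanced (k - m) (- m) (k' - m') (- m') -> graphs_balanced k m k' m'.
Proof.
have E a n a' n' : above_graph (a - n) (- n) (a' - n') (- n') =
    (fun i j => above_graph a n a' n' (- i) j).
  apply/funext => i; apply/funext => j; rewrite /above_graph.
  rewrite (gap_reflect (a - n * - i - j)).
  have H x y : x - y - - y * i - j = x - y * - i - j - y by ring.
  by rewrite !H.
by rewrite /graphs_balanced !E; exact: stencil_balanced_mirror.
Qed.

(** The point is that 1 / t + 1 / (1 - t) >= 4. *)
Lemma min_harmonic (t z A B : R) : 0 <= t <= 1 -> 0 <= A -> 0 <= B ->
  z <= t * A -> z <= (1 - t) * B -> 4 * z <= A + B.
Proof.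
move=> t01 A0 B0 zA zB.
have h1 : (1 - t) * z <= (1 - t) * (t * A) by apply: ler_wpM2l; lra.
have h2 : t * z <= t * ((1 - t) * B) by apply: ler_wpM2l; lra.
have h3 : 0 <= (1/4 - t * (1 - t)) * (A + B).
  apply: mulr_ge0; last lra.
  have := sqr_ge0 (t - 1/2); lra.
lra.
Qed.

(** The lines cross over the central column, at abscissa t.  In each row, the
    gap at the left side of the central cell bounds from below the first area
    in the left cell, and from above, times t, the first area in the central
    cell; the right cell does the same for the second area. *)
Lemma adjacent_crossing k m k' m' : 0 <= m -> m' <= 0 -> k' < k -> k - m < k' - m' ->
  graphs_balanced k m k' m'.
Proof.
move=> m0 m0' kk km.
have mm : 0 < m - m' by lra.
set t := (k - k') / (m - m').
have tE : (m - m') * t = k - k' by rewrite /t mulrC divfK//; lra.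
have t01 : 0 <= t <= 1 by rewrite /t divr_ge0 ?ler_pdivrMr//=; lra.
clearbody t.
pose A j := clip (k - j) - clip (k' - j).
pose B j := clip (k' - m' - j) - clip (k - m - j).
have A0 j : 0 <= A j by rewrite subr_ge0 clip_homo//; lra.
have B0 j : 0 <= B j by rewrite subr_ge0 clip_homo//; lra.
have ms s : 0 <= s <= 1 -> 0 <= m * s /\ m * s <= m.
  by move=> s01; split; [apply: mulr_ge0; lra|apply: ler_piMr; lra].
have ms' s : 0 <= s <= 1 -> m' * s <= 0 /\ m' <= m' * s.
  by move=> s01; split; [apply: mulr_le0_ge0; lra|nra].
have pL j : A j <= above_graph k m k' m' (- 1) j.
  apply: gap_ge => s s01; have [? ?] := ms s s01; have [? ?] := ms' s s01.
  by apply: lerB; apply: clip_homo; lra.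
have qL j : above_graph k' m' k m (- 1) j = 0.
  apply: gap_eq0 => s s01; have [? ?] := ms s s01; have [? ?] := ms' s s01.
  by apply: clip_homo; lra.
have qR j : B j <= above_graph k' m' k m 1 j.
  apply: gap_ge => s s01; have [? ?] := ms s s01; have [? ?] := ms' s s01.
  by apply: lerB; apply: clip_homo; lra.
have pR j : above_graph k m k' m' 1 j = 0.
  apply: gap_eq0 => s s01; have [? ?] := ms s s01; have [? ?] := ms' s s01.
  by apply: clip_homo; lra.
have p0 j : above_graph k m k' m' 0 j <= t * A j.
  apply: gap_le_left => // s s01.
    have [|? ?] := ms s; first lra.
    have [|? ?] := ms' s; first lra.
    by apply: lerB; apply: clip_homo; lra.
  have : 0 <= (m - m') * (s - t) by apply: mulr_ge0; lra.
  by move=> ?; apply: clip_homo; lra.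
have q0 j : above_graph k' m' k m 0 j <= (1 - t) * B j.
  apply: gap_le_right => // s s01.
    have [|? ?] := ms s; first lra.
    have [|? ?] := ms' s; first lra.
    by apply: lerB; apply: clip_homo; lra.
  have : 0 <= (m - m') * (t - s) by apply: mulr_ge0; lra.
  by move=> ?; apply: clip_homo; lra.
apply: stencil_balanced_rows => j; rewrite /sum3 qL pR.
rewrite (min_idPr (gap_ge0 _ _ _ _)) (min_idPl (gap_ge0 _ _ _ _)).
move: (pL j) (qR j) (p0 j) (q0 j).
move: (above_graph k m k' m' (- 1) j) (above_graph k' m' k m 1 j).
move: (above_graph k m k' m' 0 j) (above_graph k' m' k m 0 j) => p q pm q1 hpm hq1 hp hq.
have := min_harmonic t01 (A0 j) (B0 j) (le_trans (ge_minl p q) hp) (le_trans (ge_minr p q) hq).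
have := ge_minl p q; have := ge_minr p q; lra.
Qed.

(** The lines do not cross over the central and right columns, where the
    second graph is above the first by at least k' - k in the central row.
    Parts of both signs can occur only in the left cell of that row, over
    which the gap is at most a linear function growing from 0 to k' - k. *)
Lemma adjacent_left k m k' m' : 0 <= m -> m' <= 0 -> 0 <= k -> k <= k' -> k' <= 1 ->
  graphs_balanced k m k' m'.
Proof.
move=> m0 m0' k0 kk k1'.
have ms s : 0 <= s <= 1 -> 0 <= m * s /\ m * s <= m.
  by move=> s01; split; [apply: mulr_ge0; lra|apply: ler_piMr; lra].
have ms' s : 0 <= s <= 1 -> m' * s <= 0 /\ m' <= m' * s.
  by move=> s01; split; [apply: mulr_le0_ge0; lra|nra].
have pR i j : 0 <= i -> above_graph k m k' m' i j = 0.
  move=> i0; apply: gap_eq0 => s s01; apply: clip_homo.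
  have : 0 <= (m - m') * (i + s) by apply: mulr_ge0; lra.
  lra.
have qR i : 0 <= i -> k' - k <= above_graph k' m' k m i 0.
  move=> i0; apply: gap_ge => s s01.
  have : 0 <= m * (i + s) by apply: mulr_ge0; lra.
  have : 0 <= - m' * (i + s) by apply: mulr_ge0; lra.
  move=> h1 h2.
  have : k' <= clip (k' - m' * i - 0 - m' * s) by apply: le_clip; lra.
  have : clip (k - m * i - 0 - m * s) <= k by apply: clip_le; lra.
  lra.
have qL j : j = -1 \/ j = 1 -> Num.min (above_graph k m k' m' (- 1) j) (above_graph k' m' k m (- 1) j) = 0.
  move=> jE; have [h|h] := leP (k + m) (k' + m').
    rewrite /above_graph gap_eq0 ?(min_idPl (gap_ge0 _ _ _ _))//.
    move=> s s01; apply: clip_homo.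
    have : 0 <= (m - m') * s by apply: mulr_ge0; lra.
    lra.
  rewrite /above_graph (gap_eq0 (k := k' - _ - _)) ?(min_idPr (gap_ge0 _ _ _ _))//.
  move=> s s01; have [? ?] := ms s s01; have [? ?] := ms' s s01.
  have [h'|h'] := leP (k' - m' * -1 - j - m' * s) (k - m * -1 - j - m * s); first exact: clip_homo.
  case: jE => ->.
    by rewrite (clip_eq1 (y := k - _ - _ - _)) ?clip_le1//; lra.
  by rewrite (clip_eq0 (y := k' - _ - _ - _)) ?clip_ge0//; lra.
have q0 : Num.min (above_graph k m k' m' (- 1) 0) (above_graph k' m' k m (- 1) 0) <= (k' - k) / 2.
  have [h|h] := leP (k + m) (k' + m').
    rewrite /above_graph gap_eq0 ?(min_idPl (gap_ge0 _ _ _ _))//; first lra.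
    move=> s s01; apply: clip_homo.
    have : 0 <= (m - m') * s by apply: mulr_ge0; lra.
    lra.
  apply: le_trans (ge_minr _ _) _.
  have -> : (k' - k) / 2 = (1 - 0) * ((k' - k) * ((0 + 1) / 2) + 0) by field.
  apply: integ_le_affine => //; first exact: continuous_gap.
  move=> s s01; have [? ?] := ms s s01; have [? ?] := ms' s s01.
  rewrite addr0 ge_max; apply/andP; split; first by apply: mulr_ge0; lra.
  have H : 0 <= (k + m - (k' + m')) * (1 - s) by apply: mulr_ge0; lra.
  have H' : 0 <= (k' - k) * s by apply: mulr_ge0; lra.
  have [g0|g0] := leP (k' + m' - m' * s) 0.
    rewrite (clip_eq0 (y := k' - _ - _ - _)); last lra.
    have := clip_ge0 (k - m * -1 - 0 - m * s); lra.
  have hG : clip (k' - m' * -1 - 0 - m' * s) <= k' + m' - m' * s by apply: clip_le; lra.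
  have [h'|h'] := leP (k + m - m * s) 1.
    have : k + m - m * s <= clip (k - m * -1 - 0 - m * s) by apply: le_clip; lra.
    lra.
  rewrite (clip_eq1 (y := k - _ - _ - _)); last lra.
  have := clip_le1 (k' - m' * -1 - 0 - m' * s); lra.
have p0 i j : 0 <= above_graph k m k' m' i j by exact: gap_ge0.
have q0' i j : 0 <= above_graph k' m' k m i j by exact: gap_ge0.
rewrite /graphs_balanced; move: pR qR qL q0 p0 q0'.
move: (above_graph k m k' m') (above_graph k' m' k m) => p q pR qR qL h p0 q0.
rewrite /stencil_balanced /sum3 !(pR 0)// !(pR 1)// !(min_idPl (q0 _ _)).
rewrite (qL (-1)); last by left.
rewrite (qL 1); last by right.
have h0 := qR 0 (lexx _); have h1 := qR 1 ler01.
have := ge_minl (p (- 1) 0) (q (- 1) 0).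
have := ge_minr (p (- 1) 0) (q (- 1) 0).
have := p0 (-1) (-1); have := p0 (-1) 1; have := q0 (-1) (-1); have := q0 (-1) 1.
have := q0 0 (-1); have := q0 0 1; have := q0 1 (-1); have := q0 1 1.
lra.
Qed.

Lemma graphs_balanced_adjacent k m k' m' : 0 <= m -> m' <= 0 ->
  0 <= k -> k - m <= 1 -> k' <= 1 -> 0 <= k' - m' -> graphs_balanced k m k' m'.
Proof.
move=> m0 m0' k0 km k1' km'.
have [h|h] := leP k k'; first exact: adjacent_left.
have [h'|h'] := leP (k' - m') (k - m); last exact: adjacent_crossing.
apply: graphs_balanced_mirror; apply: graphs_balancedC.
by apply: adjacent_left; lra.
Qed.

End OppositeSlopes.

(** * Regions between graphs with slopes of the same sign *)

Section Cones.
Context {R : realType}.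
Implicit Types (k m s x y i j a b c n : R).

Lemma min_diff_homo u v a b : v <= u -> a <= b ->
  Num.min u a - Num.min v a <= Num.min u b - Num.min v b :> R.
Proof.
by move=> vu ab; case: (leP u a); case: (leP v a); case: (leP u b); case: (leP v b) => *; lra.
Qed.

(** Area of the part in the box [0, a] x [0, b] of the wedge between the lines
    of slopes n and m; coordinates are measured leftwards and upwards from the
    crossing of two decreasing lines. *)
Definition cone m n a b : R := integ 0 a (fun t => Num.min (m * t) b - Num.min (n * t) b).

Lemma continuous_cone m n b : continuous (fun t : R => Num.min (m * t) b - Num.min (n * t) b).
Proof.
move=> x; apply: cvgB; apply: continuous_minf => y; try exact: cvg_cst;
  by apply: cvgM; [exact: cvg_cst|exact: cvg_id].
Qed.

Lemma cone_integrand_ge0 m n b t : n <= m -> 0 <= t -> 0 <= Num.min (m * t) b - Num.min (n * t) b.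
Proof.
move=> nm t0; rewrite subr_ge0 le_min ge_min ge_min lexx orbT andbT.
by rewrite ler_wpM2r.
Qed.

Lemma cone_ge0 m n a b : n <= m -> 0 <= cone m n a b.
Proof. by move=> nm; apply: integ_ge0 => t t01; apply: cone_integrand_ge0 => //; lra. Qed.

(** Wedges are invariant under homotheties. *)
Lemma cone_scale m n a b c : 0 < c -> 0 <= a -> cone m n (c * a) (c * b) = c ^+ 2 * cone m n a b.
Proof.
move=> c0 a0.
have := @integ_subst R c 0 0 a (fun t => Num.min (m * t) (c * b) - Num.min (n * t) (c * b)) c0 a0.
rewrite mulr0 !addr0 /cone => ->; last exact: continuous_cone.
rewrite expr2 -mulrA; congr (_ * _); rewrite -integZ; last exact: continuous_cone.
apply: eq_integ => t _; rewrite addr0 mulrBr !minr_pMr ?(ltW c0)//.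
by rewrite !(mulrCA c).
Qed.

Lemma cone_homo m n a a' b b' : n <= m -> 0 <= a -> a <= a' -> b <= b' ->
  cone m n a b <= cone m n a' b'.
Proof.
move=> nm a0 aa bb; apply: (@le_trans _ _ (cone m n a b')).
  apply: integ_le => [||t t0]; try exact: continuous_cone.
  by apply: min_diff_homo => //; apply: ler_wpM2r; lra.
rewrite /cone (@integ_cat _ 0 a a')//; last by lra.
  rewrite lerDl; apply: integ_ge0 => t t0; apply: cone_integrand_ge0 => //; lra.
exact: continuous_cone.
Qed.

(** When m a <= b, the wedge leaves the first box through its right side, and
    beyond that side it contains a translate of itself. *)
Lemma cone_shift_right m n a b a' b' : 0 <= n -> n <= m -> 0 <= a -> 0 <= a' ->
  m * a <= b -> 0 <= b' -> cone m n a b + cone m n a' b' <= cone m n (a + a') (b + b').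
Proof.
move=> n0 nm a0 a0' mb b0'.
rewrite {3}/cone (@integ_cat _ 0 a (a + a'))//; [|exact: continuous_cone|lra].
apply: lerD.
  apply: integ_le => [||t t0]; try exact: continuous_cone.
  by apply: min_diff_homo; [apply: ler_wpM2r|]; lra.
have := @integ_subst R 1 a 0 a' (fun t => Num.min (m * t) (b + b') - Num.min (n * t) (b + b')) ltr01 a0'.
rewrite mulr0 !mul1r add0r (addrC a') => ->; last exact: continuous_cone.
apply: integ_le => [||t t0]; first exact: continuous_cone.
  move=> x; apply: (@continuous_comp _ _ _ (fun t : R => 1 * t + a) (fun t => Num.min (m * t) (b + b') - Num.min (n * t) (b + b'))).
    exact: continuous_affine.
  exact: continuous_cone.
rewrite mul1r !mulrDr.
have h1 : 0 <= (m - n) * a by apply: mulr_ge0; lra.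
have h2 : 0 <= (m - n) * t by apply: mulr_ge0; lra.
have h3 : 0 <= n * a by apply: mulr_ge0; lra.
have h4 : 0 <= n * t by apply: mulr_ge0; lra.
clear - n0 nm h1 h2 h3 h4 mb b0'.
case: (leP (m * t) b') => ?; case: (leP (n * t) b') => ?;
  case: (leP (m * t + m * a) (b + b')) => ?; case: (leP (n * t + n * a) (b + b')) => ?; lra.
Qed.

(** When b <= n a, the wedge leaves the first box through its top, and above
    that top it contains a translate of itself. *)
Lemma cone_shift_down m n a b a' b' : 0 < n -> n <= m -> 0 <= a -> 0 <= a' ->
  0 <= b -> b <= n * a -> 0 <= b' -> cone m n a b + cone m n a' b' <= cone m n (a + a') (b + b').
Proof.
move=> n0 nm a0 a0' b0 mb b0'.
have u0 : 0 <= b / n by apply: divr_ge0; lra.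
have ua : b / n <= a by rewrite ler_pdivrMr// mulrC.
have nu : n * (b / n) = b by rewrite mulrC divfK//; lra.
pose F1 t := Num.min (m * t) b - Num.min (n * t) b.
pose F2 t := Num.min (Num.max 0 (m * t - b)) b' - Num.min (Num.max 0 (n * t - b)) b'.
have cF1 : continuous F1 by exact: continuous_cone.
have cl z : continuous (fun t : R => z * t - b).
  move=> x; apply: cvgB; last exact: cvg_cst.
  by apply: cvgM; [exact: cvg_cst|exact: cvg_id].
have cM z : continuous (fun t : R => Num.min (Num.max 0 (z * t - b)) b').
  apply: (@continuous_minf _ (fun t => Num.max 0 (z * t - b)) (cst b')); last first.
    by move=> ?; exact: cvg_cst.
  apply: (@continuous_maxf _ (cst 0) (fun t => z * t - b)) => //.
  by move=> ?; exact: cvg_cst.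
have cF2 : continuous F2 by move=> x; apply: cvgB; exact: cM.
have F20 t : 0 <= t -> 0 <= F2 t.
  move=> t0; have h2 : n * t <= m * t by apply: ler_wpM2r.
  rewrite /F2 subr_ge0 le_min !ge_min lexx orbT andbT.
  by rewrite ge_max !le_max lexx/= lerB// orbT.
have -> : cone m n (a + a') (b + b') = integ 0 (a + a') F1 + integ 0 (a + a') F2.
  rewrite -integD//; apply: eq_integ => t t0; rewrite /F1 /F2.
  have E z : Num.min z (b + b') = Num.min z b + Num.min (Num.max 0 (z - b)) b'.
    clear - b0 b0'; case: (leP z (b + b')) => ?; case: (leP z b) => ?; case: (leP 0 (z - b)) => ?;
    case: (leP _ b') => ?; lra.
  by rewrite !E; ring.
apply: lerD.
  by apply: (@cone_homo m n a (a + a') b b) => //; lra.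
rewrite (@integ_cat _ 0 (b / n) (a + a'))//; last lra.
rewrite (@integ_cat _ (b / n) (b / n + a') (a + a'))//; last lra.
have H1 : 0 <= integ 0 (b / n) F2 by apply: integ_ge0 => t ?; apply: F20; lra.
have H3 : 0 <= integ (b / n + a') (a + a') F2 by apply: integ_ge0 => t ?; apply: F20; lra.
suff : cone m n a' b' <= integ (b / n) (b / n + a') F2 by lra.
have := @integ_subst R 1 (b / n) 0 a' F2 ltr01 a0' cF2.
rewrite mulr0 !mul1r add0r (addrC a') => ->.
apply: integ_le => [||t t0]; first exact: continuous_cone.
  move=> x; apply: (@continuous_comp _ _ _ (fun t : R => 1 * t + b / n) F2).
    exact: continuous_affine.
  exact: cF2.
rewrite mul1r /F2 !mulrDr nu addrK.
case/andP: t0 => t0 _; rewrite -subr_ge0 in nm.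
have h1 : 0 <= (m - n) * (b / n) by exact: mulr_ge0.
have h2 : 0 <= (m - n) * t by exact: mulr_ge0.
have h4 : 0 <= n * t by apply: mulr_ge0 => //; exact: ltW.
rewrite (max_idPr h4).
apply: lerB => //; rewrite le_min !ge_min lexx orbT andbT.
by rewrite le_max; apply/orP; left; apply/orP; right; lra.
Qed.

End Cones.

Section ConesInStencil.
Context {R : realType}.
Implicit Types (k m s x y i j a b c n : R).

Lemma gap_onem k m k' m' : gap k m k' m' = gap (1 - k' + m') m' (1 - k + m) m.
Proof.
rewrite [RHS]gap_reflect; apply: eq_integ => s _.
have E z u : 1 - z + u - u - - u * s = 1 - (z - u * s) by ring.
by rewrite !E -!clip_onem; congr (Num.max _ _); ring.
Qed.

Definition sum33 (p : R -> R -> R) : R := sum3 (fun i => sum3 (fun j => p i j)).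

(** The central symmetry of the stencil exchanges the two halves of the
    double wedge. *)
Lemma sum33_above_graph_onem k m k' m' :
  sum33 (above_graph k' m' k m) =
  sum33 (above_graph (1 - k + m) m (1 - k' + m') m').
Proof.
have E i j : above_graph (1 - k + m) m (1 - k' + m') m' i j = above_graph k' m' k m (- i) (- j).
  rewrite /above_graph gap_onem.
  have E2 z u : 1 - (1 - z + u - u * i - j) + u = z - u * - i - - j by ring.
  by rewrite !E2.
rewrite /sum33 /sum3 !E opprK oppr0.
move: (above_graph k' m' k m) => q; ring.
Qed.

(** A vertical slice of the three cells of a column, of which -1 is the bottom
    and 2 the top. *)
Lemma clip_sum y : -1 <= y -> clip (y + 1) + clip y + clip (y - 1) = 1 + Num.min y 2.
Proof.
move=> y1; case: (leP y 2) => y2.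
  have [h|h] := leP y 0; first by rewrite clip_id 1?clip_eq0 1?clip_eq0; lra.
  have [h'|h'] := leP y 1; first by rewrite clip_eq1 1?clip_id 1?clip_eq0; lra.
  by rewrite clip_eq1 1?clip_eq1 1?clip_id; lra.
by rewrite !clip_eq1; lra.
Qed.

(** The lines cross at (x, y).  The upper left half of the double wedge
    contains its part in any box with corner (x, y) that stays within the left
    and upper sides of the stencil. *)
Lemma sum33_ge_cone x y m n a b : 0 <= n -> n <= m -> 0 <= a -> a <= x + 1 -> x <= 2 ->
  -1 <= y -> b <= 2 - y ->
  cone m n a b <= sum33 (above_graph (y + m * x) m (y + n * x) n).
Proof.
move=> n0 nm a0 ax x2 y1 bY.
pose D j z := Num.max 0 (clip (y + m * x - j - m * z) - clip (y + n * x - j - n * z)).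
have cD j : continuous (D j) by exact: continuous_gap.
pose S z := D (-1) z + D 0 z + D 1 z.
have cS : continuous S by move=> z; apply: cvgD; [apply: cvgD|]; exact: cD.
have D0 j z : 0 <= D j z by rewrite le_max lexx.
have S0 z : 0 <= S z by rewrite /S !addr_ge0.
have E i : sum3 (fun j => above_graph (y + m * x) m (y + n * x) n i j) = integ i (i + 1) S.
  have Ej j : above_graph (y + m * x) m (y + n * x) n i j = integ i (i + 1) (D j).
    have := @integ_subst R 1 i 0 1 (D j) ltr01 ler01 (cD j).
    rewrite mulr0 add0r !mul1r (addrC 1) => ->; apply: eq_integ => s _.
    by rewrite /D; congr (Num.max _ (clip _ - clip _)); ring.
  have cD2 : continuous (fun z => D (-1) z + D 0 z).
    by move=> z; apply: cvgD; exact: cD.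
  rewrite /sum3 !Ej -(integD _ _ (cD (-1)) (cD 0)).
  by rewrite -(integD _ _ cD2 (cD 1)).
rewrite /sum33 {1}/sum3 !E.
have -> : - 1 + 1 = 0 :> R by ring.
rewrite add0r (_ : 1 + 1 = 2 :> R); last by ring.
rewrite -integ_cat//; last lra.
rewrite -integ_cat//; last lra.
rewrite (@integ_cat _ (-1) (x - a) 2)//; last lra.
rewrite (@integ_cat _ (x - a) x 2)//; last lra.
have H1 : 0 <= integ (-1) (x - a) S by exact: integ_ge0.
have H3 : 0 <= integ x 2 S by exact: integ_ge0.
suff : cone m n a b <= integ (x - a) x S by lra.
have := @integ_reflect R x 0 a S a0 cS; rewrite subr0 => ->.
apply: integ_le => [||t t0]; first exact: continuous_cone.
  move=> z; apply: (@continuous_comp _ _ _ (fun t : R => x - t) S); last exact: cS.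
  by apply: cvgB; [exact: cvg_cst|exact: cvg_id].
apply: le_trans (min_diff_homo _ bY) _; first by apply: ler_wpM2r; lra.
have h2 : 0 <= (m - n) * t by apply: mulr_ge0; lra.
have h4 : 0 <= n * t by apply: mulr_ge0; lra.
have Dj j : clip (y + m * t - j) - clip (y + n * t - j) <= D j (x - t).
  rewrite /D le_max; apply/orP; right; rewrite le_eqVlt; apply/orP; left; apply/eqP.
  by congr (clip _ - clip _); ring.
have A1 : clip (y + m * t + 1) + clip (y + m * t) + clip (y + m * t - 1) = 1 + Num.min (y + m * t) 2.
  by apply: clip_sum; lra.
have A2 : clip (y + n * t + 1) + clip (y + n * t) + clip (y + n * t - 1) = 1 + Num.min (y + n * t) 2.
  by apply: clip_sum; lra.
have B u : Num.min (y + u) 2 = y + Num.min u (2 - y).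
  by clear; case: (leP (y + u) 2) => ?; case: (leP u (2 - y)) => ?; lra.
rewrite !B in A1 A2.
have := Dj (-1); have := Dj 0; have := Dj 1; rewrite /S opprK !subr0.
lra.
Qed.

Lemma above_graph_eq0 x y m n i j : 0 <= n -> n <= m -> x <= i \/ j + 1 <= y ->
  above_graph (y + m * x) m (y + n * x) n i j = 0.
Proof.
move=> n0 nm H; apply: gap_eq0 => s s01.
have [xs|sx] := leP x (i + s).
  apply: clip_homo; have : 0 <= (m - n) * (i + s - x) by apply: mulr_ge0; lra.
  lra.
case: H => h; first lra.
rewrite (clip_eq1 (y := y + n * x - _ - _ - _)) ?clip_le1//.
have : 0 <= n * (x - (i + s)) by apply: mulr_ge0; lra.
lra.
Qed.

(** In the cell containing the crossing, the upper left half wedge is seen in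
    a box reaching to the left and upper sides of that cell. *)
Lemma above_graph_le_cone x y m n i j : 0 <= n -> n <= m -> i <= x <= i + 1 -> j <= y <= j + 1 ->
  above_graph (y + m * x) m (y + n * x) n i j <= cone m n (x - i) (j + 1 - y).
Proof.
move=> n0 nm xi yj; rewrite /above_graph /gap.
set F := (fun s => _); have cF : continuous F by exact: continuous_gap.
rewrite (@integ_cat _ 0 (x - i) 1)//; last lra.
have -> : integ (x - i) 1 F = integ (x - i) 1 (fun=> 0).
  apply: eq_integ => s s01; rewrite /F; apply/max_idPl; rewrite subr_le0; apply: clip_homo.
  have : 0 <= (m - n) * (i + s - x) by apply: mulr_ge0; lra.
  lra.
rewrite integ_cst; last lra.
rewrite mul0r addr0.
have xi0 : 0 <= x - i by lra.
have := @integ_reflect R (x - i) 0 (x - i) F xi0 cF.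
rewrite subrr subr0 => ->; apply: integ_le => [||t t0].
- move=> z; apply: (@continuous_comp _ _ _ (fun t : R => x - i - t) F); last exact: cF.
  by apply: cvgB; [exact: cvg_cst|exact: cvg_id].
- exact: continuous_cone.
rewrite /F.
have h2 : 0 <= (m - n) * t by apply: mulr_ge0; lra.
have h4 : 0 <= n * t by apply: mulr_ge0; lra.
have E u : 0 <= u * t -> clip (y + u * x - u * i - j - u * (x - i - t)) = y - j + Num.min (u * t) (j + 1 - y).
  move=> ut; have -> : y + u * x - u * i - j - u * (x - i - t) = y - j + u * t by ring.
  by case: leP => ?; [rewrite clip_id|rewrite clip_eq1]; lra.
rewrite !E; try lra.
rewrite ge_max cone_integrand_ge0//=; last lra.
by rewrite le_eqVlt; apply/orP; left; apply/eqP; ring.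
Qed.

End ConesInStencil.

Section SlopesOfSameSign.
Context {R : realType}.
Implicit Types (k m s x y i j a b c n : R).

Lemma sum3_ge0 (F : R -> R) : (forall i, 0 <= F i) -> 0 <= sum3 F.
Proof. by move=> F0; rewrite /sum3 !addr_ge0. Qed.

Lemma sum3_le (F G : R -> R) : (forall i, i = -1 \/ i = 0 \/ i = 1 -> F i <= G i) -> sum3 F <= sum3 G.
Proof. by move=> FG; rewrite /sum3; apply: lerD; [apply: lerD|]; apply: FG; intuition. Qed.

Lemma sum3_cell x : sum3 (fun i => (i < x < i + 1)%R%:R) <= 1 :> R.
Proof.
rewrite /sum3; case: (boolP (-1 < x < -1 + 1)); case: (boolP (0 < x < 0 + 1));
  case: (boolP (1 < x < 1 + 1)) => /= h1 h2 h3; lra.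
Qed.

(** Only the cell containing (x, y) in its interior has parts of both signs,
    so a single minimum has to be compared with the total area. *)
Lemma stencil_balanced_single x y (p q : R -> R -> R) :
  (forall i j, 0 <= p i j) -> (forall i j, 0 <= q i j) ->
  (forall i j, ~~ (i < x < i + 1) || ~~ (j < y < j + 1) -> p i j = 0 \/ q i j = 0) ->
  (forall i j, i = -1 \/ i = 0 \/ i = 1 -> j = -1 \/ j = 0 \/ j = 1 ->
    i < x < i + 1 -> j < y < j + 1 -> 6 * Num.min (p i j) (q i j) <= sum33 p + sum33 q) ->
  stencil_balanced p q.
Proof.
move=> p0 q0 out inn; rewrite /stencil_balanced.
set G := sum33 p + sum33 q.
have G0 : 0 <= G by rewrite addr_ge0// /sum33 !sum3_ge0// => i; apply: sum3_ge0.
have -> : sum3 (fun i => sum3 (fun j => p i j + q i j)) = G by rewrite /G /sum33 /sum3; ring.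
have min0 i j : ~~ (i < x < i + 1) || ~~ (j < y < j + 1) -> Num.min (p i j) (q i j) = 0.
  by move=> /out[->|->]; [apply/min_idPl|apply/min_idPr].
pose e z i : R := (i < z < i + 1)%R%:R.
have H i j : i = -1 \/ i = 0 \/ i = 1 -> j = -1 \/ j = 0 \/ j = 1 ->
    6 * Num.min (p i j) (q i j) <= e x i * (e y j * G).
  move=> hi hj; rewrite /e.
  case: (boolP (i < x < i + 1)) => hx; last first.
    by rewrite (min0 i j) ?hx// mulr0 /= mul0r.
  case: (boolP (j < y < j + 1)) => hy; last first.
    by rewrite (min0 i j) ?hy ?orbT// mulr0 /= mul0r mulr0.
  by rewrite !mul1r; exact: inn.
apply: (@le_trans _ _ (sum3 (fun i => e x i * (sum3 (e y) * G)))).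
  have -> : 6 * sum3 (fun i => sum3 (fun j => Num.min (p i j) (q i j))) =
     sum3 (fun i => sum3 (fun j => 6 * Num.min (p i j) (q i j))).
    by rewrite /sum3; ring.
  apply: sum3_le => i hi.
  have -> : e x i * (sum3 (e y) * G) = sum3 (fun j => e x i * (e y j * G)) by rewrite /sum3; ring.
  by apply: sum3_le => j hj; exact: H.
have -> : sum3 (fun i => e x i * (sum3 (e y) * G)) = sum3 (e x) * (sum3 (e y) * G).
  by rewrite /sum3; ring.
have e0 z : 0 <= sum3 (e z) by apply: sum3_ge0 => i; exact: ler0n.
have h1 : sum3 (e y) * G <= G by apply: ler_piMl => //; exact: sum3_cell.
by apply: le_trans h1; apply: ler_piMl; [exact: mulr_ge0|exact: sum3_cell].
Qed.

(** The cell containing the crossing cuts the double wedge in two pieces;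
    six times the smaller one must fit in the stencil.  From the central cell,
    both pieces can be doubled, which multiplies their areas by 4.  From the
    upper left or lower right corner one piece can be tripled.  From the other
    two corners the lines would miss the central cell.  From the middle of a
    side, one piece can be doubled, and as the lines meet the central cell, the
    wedge extends beyond the doubled box by a translate of the other piece. *)
Lemma cone_pair_bound x y m n i j : 0 < n -> n <= m ->
  0 <= y + n * x -> y + m * x - m <= 1 -> 0 <= y + m * x -> y + n * x - n <= 1 ->
  i = -1 \/ i = 0 \/ i = 1 -> j = -1 \/ j = 0 \/ j = 1 ->
  i < x < i + 1 -> j < y < j + 1 ->
  6 * Num.min (cone m n (x - i) (j + 1 - y)) (cone m n (i + 1 - x) (y - j)) <=
  sum33 (above_graph (y + m * x) m (y + n * x) n) +
  sum33 (above_graph (y + n * x) n (y + m * x) m).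
Proof.
move=> n0 nm c1 c2 c3 c4 hi hj xi yj.
have n0' := ltW n0.
rewrite (sum33_above_graph_onem (y + m * x) m (y + n * x) n).
have E u : 1 - (y + u * x) + u = (1 - y) + u * (1 - x) by ring.
rewrite !E.
have hP a b := @sum33_ge_cone R x y m n a b n0' nm.
have hQ a b := @sum33_ge_cone R (1 - x) (1 - y) m n a b n0' nm.
set P := sum33 _ in hP *; set Q := sum33 _ in hQ *.
set al := x - i; set ga := j + 1 - y; set be := i + 1 - x; set de := y - j.
have al01 : 0 < al < 1 by rewrite /al; lra.
have be01 : 0 < be < 1 by rewrite /be; lra.
have ga01 : 0 < ga < 1 by rewrite /ga; lra.
have de01 : 0 < de < 1 by rewrite /de; lra.
have ab : al + be = 1 by rewrite /al /be; ring.
have gd : ga + de = 1 by rewrite /ga /de; ring.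
have xE : x = i + al by rewrite /al; ring.
have yE : y = j + de by rewrite /de; ring.
clearbody al be ga de P Q; subst x y; clear xi yj.
have al0 : 0 <= al by case/andP: al01 => /ltW.
have be0 : 0 <= be by case/andP: be01 => /ltW.
have p0 : 0 <= cone m n al ga by exact: cone_ge0.
have q0 : 0 <= cone m n be de by exact: cone_ge0.
have s2 a b : 0 <= a -> cone m n (2 * a) (2 * b) = 4 * cone m n a b.
  by move=> a0; rewrite cone_scale//; congr (_ * _); ring.
have s3 a b : 0 <= a -> cone m n (3 * a) (3 * b) = 9 * cone m n a b.
  by move=> a0; rewrite cone_scale//; congr (_ * _); ring.
have mab : m * be + m * al = m by rewrite -mulrDr addrC ab mulr1.
have nab : n * be + n * al = n by rewrite -mulrDr addrC ab mulr1.
have hma : 0 <= m * al by apply: mulr_ge0 => //; exact: le_trans nm.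
have hmb : 0 <= m * be by apply: mulr_ge0 => //; exact: le_trans nm.
have hna : 0 <= n * al by exact: mulr_ge0.
have hnb : 0 <= n * be by exact: mulr_ge0.
have i11 : -1 <= i <= 1 by case: hi => [->|[->|->]]; lra_from n0.
have j11 : -1 <= j <= 1 by case: hj => [->|[->|->]]; lra_from n0.
have P1 : cone m n al ga <= P by apply: hP; lra_from i11 j11 al01 de01 gd.
have Q1 : cone m n be de <= Q by apply: hQ; lra_from i11 j11 al01 de01 ab.
have := ge_minl (cone m n al ga) (cone m n be de).
have := ge_minr (cone m n al ga) (cone m n be de).
move: (Num.min _ _) => z zq zp.
case: hi hj => [iE|[iE|iE]] [jE|[jE|jE]]; subst i j.
- exfalso; lra_from c3 mab hmb ab de01 gd.
- have h : cone m n (2 * be) (2 * de) + cone m n al ga <= cone m n (2 * be + al) (2 * de + ga).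
    by apply: cone_shift_right; lra_from c3 al0 be0 ga01 de01 mab hmb n0 nm.
  rewrite (s2 _ _ be0) in h.
  have : cone m n (2 * be + al) (2 * de + ga) <= Q by apply: hQ; lra_from ab gd al01 de01.
  move=> hq; lra_from h hq P1 zp zq.
- have : cone m n (3 * be) (3 * de) <= Q by apply: hQ; lra_from ab gd al01 de01.
  rewrite (s3 _ _ be0) => hq; lra_from hq P1 p0 q0 zp zq.
- have h : cone m n (2 * al) (2 * ga) + cone m n be de <= cone m n (2 * al + be) (2 * ga + de).
    by apply: cone_shift_down; lra_from c1 al0 be0 ga01 de01 gd hna hnb n0 nm.
  rewrite (s2 _ _ al0) in h.
  have : cone m n (2 * al + be) (2 * ga + de) <= P by apply: hP; lra_from ab gd al01 de01.
  move=> hp; lra_from h hp Q1 zp zq.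
- have : cone m n (2 * al) (2 * ga) <= P by apply: hP; lra_from ab gd al01 de01.
  have : cone m n (2 * be) (2 * de) <= Q by apply: hQ; lra_from ab gd al01 de01.
  rewrite (s2 _ _ al0) (s2 _ _ be0) => hq hp; lra_from hp hq p0 q0 zp zq.
- have h : cone m n (2 * be) (2 * de) + cone m n al ga <= cone m n (2 * be + al) (2 * de + ga).
    by apply: cone_shift_down; lra_from c4 al0 be0 ga01 de01 gd hna hnb nab n0 nm.
  rewrite (s2 _ _ be0) in h.
  have : cone m n (2 * be + al) (2 * de + ga) <= Q by apply: hQ; lra_from ab gd al01 de01.
  move=> hq; lra_from h hq P1 zp zq.
- have : cone m n (3 * al) (3 * ga) <= P by apply: hP; lra_from ab gd al01 de01.
  rewrite (s3 _ _ al0) => hp; lra_from hp Q1 p0 q0 zp zq.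
- have h : cone m n (2 * al) (2 * ga) + cone m n be de <= cone m n (2 * al + be) (2 * ga + de).
    by apply: cone_shift_right; lra_from c2 al0 be0 ga01 de01 gd ab mab hma hmb n0 nm.
  rewrite (s2 _ _ al0) in h.
  have : cone m n (2 * al + be) (2 * ga + de) <= P by apply: hP; lra_from ab gd al01 de01.
  move=> hp; lra_from h hp Q1 zp zq.
- exfalso; lra_from c2 mab hma al01 de01 ab.
Qed.

(** The crossing leaves one sign only in the cells that do not contain it, by
    [above_graph_eq0]; parallel lines leave one sign everywhere. *)
Lemma graphs_balanced_steeper k m k' n : 0 < n -> n <= m ->
  0 <= k -> k - m <= 1 -> 0 <= k' -> k' - n <= 1 -> graphs_balanced k m k' n.
Proof.
move=> n0 nm k0 km k0' kn.
have n0' := ltW n0.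
have gr0 a u a' u' i j : 0 <= above_graph a u a' u' i j by exact: gap_ge0.
move: (nm); rewrite le_eqVlt => /orP[/eqP mE|mn].
  have Z a b i j : a <= b -> above_graph a n b n i j = 0.
    by move=> ab; apply: gap_eq0 => s _; apply: clip_homo; lra.
  (* the point (2, 2) lies in no open cell of the stencil *)
  apply: (@stencil_balanced_single 2 2); try exact: gr0.
    move=> i j _; rewrite -mE.
    have [h|h] := leP k k'; [left|right]; apply: Z => //; exact: ltW.
  by move=> i j hi _ xi; exfalso; case: hi xi => [->|[->|->]] xi; lra_from xi.
have mnp : 0 < m - n by lra.
set x := (k - k') / (m - n).
have xE : (m - n) * x = k - k' by rewrite /x mulrC divfK//; lra.
clearbody x; set y := k - m * x.
have kE : k = y + m * x by rewrite /y; ring.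
have kE' : k' = y + n * x by rewrite /y; lra.
clearbody y; rewrite /graphs_balanced kE kE'.
rewrite kE in k0 km; rewrite kE' in k0' kn.
have mirror i j : above_graph (y + n * x) n (y + m * x) m i j =
    above_graph ((1 - y) + m * (1 - x)) m ((1 - y) + n * (1 - x)) n (- i) (- j).
  rewrite /above_graph gap_onem.
  have E u : 1 - (y + u * x - u * i - j) + u = (1 - y) + u * (1 - x) - u * - i - - j by ring.
  by rewrite !E.
apply: (@stencil_balanced_single x y); try exact: gr0.
  move=> i j h.
  have : (x <= i \/ j + 1 <= y) \/ (1 - x <= - i \/ - j + 1 <= 1 - y).
    case/orP: h; rewrite negb_and -!leNgt => /orP[h|h].
    - by left; left.
    - by right; left; lra.
    - by right; right; lra.
    - by left; right.
  case=> [h1|h1]; [left|right]; first exact: above_graph_eq0.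
  by rewrite mirror; exact: above_graph_eq0.
move=> i j hi hj xi yj.
apply: le_trans (cone_pair_bound n0 nm k0' km k0 kn hi hj xi yj).
rewrite ler_pM2l// le_min !ge_min; apply/andP; split; apply/orP; [left|right].
  by apply: above_graph_le_cone => //; lra.
rewrite mirror.
have -> : i + 1 - x = 1 - x - - i by ring.
have -> : y - j = - j + 1 - (1 - y) by ring.
by apply: above_graph_le_cone => //; lra.
Qed.

Lemma graphs_balanced_same k m k' n : 0 < m -> 0 < n ->
  0 <= k -> k - m <= 1 -> 0 <= k' -> k' - n <= 1 -> graphs_balanced k m k' n.
Proof.
move=> m0 n0 k0 km k0' kn; have [h|/ltW h] := leP n m.
  exact: graphs_balanced_steeper.
by apply: graphs_balancedC; exact: graphs_balanced_steeper.
Qed.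

End SlopesOfSameSign.

(** * Areas of plane regions *)

Section PlaneArea.
Context {R : realType}.
Implicit Types (A B : set (plane R)) (lo hi : R -> R).

(** Whether the endpoints belong to the set is left open, since regions
    bounded by several lines contain parts of their boundary only. *)
Lemma lebesgue_between (a b : R) (D : set (measurableTypeR R)) : measurable D ->
  (forall y, a < y < b -> D y) -> (forall y, D y -> a <= y <= b) ->
  @lebesgue_measure R D = (Num.max 0 (b - a))%:E.
Proof.
move=> mD oD Dc.
have [ab|ab] := leP b a.
  rewrite (max_idPl _) ?subr_le0//; apply/eqP; rewrite eq_le measure_ge0 andbT.
  apply: (@le_trans _ _ (@lebesgue_measure R `[a, b])).
    by apply: le_measure; rewrite ?inE//.
  by rewrite (lebesgue_measure_itv `[a, b])/= lte_fin ltNge ab/= lexx.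
rewrite (max_idPr _); last by rewrite subr_ge0 ltW.
apply/eqP; rewrite eq_le; apply/andP; split.
  apply: (@le_trans _ _ (@lebesgue_measure R `[a, b])).
    by apply: le_measure; rewrite ?inE//.
  by rewrite (lebesgue_measure_itv `[a, b])/= lte_fin ab.
apply: (@le_trans _ _ (@lebesgue_measure R `]a, b[)).
  by rewrite (lebesgue_measure_itv `]a, b[)/= lte_fin ab.
by apply: le_measure; rewrite ?inE//.
Qed.

Lemma area_slices A (x0 x1 : R) lo hi : measurable A ->
  continuous (fun x => Num.max 0 (hi x - lo x)) ->
  (forall x y, A (x, y) -> x0 <= x <= x1 /\ lo x <= y <= hi x) ->
  (forall x y, x0 <= x <= x1 -> lo x < y < hi x -> A (x, y)) ->
  area A = (integ x0 x1 (fun x => Num.max 0 (hi x - lo x)))%:E.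
Proof.
move=> mA cF Ac oA.
have -> : area A = (\int[@lebesgue_measure R]_x (@lebesgue_measure R (xsection A x)))%E by [].
rewrite (_ : integ x0 x1 _ = fine (\int[@lebesgue_measure R]_(x in `[x0, x1])
   (Num.max 0 (hi x - lo x))%:E))%E//.
rewrite fineK; last first.
  by apply: integrable_fin_num => //; exact: continuous_itv_integrable.
rewrite [RHS]integral_mkcond; apply: eq_integral => x _.
rewrite patchE; case: ifPn => [|]; rewrite ?inE ?notin_setE/= in_itv/= => hx.
  apply: lebesgue_between; first exact: measurable_xsection.
    by move=> y ly; rewrite /xsection/= inE; exact: oA.
  by move=> y; rewrite /xsection/= inE => /Ac[].
rewrite (_ : xsection A x = set0) ?measure0//.
rewrite -subset0 => y; rewrite /xsection/= inE => /Ac[].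
by move=> h _; exact: hx.
Qed.

Lemma area_rect (D E : set (measurableTypeR R)) : measurable D -> measurable E ->
  area (D `*` E) = (@lebesgue_measure R D * @lebesgue_measure R E)%E.
Proof. exact: product_measure1E. Qed.

Definition swap_plane (x : plane R) : plane R := (x.2, x.1).

Lemma measurable_swap_plane : measurable_fun setT swap_plane.
Proof. by apply/measurable_fun_pairP; split => /=; [exact: measurable_snd|exact: measurable_fst]. Qed.

HB.instance Definition _ := isMeasurableFun.Build _ _ (plane R) (plane R) swap_plane measurable_swap_plane.

(** By uniqueness of the product measure. *)
Lemma area_swap A : measurable A -> area (swap_plane @^-1` A) = area A.
Proof.
move=> mA; symmetry.
have := @product_measure_unique _ _ _ _ R (@lebesgue_measure R) (@lebesgue_measure R)
  (pushforward (@area R) swap_plane).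
apply => //.
move=> D E mD mE /=; rewrite /pushforward.
rewrite (_ : swap_plane @^-1` (D `*` E) = E `*` D); last first.
  by apply/seteqP; split => -[x y] /= [].
by apply: etrans (area_rect mE mD) _; rewrite muleC.
Qed.

Lemma measurable_half_plane (a b c : R) : measurable (half_plane a b c : set (plane R)).
Proof.
have mf : measurable_fun setT (fun x : plane R => a * x.1 + b * x.2).
  by apply: measurable_funD; apply: measurable_funM => //.
have -> : half_plane a b c = (fun x : plane R => a * x.1 + b * x.2) @^-1` `]-oo, c]%classic.
  by apply/seteqP; split => x; rewrite /half_plane/= in_itv.
rewrite -[X in measurable X]setTI; apply: mf => //.
Qed.

Lemma measurable_cell (h : R) t : measurable (cell h t : set (plane R)).
Proof. by apply: measurableX; exact: measurable_itv. Qed.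

End PlaneArea.

(** * Areas cut out of a cell by two lines *)

Section Pieces.
Context {R : realType}.
Implicit Types (h a b c u v : R) (t : int * int).

Lemma area_cell_slices h t (A : set (plane R)) (lo hi : R -> R) : 0 < h -> measurable A ->
  continuous (fun u => Num.max 0 (hi u - lo u)) ->
  (forall u v, A (h * (u + t.1%:~R), h * (v + t.2%:~R)) -> 0 <= u <= 1 /\ lo u <= v <= hi u) ->
  (forall u v, 0 <= u <= 1 -> lo u < v < hi u -> A (h * (u + t.1%:~R), h * (v + t.2%:~R))) ->
  area A = (h ^+ 2 * integ 0 1 (fun u => Num.max 0 (hi u - lo u)))%:E.
Proof.
move=> h0 mA cF Ac oA.
set t1 : R := t.1%:~R in Ac oA *; set t2 : R := t.2%:~R in Ac oA *.
clearbody t1 t2.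
pose U x := h^-1 * x + (- t1).
have UE x : h * (U x + t1) = x by rewrite /U subrK mulVKf//; lra.
have VE y : h * (h^-1 * y - t2 + t2) = y by rewrite subrK mulVKf//; lra.
have hi0 : 0 < h^-1 by rewrite invr_gt0.
pose lo' x := h * (lo (U x) + t2); pose hi' x := h * (hi (U x) + t2).
have E x : Num.max 0 (hi' x - lo' x) = h * Num.max 0 (hi (U x) - lo (U x)).
  rewrite -[in LHS](mulr0 h) /hi' /lo' -mulrBr -maxr_pMr; last exact: ltW.
  by congr (_ * Num.max _ _); ring.
have cU : continuous (fun x => h * Num.max 0 (hi (U x) - lo (U x))).
  move=> x; apply: cvgM; first exact: cvg_cst.
  apply: (@continuous_comp _ _ _ U (fun u => Num.max 0 (hi u - lo u))); last exact: cF.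
  exact: continuous_affine.
have lt1 x (z : R) : (h * (z + t2) < x) = (z < h^-1 * x - t2).
  by rewrite ltrBrDr -(ltr_pM2l hi0 (h * _)) mulKf//; lra.
have lt2 x (z : R) : (x < h * (z + t2)) = (h^-1 * x - t2 < z).
  by rewrite ltrBlDr -(ltr_pM2l hi0 x) mulKf//; lra.
have := @area_slices R A (h * t1) (h * (1 + t1)) lo' hi' mA.
move=> ->.
- congr EFin.
  have -> : (fun x => Num.max 0 (hi' x - lo' x)) = (fun x => h * Num.max 0 (hi (U x) - lo (U x))).
    by apply/funext => x; exact: E.
  have := @integ_subst R h (h * t1) 0 1 (fun x => h * Num.max 0 (hi (U x) - lo (U x))) h0 ler01 cU.
  rewrite mulr0 add0r mulr1 -[X in integ _ (X + _)]mulr1 -mulrDr => ->.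
  rewrite expr2 -mulrA; congr (_ * _); rewrite -integZ//; apply: eq_integ => u _.
  by rewrite (_ : U (h * u + h * t1) = u)// /U -mulrDr mulKf ?addrK//; lra.
- by move=> x; under eq_fun do rewrite E; exact: cU.
- move=> x y Axy.
  have [] := Ac (U x) (h^-1 * y - t2); first by rewrite UE VE.
  rewrite /U => /andP[u0 u1] /andP[v0 v1]; split.
    rewrite -(ler_pM2l hi0) mulKf; last lra.
    by rewrite -(ler_pM2l hi0 x) mulKf; lra.
  by rewrite /lo' /hi' !leNgt lt1 lt2 -!leNgt v0 v1.
- move=> x y xx; rewrite /lo' /hi' lt1 lt2 => hy.
  have := oA (U x) (h^-1 * y - t2); rewrite UE VE; apply => //.
  move: xx; rewrite -(ler_pM2l hi0) mulKf; last lra.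
  by rewrite -(ler_pM2l hi0 x) mulKf /U; lra.
Qed.

(** In the coordinates where the cell t is the unit square, the line
    a x + b y = c is the graph v = level - (a / b) u. *)
Definition level h t a b c : R := c / (b * h) - a / b * t.1%:~R - t.2%:~R.

Lemma half_plane_below h t a b c u v : 0 < h -> 0 < b ->
  half_plane a b c (h * (u + t.1%:~R), h * (v + t.2%:~R)) <-> v <= level h t a b c - a / b * u.
Proof.
move=> h0 b0; rewrite /half_plane/= /level.
set t1 := _%:~R; set t2 := _%:~R.
have bh : 0 < b * h by exact: mulr_gt0.
rewrite -(ler_pM2l bh v).
have -> : b * h * (c / (b * h) - a / b * t1 - t2 - a / b * u) = c - a * (h * t1) - b * h * t2 - a * (h * u).
  by field; apply/andP; split; lra.
by split=> ?; lra.
Qed.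

Lemma half_plane_above h t a b c u v : 0 < h -> b < 0 ->
  half_plane a b c (h * (u + t.1%:~R), h * (v + t.2%:~R)) <-> level h t a b c - a / b * u <= v.
Proof.
move=> h0 b0; rewrite /half_plane/= /level.
set t1 := _%:~R; set t2 := _%:~R.
have bh : b * h < 0 by rewrite pmulr_llt0.
rewrite -(ler_nM2l bh v).
have -> : b * h * (c / (b * h) - a / b * t1 - t2 - a / b * u) = c - a * (h * t1) - b * h * t2 - a * (h * u).
  by field; apply/andP; split; lra.
by split=> ?; lra.
Qed.

Lemma in_cell h t u v : 0 < h ->
  cell h t (h * (u + t.1%:~R), h * (v + t.2%:~R)) <-> 0 <= u <= 1 /\ 0 <= v <= 1.
Proof.
move=> h0; rewrite /cell/= !in_itv/= !ler_pM2l//.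
by split => [[/andP[? ?] /andP[? ?]]|[/andP[? ?] /andP[? ?]]]; split; apply/andP; split; lra.
Qed.

Definition piece h t a b c a' b' c' : set (plane R) :=
  cell h t `&` half_plane a b c `&` ~` half_plane a' b' c'.

Lemma measurable_piece h t a b c a' b' c' : measurable (piece h t a b c a' b' c').
Proof.
apply: measurableI; [apply: measurableI|apply: measurableC].
- exact: measurable_cell.
- exact: measurable_half_plane.
- exact: measurable_half_plane.
Qed.

(** The slice of the unit square between the graphs. *)
Lemma clip_diff (f g : R) : Num.max 0 (Num.min 1 f - Num.max 0 g) = Num.max 0 (clip f - clip g).
Proof.
rewrite /clip.
by case: (leP 1 f) => ?; case: (leP 1 g) => ?; case: (leP 0 f) => ?; case: (leP 0 g) => ?;
  rewrite ?(max_idPr (ler01 : 0 <= 1 :> R)); (repeat case: leP => ?); lra.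
Qed.

(** The four lemmas on areas of pieces correspond to the sides of the graphs
    on which the half-planes lie: both below, both above, below and above,
    above and below. *)
Lemma area_piece_gap h t a b c a' b' c' : 0 < h -> 0 < b -> 0 < b' ->
  area (piece h t a b c a' b' c') =
  (h ^+ 2 * gap (level h t a b c) (a / b) (level h t a' b' c') (a' / b'))%:E.
Proof.
move=> h0 b0 b0'.
set k := level _ _ _ _ c; set k' := level _ _ _ _ c'.
rewrite (@area_cell_slices h t _ (fun u => Num.max 0 (k' - a' / b' * u))
  (fun u => Num.min 1 (k - a / b * u)))//.
- by congr (_ * _)%:E; apply: eq_integ => u _; exact: clip_diff.
- exact: measurable_piece.
- by move=> x; under eq_fun do rewrite clip_diff; exact: continuous_gap.
- move=> u v [[/in_cell-/(_ h0)[u01 v01] /half_plane_below-/(_ h0 b0)]].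
  rewrite -/k => hk /= hk'; split => //.
  have : k' - a' / b' * u < v.
    by rewrite ltNge; apply/negP => H; apply: hk'; apply/half_plane_below.
  rewrite ge_max le_min; lra.
- move=> u v u01; rewrite gt_max lt_min => /andP[/andP[v0 hk'] /andP[v1 hk]].
  split; first split.
  + by apply/in_cell => //; lra.
  + by apply/half_plane_below => //; rewrite -/k; lra.
  + by move=> /half_plane_below-/(_ h0 b0'); rewrite -/k'; lra.
Qed.

Lemma area_piece_gapN h t a b c a' b' c' : 0 < h -> b < 0 -> b' < 0 ->
  area (piece h t a b c a' b' c') =
  (h ^+ 2 * gap (level h t a' b' c') (a' / b') (level h t a b c) (a / b))%:E.
Proof.
move=> h0 b0 b0'.
set k := level _ _ _ _ c; set k' := level _ _ _ _ c'.
rewrite (@area_cell_slices h t _ (fun u => Num.max 0 (k - a / b * u))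
  (fun u => Num.min 1 (k' - a' / b' * u)))//.
- by congr (_ * _)%:E; apply: eq_integ => u _; exact: clip_diff.
- exact: measurable_piece.
- by move=> x; under eq_fun do rewrite clip_diff; exact: continuous_gap.
- move=> u v [[/in_cell-/(_ h0)[u01 v01] /half_plane_above-/(_ h0 b0)]].
  rewrite -/k => hk /= hk'; split => //.
  have : v < k' - a' / b' * u.
    by rewrite ltNge; apply/negP => H; apply: hk'; apply/half_plane_above.
  rewrite ge_max le_min; lra.
- move=> u v u01; rewrite gt_max lt_min => /andP[/andP[v0 hk] /andP[v1 hk']].
  split; first split.
  + by apply/in_cell => //; lra.
  + by apply/half_plane_above => //; rewrite -/k; lra.
  + by move=> /half_plane_above-/(_ h0 b0'); rewrite -/k'; lra.
Qed.

Lemma clip_min_diff (f g : R) :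
  Num.max 0 (Num.min 1 (Num.min f g) - 0) = Num.min (clip f) (clip g).
Proof.
rewrite subr0 /clip; case: (leP f g) => fg; [symmetry; apply/min_idPl|symmetry; apply/min_idPr].
  exact: clip_homo.
by apply: clip_homo; exact: ltW.
Qed.

Lemma clip_max_diff (f g : R) :
  Num.max 0 (1 - Num.max 0 (Num.max f g)) = Num.min (1 - clip f) (1 - clip g).
Proof.
rewrite !clip_onem -clip_min_diff; congr (Num.max _ _).
by case: (leP f g) => ?; case: (leP (1 - f) (1 - g)) => ?; (repeat case: leP => ?); lra.
Qed.

Lemma area_piece_below2 h t a b c a' b' c' : 0 < h -> 0 < b -> b' < 0 ->
  area (piece h t a b c a' b' c') =
  (h ^+ 2 * below2 (level h t a b c) (a / b) (level h t a' b' c') (a' / b'))%:E.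
Proof.
move=> h0 b0 b0'.
set k := level _ _ _ _ c; set k' := level _ _ _ _ c'.
rewrite (@area_cell_slices h t _ (fun u => 0)
  (fun u => Num.min 1 (Num.min (k - a / b * u) (k' - a' / b' * u))))//.
- by congr (_ * _)%:E; apply: eq_integ => u _; exact: clip_min_diff.
- exact: measurable_piece.
- by move=> x; under eq_fun do rewrite clip_min_diff; exact: continuous_below2.
- move=> u v [[/in_cell-/(_ h0)[u01 v01] /half_plane_below-/(_ h0 b0)]].
  rewrite -/k => hk /= hk'; split => //.
  have : v < k' - a' / b' * u.
    by rewrite ltNge; apply/negP => H; apply: hk'; apply/half_plane_above.
  rewrite !le_min; lra.
- move=> u v u01; rewrite !lt_min => /and4P[v0 v1 hk hk'].
  split; first split.
  + by apply/in_cell => //; lra.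
  + by apply/half_plane_below => //; rewrite -/k; lra.
  + by move=> /half_plane_above-/(_ h0 b0'); rewrite -/k'; lra.
Qed.

Lemma area_piece_above2 h t a b c a' b' c' : 0 < h -> b < 0 -> 0 < b' ->
  area (piece h t a b c a' b' c') =
  (h ^+ 2 * above2 (level h t a b c) (a / b) (level h t a' b' c') (a' / b'))%:E.
Proof.
move=> h0 b0 b0'.
set k := level _ _ _ _ c; set k' := level _ _ _ _ c'.
rewrite (@area_cell_slices h t _ (fun u => Num.max 0 (Num.max (k - a / b * u) (k' - a' / b' * u)))
  (fun u => 1))//.
- by congr (_ * _)%:E; apply: eq_integ => u _; exact: clip_max_diff.
- exact: measurable_piece.
- by move=> x; under eq_fun do rewrite clip_max_diff; exact: continuous_above2.
- move=> u v [[/in_cell-/(_ h0)[u01 v01] /half_plane_above-/(_ h0 b0)]].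
  rewrite -/k => hk /= hk'; split => //.
  have : k' - a' / b' * u < v.
    by rewrite ltNge; apply/negP => H; apply: hk'; apply/half_plane_below.
  rewrite !ge_max; lra.
- move=> u v u01; rewrite !gt_max => /andP[/and3P[v0 hk hk'] v1].
  split; first split.
  + by apply/in_cell => //; lra.
  + by apply/half_plane_above => //; rewrite -/k; lra.
  + by move=> /half_plane_below-/(_ h0 b0'); rewrite -/k'; lra.
Qed.

End Pieces.

(** * Graphs meeting the central cell *)

Section MeetingGraphs.
Context {R : realType}.
Implicit Types (h a b c k m u v x y : R) (t : int * int) (p q : R -> R -> R).

(** The line y = k - m x meets the unit square. *)
Definition meets_cell k m : Prop := exists2 u, 0 <= u <= 1 & 0 <= k - m * u <= 1.

Lemma meets_cell_decr k m : 0 <= m -> meets_cell k m -> 0 <= k /\ k - m <= 1.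
Proof.
move=> m0 [u /andP[u0 u1] ku]; have mu := mulr_ge0 m0 u0.
have mu1 : 0 <= m * (1 - u) by rewrite mulr_ge0// subr_ge0.
lra.
Qed.

Lemma meets_cell_mirror k m : meets_cell k m -> meets_cell (k - m) (- m).
Proof. by move=> [u u01 ku]; exists (1 - u); lra. Qed.

Lemma meets_cell_incr k m : m <= 0 -> meets_cell k m -> k <= 1 /\ 0 <= k - m.
Proof. by move=> m0 /meets_cell_mirror/(meets_cell_decr (k := k - m) (m := - m)); lra. Qed.

Lemma graphs_balanced_meeting k m k' m' :
  meets_cell k m -> meets_cell k' m' -> graphs_balanced k m k' m'.
Proof.
have dec := meets_cell_decr; have inc := meets_cell_incr.
move=> M M'.
have [m0|m0] := leP m 0; have [m0'|m0'] := leP m' 0.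
- have [z0|mn0] := eqVneq m 0.
    have nn : 0 <= m by rewrite z0.
    have := dec _ _ nn M; have := inc _ _ m0' M'.
    by move=> [? ?] [? ?]; apply: graphs_balanced_adjacent => //; lra.
  have [z0|mn0'] := eqVneq m' 0.
    have nn : 0 <= m' by rewrite z0.
    have := dec _ _ nn M'; have := inc _ _ m0 M.
    by move=> [? ?] [? ?]; apply: graphs_balancedC; apply: graphs_balanced_adjacent => //; lra.
  have [k1 km] := inc _ _ m0 M; have [k1' km'] := inc _ _ m0' M'.
  apply: graphs_balanced_mirror; apply: graphs_balanced_same => //;
    by rewrite ?oppr_gt0 ?lt_neqAle ?mn0 ?mn0' ?opprK ?subrK.
- apply: graphs_balancedC.
  have := inc _ _ m0 M; have := dec _ _ (ltW m0') M'.
  by move=> [? ?] [? ?]; apply: graphs_balanced_adjacent => //; lra.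
- have := dec _ _ (ltW m0) M; have := inc _ _ m0' M'.
  by move=> [? ?] [? ?]; apply: graphs_balanced_adjacent => //; lra.
- have := dec _ _ (ltW m0) M; have := dec _ _ (ltW m0') M'.
  by move=> [? ?] [? ?]; apply: graphs_balanced_same => //; lra.
Qed.

Definition below_both k m k' m' x y := below2 (k - m * x - y) m (k' - m' * x - y) m'.
Definition above_both k m k' m' x y := above2 (k - m * x - y) m (k' - m' * x - y) m'.

Lemma below2_reflect k m k' m' : below2 k m k' m' = below2 (k - m) (- m) (k' - m') (- m').
Proof.
have := @integ_reflect R 1 0 1 (fun s => Num.min (clip (k - m * s)) (clip (k' - m' * s))) ler01.
rewrite subrr subr0 /below2 => ->; last exact: continuous_below2.
by apply: eq_integ => s _; congr (Num.min (clip _) (clip _)); ring.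
Qed.

Lemma above2_reflect k m k' m' : above2 k m k' m' = above2 (k - m) (- m) (k' - m') (- m').
Proof.
have E (z n : R) : 1 - (z - n) + - n = 1 - z by ring.
by rewrite !above2E below2_reflect !E !addrK.
Qed.

(** In the left column the lines are higher and stay above the bottom of the
    central row; the right column is its image under the central symmetry. *)
Lemma both_balanced_decreasing k m k' m' : 0 <= m -> 0 <= m' -> m * m' <= 1 ->
  0 <= k -> k - m <= 1 -> 0 <= k' -> k' - m' <= 1 ->
  stencil_balanced (below_both k m k' m') (above_both k m k' m').
Proof.
move=> m0 m0' mm k0 km k0' km'; apply: stencil_balanced_cols => i hi.
suff : column_balanced (k - m * i) m (k' - m' * i) m'.
  rewrite /column_balanced /below_both /above_both /sum3 !subr0 !opprK.
  set p1 := below2 _ _ _ _; set q1 := above2 _ _ _ _.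
  set p2 := below2 _ _ _ _; set q2 := above2 _ _ _ _.
  set p3 := below2 _ _ _ _; set q3 := above2 _ _ _ _.
  by move: p1 q1 p2 q2 p3 q3 => *; lra.
case: hi => [->|[->|->]].
- by apply: column_outer => //; lra.
- by rewrite !mulr0 !subr0; apply: column_center => //; lra.
- by apply: column_balanced_onem; apply: column_outer => //; lra.
Qed.

Lemma both_balanced k m k' m' : 0 <= m * m' <= 1 ->
  meets_cell k m -> meets_cell k' m' ->
  stencil_balanced (below_both k m k' m') (above_both k m k' m').
Proof.
have dec := meets_cell_decr; have flip := meets_cell_mirror.
move=> /andP[mm0 mm1] M M'.
have [[m0 m0']|[m0 m0']] : (0 <= m /\ 0 <= m') \/ (m <= 0 /\ m' <= 0).
  have [m0|m0] := leP 0 m; have [m0'|m0'] := leP 0 m'; [by left| | |by right; split; exact: ltW].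
  - have [->|mn0] := eqVneq m 0; first by right; split => //; exact: ltW.
    have : m * m' < 0 by rewrite pmulr_rlt0// lt_neqAle eq_sym mn0.
    by rewrite ltNge mm0.
  - have [->|mn0] := eqVneq m' 0; first by right; split => //; exact: ltW.
    have : m * m' < 0 by rewrite pmulr_llt0// lt_neqAle eq_sym mn0.
    by rewrite ltNge mm0.
- have := dec _ _ m0 M; have := dec _ _ m0' M'.
  by move=> [? ?] [? ?]; apply: both_balanced_decreasing.
- apply: stencil_balanced_mirror.
  have E (z n i j : R) : z - n * - i - j - n = z - n - - n * i - j by ring.
  have -> : (fun i => [eta below_both k m k' m' (- i)]) = below_both (k - m) (- m) (k' - m') (- m').
    apply/funext => i; apply/funext => j.
    by rewrite /below_both below2_reflect !E.
  have -> : (fun i => [eta above_both k m k' m' (- i)]) = above_both (k - m) (- m) (k' - m') (- m').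
    apply/funext => i; apply/funext => j.
    by rewrite /above_both above2_reflect !E.
  have := dec _ _ _ (flip _ _ M); have := dec _ _ _ (flip _ _ M').
  rewrite !oppr_ge0 => /(_ m0')[? ?] /(_ m0)[? ?].
  by apply: both_balanced_decreasing; rewrite ?oppr_ge0// mulrNN.
Qed.

(** A line parallel to the columns passes through the central one, so the
    share of the half-plane is 0 in one of the outer columns and 1 in the other;
    the same holds for the rows. *)
Lemma product_balanced (f g : R -> R) :
  (forall i, 0 <= f i <= 1) -> (forall i, 0 <= g i <= 1) ->
  f (-1) = 0 \/ f (-1) = 1 -> f 1 = 1 - f (-1) ->
  g (-1) = 0 \/ g (-1) = 1 -> g 1 = 1 - g (-1) ->
  stencil_balanced (fun i j => f i * g j) (fun i j => (1 - f i) * (1 - g j)).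
Proof.
move=> f01 g01 fm f1 gm g1; rewrite /stencil_balanced /sum3 f1 g1.
move: (f01 0) (g01 0); move: (f 0) (g 0) => u v u01 v01.
have uv : 0 <= u * v by apply: mulr_ge0; lra.
have uv' : 0 <= (1 - u) * (1 - v) by apply: mulr_ge0; lra.
have := ge_minl (u * v) ((1 - u) * (1 - v)).
have := ge_minr (u * v) ((1 - u) * (1 - v)).
have h1 : u * v <= u by apply: ler_piMr; lra.
have h2 : (1 - u) * (1 - v) <= 1 - u by apply: ler_piMr; lra.
set z := Num.min _ _ => zq zp.
have m00 : Num.min (0 : R) 0 = 0 by apply/min_idPl.
have m10 : Num.min (1 : R) 0 = 0 by apply/min_idPr.
have m01 : Num.min (0 : R) 1 = 0 by apply/min_idPl.
have mu0 : Num.min u 0 = 0 by apply/min_idPr; lra.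
have mv0 : Num.min v 0 = 0 by apply/min_idPr; lra.
have m0u : Num.min 0 (1 - u) = 0 by apply/min_idPl; lra.
have m0v : Num.min 0 (1 - v) = 0 by apply/min_idPl; lra.
by case: fm => ->; case: gm => ->;
  rewrite !(subr0, subrr, mul1r, mul0r, mulr1, mulr0) ?m00 ?m10 ?m01 ?mu0 ?mv0 ?m0u ?m0v; lra.
Qed.

End MeetingGraphs.

(** * The area inequality for two half-planes *)

Section HalfPlanes.
Context {R : realType}.
Implicit Types (h a b c k m u v x y : R) (t : int * int) (p q : R -> R -> R).

Definition isum3 (F : int -> R) : R := F (- 1) + F 0 + F 1.

Definition piece_area h t a b c a' b' c' (i j : int) : R :=
  fine (area (piece h (t.1 + i, t.2 + j) a b c a' b' c')).

Definition half_planes_balanced h t a b c a' b' c' : Prop :=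
  6 * isum3 (fun i => isum3 (fun j =>
    Num.min (piece_area h t a b c a' b' c' i j) (piece_area h t a' b' c' a b c i j))) <=
  isum3 (fun i => isum3 (fun j =>
    piece_area h t a b c a' b' c' i j + piece_area h t a' b' c' a b c i j)).

Lemma half_planes_balanced_transfer p q h t a b c a' b' c' :
  (forall i j, piece_area h t a b c a' b' c' i j = h ^+ 2 * p i%:~R j%:~R) ->
  (forall i j, piece_area h t a' b' c' a b c i j = h ^+ 2 * q i%:~R j%:~R) ->
  stencil_balanced p q -> half_planes_balanced h t a b c a' b' c'.
Proof.
move=> pE qE; rewrite /half_planes_balanced /isum3 !pE !qE -!minr_pMr ?sqr_ge0//.
rewrite /stencil_balanced /sum3 -!mulrDr mulrCA => pq; apply: ler_wpM2l; first exact: sqr_ge0.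
by [].
Qed.

Lemma level_shift h t a b c (i j : int) :
  level h (t.1 + i, t.2 + j) a b c = level h t a b c - a / b * i%:~R - j%:~R.
Proof. by rewrite /level/= !intrD; ring. Qed.

Lemma half_planes_balancedC h t a b c a' b' c' :
  half_planes_balanced h t a b c a' b' c' -> half_planes_balanced h t a' b' c' a b c.
Proof.
rewrite /half_planes_balanced /isum3.
move: (piece_area h t a b c a' b' c') (piece_area h t a' b' c' a b c) => p q.
rewrite (minC (q (-1) (-1))) (minC (q (-1) 0)) (minC (q (-1) 1)).
rewrite (minC (q 0 (-1))) (minC (q 0 0)) (minC (q 0 1)).
rewrite (minC (q 1 (-1))) (minC (q 1 0)) (minC (q 1 1)).
lra.
Qed.

(** Reflection in the diagonal, which turns horizontal lines into vertical
    ones and inverts slopes. *)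
Lemma half_planes_balanced_swap h t a b c a' b' c' :
  half_planes_balanced h (t.2, t.1) b a c b' a' c' -> half_planes_balanced h t a b c a' b' c'.
Proof.
have E d e f d' e' f' i j :
    piece_area h (t.2, t.1) e d f e' d' f' j i = piece_area h t d e f d' e' f' i j.
  rewrite /piece_area/= -[in RHS]area_swap; last exact: measurable_piece.
  congr (fine (area _)); apply/seteqP; split => -[x y] /=.
    move=> [[[xi yi] H] H']; split; first split => //.
      by move: H; rewrite /half_plane/= addrC.
    by move: H'; rewrite /half_plane/= addrC.
  move=> [[[xi yi] H] H']; split; first split => //.
    by move: H; rewrite /half_plane/= addrC.
  by move: H'; rewrite /half_plane/= addrC.
rewrite /half_planes_balanced /isum3 !E.
move: (piece_area h t a b c a' b' c') (piece_area h t a' b' c' a b c) => p q.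
lra.
Qed.

Lemma boundary_line_unit h t a b c : 0 < h -> boundary_line a b c `&` cell h t !=set0 ->
  exists u v, [/\ 0 <= u <= 1, 0 <= v <= 1 & c = a * (h * (u + t.1%:~R)) + b * (h * (v + t.2%:~R))].
Proof.
move=> h0 [[x y] [/= bl cl]].
have E (z : R) (n : int) : h * (z / h - n%:~R + n%:~R) = z by rewrite subrK mulrC divfK//; lra.
exists (x / h - t.1%:~R), (y / h - t.2%:~R).
have : cell h t (h * (x / h - t.1%:~R + t.1%:~R), h * (y / h - t.2%:~R + t.2%:~R)) by rewrite !E.
by move=> /in_cell-/(_ h0)[u01 v01]; split => //; rewrite !E.
Qed.

Lemma level_meets h t a b c : 0 < h -> b != 0 -> boundary_line a b c `&` cell h t !=set0 ->
  meets_cell (level h t a b c) (a / b).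
Proof.
move=> h0 b0 /(boundary_line_unit h0)[u [v [u01 v01 cE]]]; exists u => //.
rewrite (_ : _ - _ = v)// /level cE; field.
by rewrite b0/=; lra.
Qed.

Lemma balanced_nonvertical h t a b c a' b' c' : 0 < h ->
  b != 0 -> b' != 0 -> (b * b' < 0 -> a * a' <= 0 /\ b * b' <= a * a') ->
  boundary_line a b c `&` cell h t !=set0 -> boundary_line a' b' c' `&` cell h t !=set0 ->
  half_planes_balanced h t a b c a' b' c'.
Proof.
move=> h0 b0 b0' aa /(level_meets h0 b0) M /(level_meets h0 b0') M'.
move: (b0) (b0'); rewrite !neq_lt => /orP[bn|bp] /orP[bn'|bp'].
- apply: (half_planes_balanced_transfer _ _ (graphs_balancedC (graphs_balanced_meeting M M'))) => i j;
  by rewrite /piece_area area_piece_gapN// !level_shift.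
- apply: half_planes_balancedC.
  have mm : 0 <= a' / b' * (a / b) <= 1.
    have [|h1 h2] := aa; first by rewrite nmulr_rlt0.
    have -> : a' / b' * (a / b) = (a * a') / (b * b') by field; rewrite b0 b0'.
    have bb : b * b' < 0 by rewrite nmulr_rlt0.
    by rewrite ler_ndivrMr// mul1r h2 andbT; apply: mulr_le0 => //; rewrite invr_le0 ltW.
  apply: (half_planes_balanced_transfer _ _ (both_balanced mm M' M)) => i j.
    by rewrite /piece_area area_piece_below2// !level_shift.
  by rewrite /piece_area area_piece_above2// !level_shift above2C.
- have mm : 0 <= a / b * (a' / b') <= 1.
    have [|h1 h2] := aa; first by rewrite pmulr_rlt0.
    have -> : a / b * (a' / b') = (a * a') / (b * b') by field; rewrite b0 b0'.
    have bb : b * b' < 0 by rewrite pmulr_rlt0.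
    by rewrite ler_ndivrMr// mul1r h2 andbT; apply: mulr_le0 => //; rewrite invr_le0 ltW.
  apply: (half_planes_balanced_transfer _ _ (both_balanced mm M M')) => i j.
    by rewrite /piece_area area_piece_below2// !level_shift.
  by rewrite /piece_area area_piece_above2// !level_shift above2C.
- apply: (half_planes_balanced_transfer _ _ (graphs_balanced_meeting M M')) => i j;
  by rewrite /piece_area area_piece_gap// !level_shift.
Qed.

(** A cell is cut by a vertical and a horizontal line into products of a
    [share] and an [unshare]. *)
Definition share (d e : R) h (n : int) : set (measurableTypeR R) :=
  [set x | h * n%:~R <= x <= h * (n%:~R + 1) /\ d * x <= e].

Definition unshare (d e : R) h (n : int) : set (measurableTypeR R) :=
  [set x | h * n%:~R <= x <= h * (n%:~R + 1) /\ ~ (d * x <= e)].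

Lemma clip_length h u : 0 <= h -> Num.max 0 (Num.min h (h * u)) = h * clip u.
Proof. by move=> h0; rewrite /clip maxr_pMr// minr_pMr// mulr0 mulr1. Qed.

Lemma lebesgue_between_clip h n u (D : set (measurableTypeR R)) : 0 < h -> measurable D ->
  (forall s, 0 < s < 1 -> s < u -> D (h * (s + n))) ->
  (forall x, D x -> h * n <= x <= h * (n + 1) /\ x <= h * (u + n)) ->
  @lebesgue_measure R D = (h * clip u)%:E.
Proof.
move=> h0 mD oD Dc.
rewrite (@lebesgue_between R (h * n) (Num.min (h * (n + 1)) (h * (u + n)))) //.
- congr EFin; rewrite -clip_length; last exact: ltW.
  congr (Num.max _ _).
  by case: (leP (h * (n + 1)) (h * (u + n))) => ?; case: (leP h (h * u)) => ?; lra.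
- move=> y /andP[y0]; rewrite lt_min => /andP[y1 y2].
  have [s yE] : exists s, y = h * (s + n).
    by exists (y / h - n); rewrite subrK mulrC divfK//; lra.
  move: y0 y1 y2; rewrite yE !ltr_pM2l// => y0 y1 y2.
  by apply: oD; lra.
- by move=> y /Dc[/andP[y0 y1] y2]; rewrite y0 le_min y1.
Qed.

(** Fraction of the unit interval on the side of u where d (s - u) <= 0. *)
Definition share_ratio (d u : R) : R := if 0 < d then clip u else 1 - clip u.

Lemma lebesgue_shares d e h n u : 0 < h -> d != 0 -> e = d * (h * (u + n%:~R)) ->
  @lebesgue_measure R (share d e h n) = (h * share_ratio d u)%:E /\
  @lebesgue_measure R (unshare d e h n) = (h * (1 - share_ratio d u))%:E.
Proof.
move=> h0 d0 eE; rewrite /share_ratio.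
pose C : set (measurableTypeR R) := `[h * n%:~R, h * (n%:~R + 1)]%classic.
have CE x : C x <-> h * n%:~R <= x <= h * (n%:~R + 1) by rewrite /C/= in_itv/=.
have mC : measurable C by exact: measurable_itv.
have lC : @lebesgue_measure R C = h%:E.
  rewrite (lebesgue_measure_itv `[h * n%:~R, h * (n%:~R + 1)])/= lte_fin ltr_pM2l// ltrDl ltr01.
  by rewrite -EFinB; congr EFin; ring.
have split (D : set (measurableTypeR R)) z : measurable D -> D `<=` C ->
    @lebesgue_measure R D = (h * z)%:E -> @lebesgue_measure R (C `\` D) = (h * (1 - z))%:E.
  move=> mD DC Dz.
  have Cf : (@lebesgue_measure R C < +oo)%E by rewrite lC ltry.
  have := @measureD _ _ _ (@lebesgue_measure R) C D mC mD Cf.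
  rewrite (setIidr DC) => H.
  apply: etrans H (etrans (congr2 (fun x y : \bar R => (x - y)%E) lC Dz) _).
  by rewrite -EFinB; congr EFin; ring.
set w := h * (u + n%:~R) in eE.
have [dp|dn] := ltP 0 d.
  have Sh : share d e h n = C `&` `]-oo, w]%classic.
    apply/seteqP; split => x; rewrite /share/= !in_itv/= => -[xC].
      by rewrite eE ler_pM2l.
    by move=> xw; split => //; rewrite eE ler_pM2l.
  have Un : unshare d e h n = C `\` share d e h n.
    apply/seteqP; split => x; rewrite /unshare/share/= => -[xC H]; split => //.
      by case.
    by move=> H'; apply: H.
  have mS : measurable (share d e h n) by rewrite Sh; apply: measurableI => //; exact: measurable_itv.
  have lS : @lebesgue_measure R (share d e h n) = (h * clip u)%:E.
    apply: (@lebesgue_between_clip h n%:~R u) => //.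
      move=> s s01 su; rewrite /share/= eE ler_pM2l// /w !ler_pM2l//.
      by split; lra.
    by move=> x [xC]; rewrite eE ler_pM2l.
  by split => //; rewrite Un; apply: split => //; rewrite Sh; exact: subIsetl.
have dn' : d < 0 by rewrite lt_neqAle d0.
have Un : unshare d e h n = C `&` `]-oo, w[%classic.
  apply/seteqP; split => x; rewrite /unshare/= !in_itv/= => -[xC].
    by rewrite eE (ler_nM2l dn') => /negP; rewrite -ltNge.
  by move=> xw; split => //; rewrite eE (ler_nM2l dn'); apply/negP; rewrite -ltNge.
have Sh : share d e h n = C `\` unshare d e h n.
  apply/seteqP; split => x; rewrite /unshare/share/= => -[xC H]; split => //.
    by case.
  by apply: contrapT => H'; apply: H.
have mU : measurable (unshare d e h n) by rewrite Un; apply: measurableI => //; exact: measurable_itv.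
have lU : @lebesgue_measure R (unshare d e h n) = (h * clip u)%:E.
  apply: (@lebesgue_between_clip h n%:~R u) => //.
    move=> s s01 su; rewrite /unshare/= eE (ler_nM2l dn') /w !ler_pM2l//.
    by split; [lra|apply/negP; rewrite -ltNge; lra].
  by move=> x [xC]; rewrite eE (ler_nM2l dn') => /negP; rewrite -ltNge => /ltW.
split; last by rewrite lU; congr (_ * _)%:E; ring.
by rewrite Sh; apply: split => //; rewrite Un; exact: subIsetl.
Qed.

Lemma measurable_shares d e h n : measurable (share d e h n) /\ measurable (unshare d e h n).
Proof.
have mf : measurable_fun setT (fun x : measurableTypeR R => d * x).
  by apply: measurable_funM => //.
have mD : measurable [set x : measurableTypeR R | d * x <= e].
  have -> : [set x | d * x <= e] = (fun x : measurableTypeR R => d * x) @^-1` `]-oo, e]%classic.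
    by apply/seteqP; split => x /=; rewrite in_itv.
  by rewrite -[X in measurable X]setTI; apply: mf => //; exact: measurable_itv.
have -> : share d e h n = `[h * n%:~R, h * (n%:~R + 1)]%classic `&` [set x | d * x <= e].
  by apply/seteqP; split => x /=; rewrite /share/= in_itv.
have -> : unshare d e h n = `[h * n%:~R, h * (n%:~R + 1)]%classic `&` ~` [set x | d * x <= e].
  by apply/seteqP; split => x /=; rewrite /unshare/= in_itv.
split; apply: measurableI => //; try exact: measurable_itv.
exact: measurableC.
Qed.

Lemma balanced_perpendicular h t a c b' c' : 0 < h -> a != 0 -> b' != 0 ->
  boundary_line a 0 c `&` cell h t !=set0 -> boundary_line 0 b' c' `&` cell h t !=set0 ->
  half_planes_balanced h t a 0 c 0 b' c'.
Proof.
move=> h0 a0 b0 /(boundary_line_unit h0)[u [u' [u01 _ cE]]] /(boundary_line_unit h0)[v' [v [_ v01 cE']]].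
rewrite mul0r addr0 in cE; rewrite mul0r add0r in cE'.
pose f (i : R) := share_ratio a (u - i).
pose g (j : R) := 1 - share_ratio b' (v - j).
have r01 d z : 0 <= share_ratio d z <= 1.
  by rewrite /share_ratio; case: ifP => _; have := clip_ge0 z; have := clip_le1 z; lra.
have rm d z : 0 <= z <= 1 -> share_ratio d (z - -1) = 0 \/ share_ratio d (z - -1) = 1.
  by move=> z01; rewrite /share_ratio clip_eq1; last lra; case: ifP => _; [right|left; rewrite subrr].
have r1 d z : 0 <= z <= 1 -> share_ratio d (z - 1) = 1 - share_ratio d (z - -1).
  move=> z01; rewrite /share_ratio (clip_eq1 (y := z - -1)); last lra.
  by rewrite clip_eq0; last lra; case: ifP => _; ring.
have cEi (i : int) : c = a * (h * (u - i%:~R + (t.1 + i)%:~R)).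
  by rewrite cE intrD; congr (_ * (_ * _)); ring.
have cEj (j : int) : c' = b' * (h * (v - j%:~R + (t.2 + j)%:~R)).
  by rewrite cE' intrD; congr (_ * (_ * _)); ring.
apply: (@half_planes_balanced_transfer (fun i j => f i * g j) (fun i j => (1 - f i) * (1 - g j))).
- move=> i j; rewrite /piece_area.
  have -> : piece h (t.1 + i, t.2 + j) a 0 c 0 b' c' = share a c h (t.1 + i) `*` unshare b' c' h (t.2 + j).
    apply/seteqP; split => -[x y]; rewrite /piece /share /unshare /half_plane /cell/= !in_itv/= !mul0r addr0 add0r.
      by move=> [[[? ?] ?] ?].
    by move=> [[? ?] [? ?]].
  have [mS mU] := (measurable_shares a c h (t.1 + i), measurable_shares b' c' h (t.2 + j)).
  rewrite area_rect//; [|exact: mS.1|exact: mU.2].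
  have [-> _] := lebesgue_shares h0 a0 (cEi i).
  have [_ ->] := lebesgue_shares h0 b0 (cEj j).
  by rewrite -EFinM /= /f /g; ring.
- move=> i j; rewrite /piece_area.
  have -> : piece h (t.1 + i, t.2 + j) 0 b' c' a 0 c = unshare a c h (t.1 + i) `*` share b' c' h (t.2 + j).
    apply/seteqP; split => -[x y]; rewrite /piece /share /unshare /half_plane /cell/= !in_itv/= !mul0r addr0 add0r.
      by move=> [[[? ?] ?] ?].
    by move=> [[? ?] [? ?]].
  have [mS mU] := (measurable_shares a c h (t.1 + i), measurable_shares b' c' h (t.2 + j)).
  rewrite area_rect//; [|exact: mS.2|exact: mU.1].
  have [_ ->] := lebesgue_shares h0 a0 (cEi i).
  have [-> _] := lebesgue_shares h0 b0 (cEj j).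
  by rewrite -EFinM /= /f /g; ring.
- apply: product_balanced.
  + by move=> i; exact: r01.
  + by move=> i; have := r01 b' (v - i); rewrite /g; lra.
  + exact: rm.
  + exact: r1.
  + by rewrite /g; case: (rm b' v v01) => ->; [right; rewrite subr0|left; rewrite subrr].
  + by rewrite /g r1.
Qed.

(** The coordinates are exchanged when this makes both lines nonvertical,
    puts the half-planes on the same side of their graphs, or brings the product
    of the slopes down to at most 1. *)
Lemma half_planes_balanced_all h t a b c a' b' c' : 0 < h ->
  (a, b) != (0, 0) -> (a', b') != (0, 0) ->
  boundary_line a b c `&` cell h t !=set0 -> boundary_line a' b' c' `&` cell h t !=set0 ->
  half_planes_balanced h t a b c a' b' c'.
Proof.
move=> h0 n0 n0' L L'.
have sw d e f : boundary_line d e f `&` cell h t !=set0 ->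
    boundary_line e d f `&` cell h (t.2, t.1) !=set0.
  by move=> [[x y] [/= l [? ?]]]; exists (y, x); split => //; rewrite /boundary_line/= addrC.
have vert : a != 0 -> a' != 0 -> (a * a' < 0 -> b * b' <= 0 /\ a * a' <= b * b') ->
    half_planes_balanced h t a b c a' b' c'.
  move=> a0 a0' H; apply: half_planes_balanced_swap; apply: balanced_nonvertical => //; exact: sw.
have az : b = 0 -> a != 0 by move=> b0; move: n0; rewrite b0 xpair_eqE eqxx andbT.
have az' : b' = 0 -> a' != 0 by move=> b0; move: n0'; rewrite b0 xpair_eqE eqxx andbT.
have [b0|b0] := eqVneq b 0.
  have a0 := az b0.
  have [a0'|a0'] := eqVneq a' 0; last by apply: vert => // ?; rewrite b0 mul0r; lra.
  have b0' : b' != 0 by move: n0'; rewrite a0' xpair_eqE eqxx.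
  by move: L L'; rewrite b0 a0' => L L'; exact: balanced_perpendicular.
have [b0'|b0'] := eqVneq b' 0.
  have a0' := az' b0'.
  have [a0|a0] := eqVneq a 0; last by apply: vert => // ?; rewrite b0' mulr0; lra.
  apply: half_planes_balancedC.
  by move: L L'; rewrite b0' a0 => L L'; exact: balanced_perpendicular.
have [bb|bb] := ltP (b * b') 0; last first.
  by apply: balanced_nonvertical => // /lt_geF; rewrite bb.
have [aa|aa] := ltP 0 (a * a').
  have a0 : a != 0 by apply: contraTneq aa => ->; rewrite mul0r ltxx.
  have a0' : a' != 0 by apply: contraTneq aa => ->; rewrite mulr0 ltxx.
  by apply: vert => // ?; lra.
have [ba|ab] := leP (b * b') (a * a'); first exact: balanced_nonvertical.
have aa0 : a * a' != 0 by apply: contraTneq ab => ->; rewrite -leNgt ltW.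
move: (aa0); rewrite mulf_eq0 negb_or => /andP[a0 a0'].
by apply: vert => // _; lra.
Qed.

End HalfPlanes.

(** * The stencil as a union of almost disjoint cells *)

Section Mesh.
Context {R : realType}.
Implicit Types (h : R) (t : int * int) (k l : nat) (v w : plane R -> R).

Local Notation cells k l := ('I_(k.*2.+1) * 'I_(l.*2.+1))%type.

Definition stencil_cell h t k l (ij : cells k l) : set (plane R) :=
  cell h (stencil_index t ij.1 ij.2).

Definition open_cell h t : set (plane R) :=
  `]h * t.1%:~R, h * (t.1%:~R + 1)[ `*` `]h * t.2%:~R, h * (t.2%:~R + 1)[.

Lemma measurable_open_cell h t : measurable (open_cell h t).
Proof. by apply: measurableX; exact: measurable_itv. Qed.

Lemma area_cell h t : 0 < h -> area (cell h t : set (plane R)) = (h ^+ 2)%:E.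
Proof.
move=> h0; rewrite /cell area_rect; [|exact: measurable_itv..].
have E (n : int) : @lebesgue_measure R `[h * n%:~R, h * (n%:~R + 1)] = h%:E.
  rewrite (lebesgue_measure_itv `[h * n%:~R, h * (n%:~R + 1)])/= lte_fin ltr_pM2l// ltrDl ltr01.
  by rewrite -EFinB; congr EFin; ring.
by rewrite !E -EFinM expr2.
Qed.

Lemma area_open_cell h t : 0 < h -> area (open_cell h t) = (h ^+ 2)%:E.
Proof.
move=> h0; rewrite /open_cell area_rect; [|exact: measurable_itv..].
have E (n : int) : @lebesgue_measure R `]h * n%:~R, h * (n%:~R + 1)[ = h%:E.
  rewrite (lebesgue_measure_itv `]h * n%:~R, h * (n%:~R + 1)[)/= lte_fin ltr_pM2l// ltrDl ltr01.
  by rewrite -EFinB; congr EFin; ring.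
by rewrite !E -EFinM expr2.
Qed.

Lemma open_cell_sub h t : open_cell h t `<=` cell h t.
Proof.
move=> [x y]; rewrite /open_cell /cell/= !in_itv/=.
by move=> [/andP[/ltW-> /ltW->] /andP[/ltW-> /ltW->]].
Qed.

Lemma cell_boundary0 h t : 0 < h -> area (cell h t `\` open_cell h t : set (plane R)) = 0%E.
Proof.
move=> h0.
have f : (area (cell h t : set (plane R)) < +oo)%E by rewrite area_cell// ltry.
have := measureD (@measurable_cell R h t) (measurable_open_cell h t) f.
rewrite (setIidr (@open_cell_sub h t)) => H.
apply: etrans H (etrans (congr2 (fun x y : \bar R => (x - y)%E) (area_cell t h0) (area_open_cell t h0)) _).
by rewrite subee.
Qed.

Lemma stencilE h t k l :
  stencil h t k l = \big[setU/set0]_(ij : cells k l) (stencil_cell h t ij : set (plane R)).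
Proof.
rewrite -bigcup_seq; apply/seteqP; split => x /=.
  by move=> [i [j xij]]; exists (i, j) => //=; rewrite mem_index_enum.
by move=> [[i j] _ xij]; exists i, j.
Qed.

Lemma measurable_stencil h t k l : measurable (stencil h t k l : set (plane R)).
Proof. by rewrite stencilE; apply: bigsetU_measurable => ij _; exact: measurable_cell. Qed.

Lemma stencil_cell_sub h t k l (ij : cells k l) : stencil_cell h t ij `<=` (stencil h t k l : set (plane R)).
Proof. by move=> x xij; exists ij.1, ij.2. Qed.

Lemma trivIset_open_cells h t k l : 0 < h ->
  trivIset [set: cells k l] (fun ij => open_cell h (stencil_index t ij.1 ij.2)).
Proof.
move=> h0 [i j] [i' j'] _ _ [[x y]] [] /=; rewrite /open_cell/= !in_itv/=.
have E (z : R) (n m : int) : h * n%:~R < z < h * (n%:~R + 1) -> h * m%:~R < z < h * (m%:~R + 1) -> n <= m.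
  move=> /andP[a _] /andP[_ b]; have := lt_trans a b; rewrite ltr_pM2l//.
  by rewrite -[1]/(1%:~R) -intrD ltr_int ltzD1.
move=> [xi yj] [xi' yj'].
have /eqP : t.1 + i%:Z - k%:Z = t.1 + i'%:Z - k%:Z by apply/eqP; rewrite eq_le (E _ _ _ xi xi') (E _ _ _ xi' xi).
have /eqP : t.2 + j%:Z - l%:Z = t.2 + j'%:Z - l%:Z by apply/eqP; rewrite eq_le (E _ _ _ yj yj') (E _ _ _ yj' yj).
rewrite !(inj_eq (addIr _)) !(inj_eq (addrI _)) => /eqP[jj] /eqP[ii].
by congr pair; exact: val_inj.
Qed.

Lemma L1_cell h t k l v : L1 (stencil h t k l) v -> forall ij : cells k l, L1 (stencil_cell h t ij) v.
Proof.
move=> iv ij; apply: (integrableS _ _ _ iv); [exact: measurable_stencil|exact: measurable_cell|].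
exact: stencil_cell_sub.
Qed.

(** The open cells are disjoint and cover the stencil up to a null set. *)
Lemma L1norm_stencil h t k l v : 0 < h -> L1 (stencil h t k l) v ->
  L1norm (stencil h t k l) v = \sum_(i < k.*2.+1) \sum_(j < l.*2.+1) L1norm (cell h (stencil_index t i j)) v.
Proof.
move=> h0 iv.
pose O (ij : cells k l) := open_cell h (stencil_index t ij.1 ij.2).
pose D := \big[setU/set0]_(ij : cells k l) O ij.
have mO ij : measurable (O ij) by exact: measurable_open_cell.
have mD : measurable D by apply: bigsetU_measurable => ij _.
have mS := measurable_stencil h t k l.
have DS : D `<=` stencil h t k l.
  rewrite /D -bigcup_seq => x [ij _ xij]; apply: (@stencil_cell_sub _ _ _ _ ij).
  exact: open_cell_sub.
have N0 : area (stencil h t k l `\` D : set (plane R)) = 0%E.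
  apply/(negligibleP (@area R)); first exact: measurableD.
  have sub : stencil h t k l `\` D `<=`
     \big[setU/set0]_(ij <- index_enum (cells k l)) (stencil_cell h t ij `\` O ij).
    move=> x [[i [j xij]] nD]; rewrite -bigcup_seq; exists (i, j) => /=; first by rewrite mem_index_enum.
    split => // xO; apply: nD; rewrite /D -bigcup_seq; exists (i, j) => //=.
    by rewrite mem_index_enum.
  apply: (negligibleS sub).
  elim: (index_enum _) => [|ij s IH]; first by rewrite big_nil; exact: negligible_set0.
  rewrite big_cons; apply: negligibleU => //.
  apply/(negligibleP (@area R)); first by apply: measurableD => //; exact: measurable_cell.
  exact: cell_boundary0.
have mv : measurable_fun (stencil h t k l) (fun x => `|v x|%:E).
  by move/integrable_norm/measurable_int : iv.
have ET : (\int[@area R]_(x in stencil h t k l) `|v x|%:E = \sum_(ij : cells k l) \int[@area R]_(x in stencil_cell h t ij) `|v x|%:E)%E.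
  rewrite (ge0_negligible_integral _ _ _ _ N0)//; last exact: measurableD.
  rewrite setDD (setIidr DS) /D ge0_integral_bigsetU//.
  - apply: eq_bigr => ij _.
    rewrite [RHS](@ge0_negligible_integral _ _ _ _ _ (stencil_cell h t ij `\` O ij))//.
    + by rewrite setDD (setIidr (@open_cell_sub _ _)).
    + by apply: measurableD => //; exact: measurable_cell.
    + exact: measurable_cell.
    + by apply: measurable_funS mv => //; exact: stencil_cell_sub.
    + exact: cell_boundary0.
  - exact: index_enum_uniq.
  - move=> ij ij' _ _; exact: (@trivIset_open_cells h t k l h0).
  - by apply: measurable_funS mv.
rewrite /L1norm /Rintegral ET pair_bigA/= -sum_fine// => ij _.
by apply: integrable_fin_num; [exact: measurable_cell|exact: integrable_norm (L1_cell iv ij)].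
Qed.

End Mesh.

(** * Stability and near optimality *)

Section Recovery.
Context {R : realType}.
Implicit Types (h C : R) (t : int * int) (k l : nat) (u v w : plane R -> R).

Lemma L1B (A : set (plane R)) u v : measurable A -> L1 A u -> L1 A v -> L1 A (u \- v).
Proof.
move=> mA iu iv; have := integrableB mA iu iv.
by apply: eq_integrable => // x _ /=; rewrite EFinB.
Qed.

Lemma L1norm_triangle (A : set (plane R)) u v w : measurable A -> L1 A u -> L1 A v -> L1 A w ->
  L1norm A (u \- w) <= L1norm A (u \- v) + L1norm A (v \- w).
Proof.
move=> mA iu iv iw.
have iuv : (@area R).-integrable A (EFin \o (fun x => `|(u \- v) x|)) by apply: integrable_norm; exact: L1B.
have ivw : (@area R).-integrable A (EFin \o (fun x => `|(v \- w) x|)) by apply: integrable_norm; exact: L1B.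
have iuw : (@area R).-integrable A (EFin \o (fun x => `|(u \- w) x|)) by apply: integrable_norm; exact: L1B.
rewrite /L1norm -RintegralD//; apply: le_Rintegral => //.
  by have := integrableD mA iuv ivw; apply: eq_integrable.
by move=> x _ /=; exact: ler_distD.
Qed.

Lemma L1norm_subset (A B : set (plane R)) u : measurable A -> measurable B -> A `<=` B -> L1 B u ->
  L1norm A u <= L1norm B u.
Proof.
move=> mA mB AB iu; rewrite /L1norm /Rintegral.
have iB := integrable_norm iu.
apply: fine_le.
- by apply: integrable_fin_num => //; exact: integrableS iB.
- exact: integrable_fin_num.
- by apply: ge0_subset_integral => //; exact: measurable_int iB.
Qed.

Lemma cell_sub_stencil h t k l : cell h t `<=` (stencil h t k l : set (plane R)).
Proof.
move=> x tx; have kk : (k < k.*2.+1)%N by rewrite ltnS -addnn leq_addr.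
have ll : (l < l.*2.+1)%N by rewrite ltnS -addnn leq_addr.
exists (Ordinal kk), (Ordinal ll); rewrite /stencil_index/=.
by rewrite -!addrA !subrr !addr0; case: t tx.
Qed.

Lemma stencil_averagesB h t k l u v : L1 (stencil h t k l) u -> L1 (stencil h t k l) v ->
  stencil_averages h t k l u - stencil_averages h t k l v = stencil_averages h t k l (u \- v).
Proof.
move=> iu iv; apply/matrixP => i j; rewrite !mxE /cell_average -mulrBr -RintegralB//.
- exact: measurable_cell.
- exact: (L1_cell iu (i, j)).
- exact: (L1_cell iv (i, j)).
Qed.

(** Cell by cell, the integral of v is at most that of its absolute value. *)
Lemma stable_stencil h t k l : 0 < h -> @stable R h t k l.
Proof.
move=> h0 v iv; rewrite (L1norm_stencil h0 iv) /ell1 mulr_sumr; apply: ler_sum => i _.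
rewrite mulr_sumr; apply: ler_sum => j _; rewrite !mxE /cell_average area_cell//= normrM.
rewrite ger0_norm ?invr_ge0 ?sqr_ge0// mulVKf ?expf_neq0 ?gt_eqF//.
by apply: le_normr_Rintegral; [exact: measurable_cell|exact: (L1_cell iv (i, j))].
Qed.

(** The Cauchy-Schwarz inequality, read off the sum of the squares of
    [n * x i - s]. *)
Lemma sqr_sum_le (I : finType) (x : I -> R) : (\sum_i x i) ^+ 2 <= #|I|%:R * \sum_i x i ^+ 2.
Proof.
have [n0|n0] := eqVneq (#|I|%:R : R) 0.
  move/eqP : n0; rewrite pnatr_eq0 => /eqP I0.
  by rewrite !big1 ?expr0n ?mulr0// => i; have := fintype0 i I0.
have np : 0 < (#|I|%:R : R) by rewrite lt_neqAle eq_sym n0 ler0n.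
set n : R := #|I|%:R in n0 np *; set s := \sum_i x i.
have : 0 <= \sum_i (n * x i - s) ^+ 2 by apply: sumr_ge0 => i _; exact: sqr_ge0.
have -> : \sum_i (n * x i - s) ^+ 2 = n * (n * \sum_i x i ^+ 2 - s ^+ 2).
  have E i : (n * x i - s) ^+ 2 = n ^+ 2 * x i ^+ 2 + (- (2 * n * s)) * x i + s ^+ 2 by ring.
  rewrite (eq_bigr _ (fun i _ => E i)) !big_split/=.
  have -> : \sum_(i : I) s ^+ 2 = n * s ^+ 2 by rewrite sumr_const /n mulr_natl.
  by rewrite -!mulr_sumr -/s; ring.
by rewrite pmulr_rge0// subr_ge0.
Qed.

Lemma ell1_le_ell2 (p q : nat) (a : 'M[R]_(p, q)) : ell1 a <= Num.sqrt (p * q)%:R * ell2 a.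
Proof.
have e0 : 0 <= ell1 a by apply: sumr_ge0 => i _; apply: sumr_ge0.
rewrite /ell2 -sqrtrM ?ler0n// -[ell1 a]ger0_norm// -sqrtr_sqr.
apply: ler_wsqrtr; rewrite /ell1 !pair_bigA/=.
have := @sqr_sum_le ('I_p * 'I_q)%type (fun ij => `|a ij.1 ij.2|).
by rewrite card_prod !card_ord.
Qed.

Lemma ell2_le_ell1 (p q : nat) (a : 'M[R]_(p, q)) : ell2 a <= ell1 a.
Proof.
have e0 : 0 <= ell1 a by apply: sumr_ge0 => i _; apply: sumr_ge0.
rewrite /ell2 -[ell1 a]ger0_norm// -sqrtr_sqr; apply: ler_wsqrtr.
rewrite /ell1 !pair_bigA/= expr2 mulr_suml; apply: ler_sum => ij _.
rewrite expr2; apply: ler_wpM2l => //.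
by rewrite (bigD1 ij)//= lerDl sumr_ge0.
Qed.

(** The vectors a - c and b - c have a difference a - b whose square norm is, by
    the parallelogram identity, at most twice the sum of theirs. *)
Lemma ell2_closest (p q : nat) (a b c : 'M[R]_(p, q)) :
  ell2 (b - c) <= ell2 (a - c) -> ell2 (a - b) <= 2 * ell2 (a - c).
Proof.
have n0 d : 0 <= \sum_i \sum_j `|(d : 'M[R]_(p, q)) i j| ^+ 2.
  by apply: sumr_ge0 => i _; apply: sumr_ge0 => j _; exact: sqr_ge0.
rewrite /ell2 ler_sqrt// => H.
rewrite -[2]ger0_norm// -sqrtr_sqr -sqrtrM ?sqr_ge0//; apply: ler_wsqrtr.
have : \sum_i \sum_j `|(a - b) i j| ^+ 2 <=
  \sum_i \sum_j (2 * `|(a - c) i j| ^+ 2 + 2 * `|(b - c) i j| ^+ 2).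
  apply: ler_sum => i _; apply: ler_sum => j _; rewrite !mxE !real_normK ?num_real//.
  by rewrite -subr_ge0 (_ : _ - _ = (a i j + b i j - 2 * c i j) ^+ 2) ?sqr_ge0//; ring.
have -> : \sum_i \sum_j (2 * `|(a - c) i j| ^+ 2 + 2 * `|(b - c) i j| ^+ 2) =
    2 * (\sum_i \sum_j `|(a - c) i j| ^+ 2) + 2 * (\sum_i \sum_j `|(b - c) i j| ^+ 2).
  rewrite !mulr_sumr -big_split; apply: eq_bigr => i _ /=.
  by rewrite !mulr_sumr -big_split.
lra.
Qed.

(** The bound is proved for each v of the family and passes to the infimum. *)
Lemma near_optimal_stable h t k l (V : set (plane R -> R)) C : 0 < h ->
  V `<=` L1 (stencil h t k l) -> 0 <= C -> stable h t k l -> inverse_stable h t k l V C ->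
  near_optimal h t k l V (1 + 2 * C * Num.sqrt (stencil_card k l)%:R).
Proof.
move=> h0 VL C0 st ist u w iu [Vw wmin].
set S := stencil h t k l; set K := 1 + _.
have mS : measurable S by exact: measurable_stencil.
have sm0 : 0 <= Num.sqrt ((stencil_card k l)%:R : R) by exact: sqrtr_ge0.
have K0 : 0 < K by rewrite /K ltr_wpDr// mulr_ge0// mulr_ge0.
have key v : V v -> L1norm (cell h t) (u \- w) <= K * L1norm S (u \- v).
  move=> Vv; have iv := VL v Vv; have iw := VL w Vw.
  apply: (@le_trans _ _ (L1norm S (u \- w))).
    by apply: L1norm_subset => //; [exact: measurable_cell|exact: cell_sub_stencil|exact: L1B].
  apply: le_trans (L1norm_triangle mS iu iv iw) _.
  rewrite /K mulrDl mul1r lerD2l; apply: le_trans (ist v w Vv Vw) _.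
  set a := stencil_averages h t k l in wmin *.
  have h1 : ell1 (a v - a w) <= Num.sqrt (stencil_card k l)%:R * (2 * ell1 (a v - a u)).
    apply: le_trans (ell1_le_ell2 _) _; apply: ler_wpM2l => //.
    apply: le_trans (ell2_closest (wmin v Vv)) _.
    by apply: ler_wpM2l => //; exact: ell2_le_ell1.
  have h2 : h ^+ 2 * ell1 (a v - a u) <= L1norm S (u \- v).
    have -> : ell1 (a v - a u) = ell1 (a (u \- v)).
      rewrite /a -stencil_averagesB//; apply: eq_bigr => i _; apply: eq_bigr => j _.
      by rewrite -[in RHS]opprB [in RHS]mxE normrN.
    by apply: st; exact: L1B.
  apply: (@le_trans _ _ (C * h ^+ 2 * (Num.sqrt (stencil_card k l)%:R * (2 * ell1 (a v - a u))))).
    by apply: ler_wpM2l => //; rewrite mulr_ge0// sqr_ge0.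
  have -> : C * h ^+ 2 * (Num.sqrt (stencil_card k l)%:R * (2 * ell1 (a v - a u))) =
    2 * C * Num.sqrt (stencil_card k l)%:R * (h ^+ 2 * ell1 (a v - a u)) by ring.
  by apply: ler_wpM2l => //; rewrite mulr_ge0// mulr_ge0.
rewrite -ler_pdivrMl//; apply: lb_le_inf; first by exists (L1norm S (u \- w)), w.
by move=> _ [v Vv <-]; rewrite ler_pdivrMl//; exact: key.
Qed.

Lemma unit_vector_angle (x y : R) : x ^+ 2 + y ^+ 2 = 1 -> exists th : R, cos th = x /\ sin th = y.
Proof.
move=> xy.
have x1 : -1 <= x <= 1.
  have y0 := sqr_ge0 y; have : x ^+ 2 <= 1 by lra.
  by move=> ?; apply/andP; split; nra.
have cE : cos (acos x) = x by rewrite acosK// in_itv.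
have sE : sin (acos x) = `|y|.
  by rewrite sin_acos// -sqrtr_sqr; congr Num.sqrt; lra.
have [y0|y0] := leP 0 y.
  by exists (acos x); rewrite cE sE ger0_norm.
by exists (- acos x); rewrite cosN sinN cE sE ltr0_norm// opprK.
Qed.

Lemma half_plane_scale (r a b c : R) : 0 < r -> half_plane (r * a) (r * b) (r * c) = half_plane a b c.
Proof.
by move=> r0; apply/seteqP; split => x; rewrite /half_plane/= -!mulrA -mulrDr ler_pM2l.
Qed.

Lemma boundary_line_scale (r a b c : R) : r != 0 -> boundary_line (r * a) (r * b) (r * c) = boundary_line a b c.
Proof.
move=> r0; apply/seteqP; split => x; rewrite /boundary_line/= -!mulrA -mulrDr; first exact: mulfI.
by move=> ->.
Qed.

(** The parameters are the angle of the unit normal of the half-plane and its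
    offset. *)
Lemma parametric_lvira h t : @parametric_family R 2 (lvira_family h t).
Proof.
pose O (p : 'rV[R]_2) : set (plane R) := half_plane (cos (p 0 0)) (sin (p 0 0)) (p 0 1).
exists [set p | boundary_line (cos (p 0 0)) (sin (p 0 0)) (p 0 1) `&` cell h t !=set0], O.
apply/seteqP; split => v /=.
  move=> [a [b [c [ab meet ->]]]].
  have n0 : 0 < a ^+ 2 + b ^+ 2.
    rewrite lt_neqAle eq_sym addr_ge0 ?sqr_ge0// andbT paddr_eq0 ?sqr_ge0// !sqrf_eq0.
    by rewrite -xpair_eqE.
  set r := Num.sqrt (a ^+ 2 + b ^+ 2).
  have r0 : 0 < r by rewrite sqrtr_gt0.
  have rE : r ^+ 2 = a ^+ 2 + b ^+ 2 by rewrite sqr_sqrtr// ltW.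
  have [th [cE sE]] : exists th, cos th = a / r /\ sin th = b / r.
    apply: unit_vector_angle; rewrite !expr_div_n -mulrDl -rE divff//.
    by rewrite expf_neq0// gt_eqF.
  have scale z : r * (z / r) = z by rewrite mulrC divfK// gt_eqF.
  exists (\row_j (if j == 0 then th else c / r)); rewrite /O !mxE /= cE sE.
    by rewrite -(@boundary_line_scale r) ?gt_eqF// !scale.
  by rewrite -(half_plane_scale _ _ _ r0) !scale.
move=> [p meet <-]; exists (cos (p 0 0)), (sin (p 0 0)), (p 0 1); split => //.
apply/negP; rewrite xpair_eqE => /andP[/eqP c0 /eqP s0].
have := cos2Dsin2 (p 0 0); rewrite c0 s0 expr0n addr0 => /esym/eqP.
by rewrite oner_eq0.
Qed.

End Recovery.

(** * Inverse stability of the LVIRA family *)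

Section Lvira.
Context {R : realType}.
Implicit Types (h a b c : R) (t : int * int) (k l : nat).

Lemma area_stencil_lty h t k l : 0 < h -> (area (stencil h t k l : set (plane R)) < +oo)%E.
Proof.
move=> h0; rewrite stencilE; elim: (index_enum _) => [|ij s IH].
  have e : area (set0 : set (plane R)) = 0%E by exact: (measure0 (@area R)).
  by rewrite big_nil; have := ltry (0 : R); rewrite -[0%:E]/(0%E : \bar R) -[X in (X < _)%E]e.
rewrite big_cons; set A := \big[_/_]_(i <- s) _ in IH *.
have mA : measurable A by apply: bigsetU_measurable => *; exact: measurable_cell.
have U : (area (stencil_cell h t ij `|` A) <= (h ^+ 2)%:E + area A)%E.
  rewrite -(area_cell (stencil_index t ij.1 ij.2) h0).
  by apply: (@measureU2 _ _ _ (@area R)) => //; exact: measurable_cell.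
by apply: le_lt_trans U _; apply: lte_add_pinfty => //; exact: ltry.
Qed.

Lemma L1_indic (D A : set (plane R)) : measurable D -> (area D < +oo)%E -> measurable A ->
  L1 D \1_A.
Proof.
move=> mD fD mA; apply: measurable_bounded_integrable => //.
exists 1; split => // M M1 x _ /=; rewrite ger0_norm// indicE.
by rewrite (le_trans _ (ltW M1))//; case: (_ \in _).
Qed.

Lemma Rintegral_indic (A D : set (plane R)) : measurable A -> measurable D ->
  \int[@area R]_(x in D) (\1_A x) = fine (area (D `&` A)).
Proof. by move=> mA mD; rewrite /Rintegral integral_indic// setIC. Qed.

(** The difference of the indicator functions is the difference of those of
    two disjoint sets. *)
Lemma Rintegral_indicB h Q a b c a' b' c' : 0 < h ->
  let v := \1_(half_plane a b c) : plane R -> R in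
  let w := \1_(half_plane a' b' c') : plane R -> R in
  let p := fine (area (piece h Q a b c a' b' c')) in
  let q := fine (area (piece h Q a' b' c' a b c)) in
  \int[@area R]_(x in cell h Q) (v x - w x) = p - q /\
  L1norm (cell h Q) (v \- w) = p + q.
Proof.
move=> h0 v w p q.
pose H := (half_plane a b c : set (plane R)); pose H' := (half_plane a' b' c' : set (plane R)).
have mH : measurable H by exact: measurable_half_plane.
have mH' : measurable H' by exact: measurable_half_plane.
have mD : measurable (H `\` H') by exact: measurableD.
have mD' : measurable (H' `\` H) by exact: measurableD.
have mC : measurable (cell h Q : set (plane R)) by exact: measurable_cell.
have iI (A : set (plane R)) : measurable A -> (@area R).-integrable (cell h Q) (EFin \o \1_A).
  by move=> mA; apply: L1_indic => //; rewrite area_cell// ltry.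
have pE : p = \int[@area R]_(x in cell h Q) \1_(H `\` H') x by rewrite Rintegral_indic// setDE setIA.
have qE : q = \int[@area R]_(x in cell h Q) \1_(H' `\` H) x by rewrite Rintegral_indic// setDE setIA.
have B x : v x - w x = \1_(H `\` H') x - \1_(H' `\` H) x /\
    `|v x - w x| = \1_(H `\` H') x + \1_(H' `\` H) x.
  rewrite /v /w !indicE !in_setD -/H -/H'; case: (x \in H); case: (x \in H') => /=;
  rewrite ?subrr ?subr0 ?sub0r ?addr0 ?add0r ?normr0 ?normrN ?normr1; by split.
rewrite pE qE; split.
  by rewrite -RintegralB//; try exact: iI; apply: eq_Rintegral => x _; have [] := B x.
rewrite /L1norm -RintegralD//; try exact: iI.
by apply: eq_Rintegral => x _; have [] := B x.
Qed.

Lemma sum_ord_isum3 (F : int -> R) : \sum_(i < 1.*2.+1) F (i%:Z - 1%:Z) = isum3 F.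
Proof. by rewrite /isum3 !big_ord_recl big_ord0 /= addr0 addrA; congr (F _ + F _ + F _). Qed.

Lemma inverse_stable_lvira h t : 0 < h ->
  inverse_stable h t 1 1 (@lvira_family R h t) (3 / 2).
Proof.
move=> h0 v w [a [b [c [ab L ->]]]] [a' [b' [c' [ab' L' ->]]]].
have iH d e f : L1 (stencil h t 1 1) (\1_(half_plane d e f) : plane R -> R).
  apply: L1_indic; [exact: measurable_stencil|exact: area_stencil_lty|].
  exact: measurable_half_plane.
have scaled (x : R) : h ^+ 2 * `|(h ^+ 2)^-1 * x| = `|x|.
  by rewrite normrM ger0_norm ?invr_ge0 ?sqr_ge0// mulVKf// expf_neq0// gt_eqF.
pose P := piece_area h t a b c a' b' c'; pose Q := piece_area h t a' b' c' a b c.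
have idx (i : 'I_(1.*2.+1)) (j : 'I_(1.*2.+1)) :
    stencil_index t i j = (t.1 + (i%:Z - 1%:Z), t.2 + (j%:Z - 1%:Z)) by rewrite /stencil_index !addrA.
rewrite L1norm_stencil//; last by apply: L1B => //; exact: measurable_stencil.
have -> : \sum_(i < 1.*2.+1) \sum_(j < 1.*2.+1)
    L1norm (cell h (stencil_index t i j)) (\1_(half_plane a b c) \- \1_(half_plane a' b' c')) =
    isum3 (fun i => isum3 (fun j => P i j + Q i j)).
  rewrite -sum_ord_isum3; apply: eq_bigr => i _; rewrite -sum_ord_isum3; apply: eq_bigr => j _.
  by have [_ ->] := @Rintegral_indicB h (stencil_index t i j) a b c a' b' c' h0; rewrite /P /Q /piece_area -idx.
have -> : 3 / 2 * h ^+ 2 * ell1 (stencil_averages h t 1 1 \1_(half_plane a b c) -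
      stencil_averages h t 1 1 \1_(half_plane a' b' c')) =
    3 / 2 * isum3 (fun i => isum3 (fun j => `|P i j - Q i j|)).
  rewrite -mulrA; congr (_ * _); rewrite stencil_averagesB//.
  rewrite /ell1 mulr_sumr -sum_ord_isum3; apply: eq_bigr => i _.
  rewrite mulr_sumr -sum_ord_isum3; apply: eq_bigr => j _; rewrite !mxE /cell_average area_cell//=.
  have [-> _] := @Rintegral_indicB h (stencil_index t i j) a b c a' b' c' h0.
  rewrite /P /Q /piece_area -idx; exact: scaled.
have := half_planes_balanced_all h0 ab ab' L L'.
rewrite /half_planes_balanced -/P -/Q.
have dist (x y : R) : `|x - y| = x + y - 2 * Num.min x y.
  by case: (leP x y) => xy; [rewrite ler0_norm|rewrite gtr0_norm]; lra.
move: P Q => P Q; rewrite /isum3 !dist; lra.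
Qed.

Lemma lvira_L1 h t k l : 0 < h -> @lvira_family R h t `<=` L1 (stencil h t k l).
Proof.
move=> h0 v [a [b [c [_ _ ->]]]]; apply: L1_indic; [exact: measurable_stencil| |].
  exact: area_stencil_lty.
exact: measurable_half_plane.
Qed.

End Lvira.

Theorem theorem3p2 (R : realType) :
  (forall (h : R) (t : int * int) (k l n : nat) (V : set (plane R -> R))
      (C : R),
    0 < h -> (1 <= k)%N -> (1 <= l)%N ->
    parametric_family n V ->
    V `<=` L1 (stencil h t k l) ->
    stable h t k l ->
    0 <= C ->
    inverse_stable h t k l V C ->
    near_optimal h t k l V (1 + 2 * C * Num.sqrt (stencil_card k l)%:R))
  /\
  (forall (h : R) (t : int * int),
    0 < h ->
    [/\ parametric_family 2 (lvira_family h t),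
        lvira_family h t `<=` L1 (stencil h t 1 1),
        inverse_stable h t 1 1 (lvira_family h t) (3 / 2)
      & near_optimal h t 1 1 (lvira_family h t)
          (1 + 2 * (3 / 2) * Num.sqrt 9)])
  /\ 1 + 2 * (3 / 2) * Num.sqrt 9 = 10 :> R.
Proof.
split; first by move=> h t k l n V C h0 _ _ _ VL st C0 ist; exact: near_optimal_stable.
split.
  move=> h t h0; have VL := @lvira_L1 R h t 1 1 h0.
  have ist := @inverse_stable_lvira R h t h0.
  split => //; first exact: parametric_lvira.
  apply: near_optimal_stable => //; exact: stable_stencil.
have -> : 9 = 3 ^+ 2 :> R by ring.
by rewrite sqrtr_sqr ger0_norm//; lra.
Qed.
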